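(* Let $G$ be a planar graph and let $r$ be an integer with $r\ge\max\{9,\Delta(G)\}$. Then $G$ is equitably $r$-choosable.
   Context: Graphs are finite and simple; $|G|$ is the number of vertices and $\Delta(G)$ the maximum degree of $G$. An $r$-list assignment $L$ for $G$ assigns to each vertex $v$ a set $L(v)$ of exactly $r$ colors. An $L$-coloring of $G$ is a proper coloring $f$ of $G$ with $f(v)\in L(v)$ for every vertex $v$. An $L$-coloring (for an $r$-list assignment $L$) is equitable if every color class has size at most $\lceil |G|/r\rceil$. A graph $G$ is equitably $r$-choosable if it has an equitable $L$-coloring for every $r$-list assignment $L$. *)

(* Defs.v *)
From mathcomp Require Import all_boot all_order all_algebra.
From mathcomp Require Import finmap reals.

Set Implicit Arguments.
Unset Strict Implicit.
Unset Printing Implicit Defensive.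

Import Order.TTheory GRing.Theory Num.Theory.

Record sgraph := SGraph {
  vertex :> finType;
  adj : rel vertex;
  adj_sym : symmetric adj;
  adj_irr : irreflexive adj }.

Definition max_degree (G : sgraph) : nat :=
  \max_(v : G) #|[set w | adj v w]|.

(* The ceiling of n / r, for r > 0. *)
Definition ceil_div (n r : nat) : nat := (n + r.-1) %/ r.

Section ListColoring.
Variables (G : sgraph) (C : choiceType).
Implicit Types (L : G -> {fset C}) (f : G -> C).

Definition list_assignment (r : nat) L : Prop := forall v, #|` L v| = r.

Definition list_coloring L f : Prop :=
  (forall u v, adj u v -> f u != f v) /\ (forall v, f v \in L v).

Definition equitable (r : nat) f : Prop :=
  forall c, #|[set v | f v == c]| <= ceil_div #|G| r.

End ListColoring.

Definition equitably_choosable (G : sgraph) (r : nat) : Prop :=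
  forall (C : choiceType) (L : G -> {fset C}), list_assignment r L ->
  exists f : G -> C, list_coloring L f /\ equitable r f.

Section Planarity.
Variable R : realType.
Local Open Scope ring_scope.
Implicit Types (a b x : 'rV[R]_2) (s : seq 'rV[R]_2).

Definition on_segment a b x : Prop :=
  exists2 t : R, 0 <= t <= 1 & x = (1 - t) *: a + t *: b.

(* A polygonal curve is given by the sequence s of its corners, end points
   included; its segments join s`_i to s`_i.+1. *)
Definition on_polyline s x : Prop :=
  exists2 i : nat, (i.+1 < size s)%N & on_segment s`_i s`_i.+1 x.

(* The curve is an arc: distinct segments meet only in the corner shared by
   two successive ones. *)
Definition simple_polyline s : Prop :=
  uniq s /\
  forall (i j : nat) x, (i < j)%N -> (j.+1 < size s)%N ->
    on_segment s`_i s`_i.+1 x -> on_segment s`_j s`_j.+1 x ->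
    j = i.+1 /\ x = s`_j.

Section Drawing.
Variables (G : sgraph) (pt : G -> 'rV[R]_2) (bends : G -> G -> seq 'rV[R]_2).

Definition route (u v : G) : seq 'rV[R]_2 := pt u :: rcons (bends u v) (pt v).

(* A drawing of G in the plane without crossings, edges being drawn as
   polygonal arcs. An edge is a single unoriented arc, listed from u to v
   by route u v and from v to u by route v u. *)
Definition plane_drawing : Prop :=
  [/\ injective pt,
      forall u v, adj u v -> bends v u = rev (bends u v),
      forall u v, adj u v -> simple_polyline (route u v),
      forall u v w, adj u v -> on_polyline (route u v) (pt w) ->
        w \in [set u; v]
    & forall u v u' v' x, adj u v -> adj u' v' ->
        [set u; v] != [set u'; v'] ->
        on_polyline (route u v) x -> on_polyline (route u' v') x ->
        exists2 w, w \in [set u; v] :&: [set u'; v'] & x = pt w].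

End Drawing.

(* Polygonal arcs are the usual textbook convention (Diestel, West); they
   yield the same planar graphs as arbitrary continuous arcs. *)
Definition planar (G : sgraph) : Prop :=
  exists (pt : G -> 'rV[R]_2) (bends : G -> G -> seq 'rV[R]_2),
    plane_drawing pt bends.

End Planarity.

(* Main.v *)
Require Import Defs.
From mathcomp Require Import all_boot all_order all_algebra.
From mathcomp Require Import finmap reals.
From mathcomp Require Import boolp zify ring lra.

(* Let G be planar with n vertices, s = ceil(n / r), and colour the vertices one by
   one, always adding a vertex x with few neighbours among the coloured ones. If x
   cannot be added, call a colour reachable when a chain of moves of single vertices
   between classes leads from it to a class with fewer than s vertices, and stuck
   otherwise. Stuck classes are full, and each vertex in them has a neighbour in
   each reachable class of its list. With b stuck colours this gives b (r - b) s
   edges of a bipartite planar graph on fewer than r s vertices, whence b <= 2 or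
   b >= r - 2; and b <= 2 would allow x to be added. When b >= r - 2, double counting
   yields a vertex z outside the stuck classes that is, for many vertices of the
   stuck classes, the only obstacle to entering the class of z. Moving z into a
   stuck class in exchange for one or two of those vertices decreases b or leaves
   room for x.

   The edge bounds for planar graphs come from linear algebra over F_2. For each
   even set of edges of a drawing and each side of each edge, record the parity of
   the number of selected edges above a point next to that side. This parity is the
   same along a face, so the cycle space together with the constant function embeds
   into the functions on faces: there are at least |E| - |V| + 2 faces. *)

Set Implicit Arguments.
Unset Strict Implicit.
Unset Printing Implicit Defensive.

Import Order.TTheory GRing.Theory Num.Theory.

(** * Equitable list colourings of sparse graphs *)

(** The number 9 is where the counts become tight. For 3 <= q <= r - 3 the product q (r - q) is at
    least 3 (r - 3), and this reaches 2 r, which planarity forbids, from r = 9 on. The averages that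
    produce [z] compare 4 (r - 2) with 2 (r + 5), 2 (r - 1) with r + 7, and 2 r - 3 with r + 6:
    equality at r = 9 each time. The obstacle is the end b >= r - 2, where the edge bound is silent.
    The degree bound takes over: a [z] that cannot be moved has neighbours in nearly all reachable
    classes of its list, so little of its degree is left for the stuck classes, and around it the
    stuck colours of its list are repeated only a few times. Planarity returns by excluding K_{3,3}:
    among five vertices that wait for the place of [z], two are non-adjacent, and these can enter
    its class together once [z] has left. Faces are never built as regions: a face is a set of edge
    sides on which all parities agree. *)

Section PartialColorings.
Variables (V K : finType) (e : rel V) (L : V -> {set K}).
Hypotheses (e_sym : symmetric e) (e_irr : irreflexive e).
Implicit Types (f g : {ffun V -> option K}) (c d : K) (u v w x y z : V).

(** * Partial list colourings and recolouring *)

Definition nbr v := [set u | e v u].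
Definition cls f c := [set v | f v == Some c].
Definition dom f := [set v | isSome (f v)].
Definition lcoloring f :=
  (forall u v c, e u v -> f u = Some c -> f v <> Some c) /\
  (forall v c, f v = Some c -> c \in L v).
Definition free f v c := (c \in L v) && [disjoint nbr v & cls f c].
Definition move f c d := (c != d) && [exists w in cls f c, free f w d].
Definition move_in (Q : {set K}) f c d := [&& c \in Q, d \in Q & move f c d].

Lemma in_nbr v u : (u \in nbr v) = e v u.
Proof. by rewrite inE. Qed.

Lemma in_cls f c v : (v \in cls f c) = (f v == Some c).
Proof. by rewrite inE. Qed.

Lemma in_dom f v : (v \in dom f) = isSome (f v).
Proof. by rewrite inE. Qed.

Lemma not_free f v c :
  c \in L v -> ~~ free f v c -> exists2 u, e v u & f u = Some c.
Proof.
rewrite /free => -> /=; rewrite -setI_eq0 => /set0Pn[u].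
by rewrite !inE => /andP[evu /eqP fu]; exists u.
Qed.

Lemma freeP f v c u : free f v c -> e v u -> f u <> Some c.
Proof.
case/andP=> _ /disjointFr dis evu fu.
by have := dis u; rewrite !inE fu eqxx => /(_ evu).
Qed.

Lemma free_eq_cls f g v c : cls g c = cls f c -> free g v c = free f v c.
Proof. by rewrite /free => ->. Qed.

Lemma move_eq_cls f g c d :
  cls g c = cls f c -> cls g d = cls f d -> move g c d = move f c d.
Proof. by rewrite /move /free => -> ->. Qed.

Lemma Some_eqF (c d : K) : d != c -> (Some c == Some d) = (None == Some d).
Proof. by move=> dc; rewrite (inj_eq Some_inj) eq_sym (negPf dc). Qed.

Definition recolor f v (o : option K) : {ffun V -> option K} :=
  [ffun u => if u == v then o else f u].

Lemma cls_recolor f v c d :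
  cls (recolor f v (Some c)) d = if d == c then v |: cls f d else cls f d :\ v.
Proof.
apply/setP=> u; have [->|dc] := eqVneq d c; rewrite !inE ffunE;
  have [//|uv] := eqVneq u v; by rewrite ?eqxx ?Some_eqF.
Qed.

Lemma cls_erase f v d : cls (recolor f v None) d = cls f d :\ v.
Proof. by apply/setP=> u; rewrite !inE ffunE; have [|] := eqVneq u v. Qed.

Lemma dom_recolor f v c : dom (recolor f v (Some c)) = v |: dom f.
Proof. by apply/setP=> u; rewrite !inE ffunE; have [|] := eqVneq u v. Qed.

Lemma dom_erase f v : dom (recolor f v None) = dom f :\ v.
Proof. by apply/setP=> u; rewrite !inE ffunE; have [|] := eqVneq u v. Qed.

Lemma lcoloring_cls f :
  (forall u v c, e u v -> u \in cls f c -> v \notin cls f c) ->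
  (forall v c, v \in cls f c -> c \in L v) -> lcoloring f.
Proof.
move=> P1 P2; split=> [u v c euv fu fv|v c fv]; last by apply: P2; rewrite in_cls fv.
by have := P1 u v c euv; rewrite !in_cls fu fv eqxx => /(_ isT).
Qed.

Lemma lcoloring_erase f v : lcoloring f -> lcoloring (recolor f v None).
Proof.
case=> Pf Lf; apply: lcoloring_cls => [u w c euw|u c]; rewrite cls_erase !inE.
  by case/andP=> _ /eqP fu; rewrite negb_and; apply/orP; right; apply/eqP/(Pf u).
by case/andP=> _ /eqP; apply: Lf.
Qed.

Lemma lcoloring_recolor f v c :
  lcoloring f -> free f v c -> lcoloring (recolor f v (Some c)).
Proof.
move=> [Pf Lf] fr; split=> [u w c' euw|u c']; rewrite !ffunE.
  have [uv|_] := eqVneq u v; have [wv|_] := eqVneq w v.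
  - by move: euw; rewrite uv wv e_irr.
  - by case=> <-; apply: (freeP fr); rewrite -uv.
  - by move=> fu [cc]; apply: (freeP fr (u := u)); rewrite ?cc // e_sym -wv.
  exact: Pf.
by have [-> [<-]|_] := eqVneq u v; [case/andP: fr | apply: Lf].
Qed.

Lemma freeS f g v c : cls g c \subset cls f c -> free f v c -> free g v c.
Proof.
move=> sub /andP[cL dis]; rewrite /free cL /=.
by rewrite disjoint_sym (disjointWl sub) // disjoint_sym.
Qed.

Lemma cls_none f v c : f v = None -> v \notin cls f c.
Proof. by rewrite in_cls => ->. Qed.

(** * Shifting vertices along chains of moves *)

(** Each vertex pushed out of a class is the one to be inserted into the next, so only the last
    class grows. Since no colour repeats, the rest of the chain still has its original classes when
    the displaced vertex arrives. *)
Lemma shift_path f v c p :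
    lcoloring f -> f v = None -> free f v c -> path (move f) c p -> uniq (c :: p) ->
  exists g, [/\ lcoloring g, dom g = v |: dom f,
    forall d, #|cls g d| = #|cls f d| + (d == last c p) &
    forall d, d \notin c :: p -> cls g d = cls f d].
Proof.
elim: p f v c => [|c1 p IH] f v c Pf fv fr /=.
  move=> _ _; exists (recolor f v (Some c)); split.
  - exact: lcoloring_recolor.
  - exact: dom_recolor.
  - move=> d; rewrite cls_recolor; case: eqP => _.
      by rewrite cardsU1 cls_none // addnC.
    by rewrite [in RHS](cardsD1 v) (negPf (cls_none _ fv)) addn0.
  - move=> d; rewrite inE cls_recolor => /negPf ->.
    by apply/setDidPl; rewrite disjoint_sym disjoints1 cls_none.
case/andP=> /andP[cc1 /exists_inP[w]]; rewrite in_cls => /eqP fw frw pth.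
case/and3P=> cp c1p up.
have wv : w != v by apply: contraTneq isT => wv; move: fw; rewrite wv fv.
(* [w] cedes its place to [v] and becomes the uncoloured vertex of the induction. *)
pose f1 := recolor (recolor f w None) v (Some c).
have cls1 d : d != c -> cls f1 d = cls f d.
  move=> dc; rewrite cls_recolor (negPf dc) cls_erase; apply/setP=> u.
  rewrite !inE; have [->|_] := eqVneq u v; first by rewrite fv.
  by have [->|//] := eqVneq u w; rewrite fw Some_eqF.
have Pf1 : lcoloring f1.
  apply: lcoloring_recolor; first exact: lcoloring_erase.
  by apply: freeS fr; rewrite cls_erase subD1set.
have f1w : f1 w = None by rewrite !ffunE (negPf wv) eqxx.
have fr1 : free f1 w c1 by rewrite (free_eq_cls _ (cls1 _ _)) // eq_sym.
have pth1 : path (move f1) c1 p.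
  rewrite (@eq_in_path _ (mem (c1 :: p)) _ (move f)) //; last first.
    by apply/allP.
  move=> a b ain bin; apply: move_eq_cls; apply: cls1.
    by apply: contraNneq cp => <-.
  by apply: contraNneq cp => <-.
have [|g [Pg dg sg og]] := IH f1 w c1 Pf1 f1w fr1 pth1; first by rewrite /= c1p.
exists g; split=> //.
- rewrite dg dom_recolor dom_erase; apply/setP=> u; rewrite !inE.
  by have [->|] := eqVneq u w; rewrite ?fw ?orbT.
- move=> d; rewrite sg; congr (_ + _).
  have [->|dc] := eqVneq d c; last by rewrite cls1.
  rewrite cls_recolor eqxx cls_erase cardsU1 !inE fv andbF.
  by rewrite [in RHS](cardsD1 w) in_cls fw eqxx.
move=> d; rewrite !inE !negb_or => /and3P[dc dc1 dp].
by rewrite og ?inE ?negb_or ?dc1 // cls1.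
Qed.

(** Confining the chain to [Q] leaves all classes outside [Q] intact. *)
Lemma shift_connect (Q : {set K}) f v c d :
    lcoloring f -> f v = None -> free f v c -> c \in Q ->
    connect (move_in Q f) c d ->
  exists g, [/\ lcoloring g, dom g = v |: dom f,
    forall c', #|cls g c'| = #|cls f c'| + (c' == d) &
    forall c', c' \notin Q -> cls g c' = cls f c'].
Proof.
move=> Pf fv fr cQ /connectP[p0 pth0 ->].
case/shortenP: pth0 => p pth up _.
have pQ : {subset c :: p <= Q}.
  apply/allP; elim: p c {p0 fr up} cQ pth => [|a p IH] c cQ; rewrite /= cQ //.
  by case/andP=> /and3P[_ aQ _] /(IH _ aQ).
have pth' : path (move f) c p.
  by apply: sub_path pth => a b /and3P[].
have [g [Pg dg sg og]] := shift_path Pf fv fr pth' up.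
by exists g; split=> // c' /(contra (pQ c')); apply: og.
Qed.

Implicit Types (Q : {set K}).

Definition colored f (Q : {set K}) := \bigcup_(c in Q) cls f c.

Lemma coloredP f Q v : reflect (exists2 c, c \in Q & f v = Some c) (v \in colored f Q).
Proof.
apply: (iffP bigcupP) => [[c cQ]|[c cQ fv]].
  by rewrite in_cls => /eqP fv; exists c.
by exists c => //; rewrite in_cls fv.
Qed.

Lemma colored_Some f Q v c : f v = Some c -> (v \in colored f Q) = (c \in Q).
Proof.
move=> fv; apply/coloredP/idP => [[d dQ]|cQ]; last by exists c.
by rewrite fv => -[->].
Qed.

Lemma coloredS f Q Q' : Q \subset Q' -> colored f Q \subset colored f Q'.
Proof.
move=> /subsetP sQ; apply/subsetP=> v /coloredP[c cQ fv].
by rewrite (colored_Some _ fv) sQ.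
Qed.

Lemma colored_dom f Q : colored f Q \subset dom f.
Proof. by apply/subsetP=> v /coloredP[c _ fv]; rewrite in_dom fv. Qed.

Lemma coloredC f Q : colored f (~: Q) = dom f :\: colored f Q.
Proof.
apply/setP=> v; rewrite inE in_dom; case fv: (f v) => [c|].
  by rewrite !(colored_Some _ fv) inE andbT.
by apply/negP; rewrite andbF => -[] /coloredP[c _]; rewrite fv.
Qed.

Lemma eq_colored f g Q :
  (forall c, c \in Q -> cls g c = cls f c) -> colored g Q = colored f Q.
Proof. by move=> eqc; apply: eq_bigr. Qed.

Lemma sum_colored f Q (F : V -> nat) :
  \sum_(v in colored f Q) F v = \sum_(c in Q) \sum_(v in cls f c) F v.
Proof.
rewrite (exchange_big_dep (mem (colored f Q))) /=; last first.
  by move=> c v cQ; rewrite in_cls => /eqP fv; rewrite (colored_Some _ fv).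
apply: eq_bigr => v /coloredP[c cQ fv].
rewrite (bigD1 c) ?cQ ?in_cls ?fv //= big_pred0 ?addn0 // => d.
by rewrite in_cls fv (inj_eq Some_inj) eq_sym; case: eqP => [->|_]; rewrite ?andbF.
Qed.

Lemma card_colored f Q : #|colored f Q| = \sum_(c in Q) #|cls f c|.
Proof.
by rewrite -sum1_card sum_colored; apply: eq_bigr => c _; rewrite sum1_card.
Qed.

(** The labelling is kept apart from the colouring because [doubled_color] relabels one vertex. *)
Lemma card_labels (lab : V -> option K) (W : {set V}) (S : {set K}) :
  (forall c, c \in S -> exists2 u, u \in W & lab u = Some c) -> #|S| <= #|W|.
Proof.
move=> wit; rewrite -(card_imset _ Some_inj); apply: leq_trans (leq_imset_card lab W).
apply/subset_leq_card/subsetP=> o /imsetP[c cS ->].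
by have [u uW labu] := wit c cS; rewrite -labu imset_f.
Qed.

(** * Reachable and stuck colours *)

Variables r s : nat.

Definition reaches f c := [exists d, (#|cls f d| < s) && connect (move f) c d].
Definition stuck f := [set c | ~~ reaches f c].

Lemma reaches_nonfull f c : #|cls f c| < s -> reaches f c.
Proof. by move=> lt; apply/existsP; exists c; rewrite lt connect0. Qed.

Lemma reaches_step f c d : move f c d -> reaches f d -> reaches f c.
Proof.
move=> cd /existsP[d' /andP[lt dd']]; apply/existsP; exists d'; rewrite lt.
exact: connect_trans (connect1 cd) dd'.
Qed.

Lemma stuckE f c : (c \in stuck f) = ~~ reaches f c.
Proof. by rewrite inE. Qed.

(** Otherwise [v] could move to [d], and its class would reach whatever [d] reaches. *)
Lemma stuck_nbr f v c d :
  f v = Some c -> c \in stuck f -> d \in L v -> reaches f d ->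
  exists2 u, e v u & f u = Some d.
Proof.
move=> fv; rewrite stuckE => nc dL rd; apply: not_free dL _.
apply: contra nc => fr; have [-> //|cd] := eqVneq c d.
apply: reaches_step rd; rewrite /move cd.
by apply/exists_inP; exists v; rewrite // in_cls fv.
Qed.

(** * A vertex [x] that cannot be added, and the edge bound *)

Hypotheses (r_ge9 : 9 <= r) (card_L : forall v, #|L v| = r).
Hypothesis deg_le : forall v, #|nbr v| <= r.
Hypothesis sparse : forall U W : {set V}, [disjoint U & W] -> 3 <= #|U| + #|W| ->
  \sum_(u in U) #|nbr u :&: W| + 4 <= 2 * (#|U| + #|W|).

Variables (x : V) (D : {set V}).
Hypotheses (x_notin : x \notin D) (card_D : #|D| < r * s).
Hypothesis deg_x : #|nbr x :&: D| <= 6.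

Definition good f := [/\ lcoloring f, forall c, #|cls f c| <= s & dom f = D].

Hypothesis no_extension :
  forall g, lcoloring g -> (forall c, #|cls g c| <= s) -> dom g = x |: D -> False.

Lemma good_dom f v c : good f -> f v = Some c -> v \in D.
Proof. by case=> _ _ <- fv; rewrite in_dom fv. Qed.

Lemma good_color f v : good f -> v \in D -> exists c, f v = Some c.
Proof. by case=> _ _ <-; rewrite in_dom; case: (f v) => // c _; exists c. Qed.

Lemma s_gt0 : 0 < s.
Proof. by move: card_D; case: s; rewrite ?muln0. Qed.

Lemma stuck_full f c : good f -> c \in stuck f -> #|cls f c| = s.
Proof.
case=> _ le _; rewrite stuckE => nr; apply/eqP; rewrite eqn_leq le leqNgt.
by apply: contra nr; apply: reaches_nonfull.
Qed.

Lemma full_colored f Q :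
  (forall c, c \in Q -> #|cls f c| = s) -> #|colored f Q| = #|Q| * s.
Proof. by move=> full; rewrite card_colored -sum_nat_const; apply: eq_bigr. Qed.

Lemma card_coloredC f Q : good f -> #|colored f (~: Q)| + #|colored f Q| = #|D|.
Proof.
case=> _ _ <-; rewrite coloredC cardsD (setIidPr (colored_dom f Q)) subnK //.
exact/subset_leq_card/colored_dom.
Qed.

(** A reachable class open to [x] would start a chain of moves that makes room for [x]. *)
Lemma x_nbr f c : good f -> reaches f c -> c \in L x -> exists2 u, e x u & f u = Some c.
Proof.
move=> [Pf sf df] /existsP[d /andP[ltd cd]] cL; apply: not_free cL _.
apply/negP=> fr.
have fx : f x = None.
  by apply/eqP; rewrite -[_ == _]negbK; have := x_notin; rewrite -df in_dom; case: (f x).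
have cd' : connect (move_in setT f) c d.
  apply: connect_sub cd => a b ab; apply: connect1.
  by rewrite /move_in !inE.
have [g [Pg dg sg _]] := shift_connect Pf fx fr (in_setT c) cd'.
apply: (no_extension Pg); last by rewrite dg df.
move=> c'; rewrite sg; case: eqP => [->|_]; rewrite ?addn1 ?addn0 //.
Qed.

(* The lower bound [r - #|Q|] on the number of neighbours outside the [Q]-coloured
   vertices may fail by one for the vertices of [X]. *)
Lemma few_inner f Q (X : {set V}) :
    good f -> (forall c, c \in Q -> #|cls f c| = s) -> #|Q| + 3 <= r ->
    #|X :&: colored f Q| <= 5 ->
    (forall v, v \in colored f Q ->
      r <= #|Q| + #|nbr v :&: colored f (~: Q)| + (v \in X)) ->
  #|Q| <= 2.
Proof.
move=> gf full Q3 X5 out; rewrite leqNgt; apply/negP=> Q2.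
set U := colored f Q in X5 out *; set W := colored f (~: Q) in out *.
have cU : #|U| = #|Q| * s by apply: full_colored.
have cUW : #|W| + #|U| = #|D| by apply: card_coloredC.
have disUW : [disjoint U & W].
  by rewrite -setI_eq0 /W coloredC setIDA setIC -setIDA setDv setI0.
have s0 := s_gt0.
have sp : \sum_(u in U) #|nbr u :&: W| + 4 <= 2 * #|D|.
  rewrite -cUW addnC [#|W| + _]addnC addnC; apply: sparse disUW _.
  by rewrite cU; apply: leq_trans (leq_addr _ _); rewrite -[3]muln1 leq_mul.
have low : \sum_(u in U) r <= \sum_(u in U) (#|Q| + #|nbr u :&: W| + (u \in X)).
  by apply: leq_sum.
rewrite !big_split !sum_nat_const /= in low.
have X5' : \sum_(u in U) (u \in X) <= 5.
  apply: leq_trans X5; rewrite -sum1_card big_mkcond [in leqRHS]big_mkcond /=.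
  by apply: leq_sum => u _; rewrite inE; case: (u \in U); case: (u \in X).
(* From 3 <= |Q| <= r - 3 the product is at least 3 (r - 3), and r >= 9 makes this at least 2 r. *)
have key : 2 * r * s <= #|Q| * (r - #|Q|) * s.
  rewrite leq_mul2r; apply/orP; right.
  have [k rk] : exists k, r = #|Q| + 3 + k by exists (r - (#|Q| + 3)); rewrite subnKC.
  have [i qi] : exists i, #|Q| = 3 + i by exists (#|Q| - 3); rewrite subnKC.
  nia.
(* Five exceptions are the most that fit: 2 r s <= (2 |D| - 4) + 5 just fails for |D| <= r s - 1. *)
move: low; rewrite cU -/W; move: key sp X5' card_D.
set q := #|Q|; set SW := \sum_(u in U) #|_|; set SX := \sum_(u in U) _; nia.
Qed.

(** The witnesses for different colours are distinct because [lab] tells them apart. *)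
Lemma out_nbrs f (lab : V -> option K) Q (X : {set K}) v :
    (forall c, c \in L v -> c \notin Q -> c \notin X ->
      exists u, [/\ e v u, u \in colored f (~: Q) & lab u = Some c]) ->
  r <= #|Q| + #|nbr v :&: colored f (~: Q)| + #|X|.
Proof.
move=> wit; rewrite -(card_L v) -addnA [_ + #|X|]addnC addnA.
have: #|L v :\: (Q :|: X)| <= #|nbr v :&: colored f (~: Q)|.
  apply: (card_labels (lab := lab)) => c; rewrite !inE negb_or.
  case/andP=> /andP[cQ cX] cL; have [u [evu uc lu]] := wit c cL cQ cX.
  by exists u; rewrite // inE in_nbr evu.
have := cardsID (Q :|: X) (L v); have := subset_leq_card (subsetIr (L v) (Q :|: X)).
have := (leq_card_setU Q X).1; clear; lia.
Qed.

Lemma stuck_nbr_colored f Q v c d :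
    good f -> f v = Some c -> c \in stuck f -> d \in L v -> reaches f d -> d \notin Q ->
  exists u, [/\ e v u, u \in colored f (~: Q) & f u = Some d].
Proof.
move=> gf fv cs dL rd dQ; have [u evu fu] := stuck_nbr fv cs dL rd.
by exists u; rewrite (colored_Some _ fu) inE.
Qed.

(** By the edge bound the alternative is b <= 2. Then at least r - 2 >= 7 colours of [L x] are
    reachable and each demands a neighbour of [x], which has at most six. *)
Lemma stuck_ge f : good f -> r <= #|stuck f| + 2.
Proof.
move=> gf; rewrite leqNgt; apply/negP=> lt.
have le2 : #|stuck f| <= 2.
  apply: (few_inner (X := set0) gf); rewrite ?set0I ?cards0 //.
  - by move=> c; apply: stuck_full.
  - by rewrite addnS.
  move=> v /coloredP[c cs fv]; rewrite in_set0 -[nat_of_bool _](cards0 K).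
  apply: (out_nbrs (lab := f)) => d dL ds _.
  by apply: (stuck_nbr_colored gf fv) => //; move: ds; rewrite stuckE negbK.
have: #|L x :\: stuck f| <= #|nbr x :&: D|.
  apply: (card_labels (lab := f)) => c; rewrite !inE negbK => /andP[rc cL].
  have [u exu fu] := x_nbr gf rc cL.
  by exists u; rewrite // !inE exu (good_dom gf fu).
have := cardsID (stuck f) (L x); have := subset_leq_card (subsetIr (L x) (stuck f)).
have := deg_x; rewrite card_L; move: r_ge9 le2; clear; lia.
Qed.

(** Stuck classes are full, and r full classes hold more vertices than [D] has. *)
Lemma stuck_lt f : good f -> #|stuck f| < r.
Proof.
move=> gf; rewrite -(ltn_pmul2r s_gt0); apply: leq_ltn_trans card_D.
rewrite -(full_colored (f := f)); last by move=> c; apply: stuck_full.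
by case: gf => _ _ <-; apply/subset_leq_card/colored_dom.
Qed.

(** At least r - 4 >= 5 stuck colours would lie outside [Q], but at most 2 s vertices are coloured
    from outside [Q], enough for two full classes only. Recolourings are refuted by this lemma
    together with [few_inner]. *)
Lemma stuck_outside f Q :
    good f -> r = #|Q| + 2 -> #|Q| * s <= #|colored f Q| + 1 ->
  ~ #|stuck f :&: Q| <= 2.
Proof.
move=> gf rQ cQ le2.
have: #|stuck f :\: Q| * s <= #|colored f (~: Q)|.
  rewrite -(full_colored (f := f)); last first.
    by move=> c; rewrite inE => /andP[_]; apply: stuck_full.
  by apply/subset_leq_card/coloredS; rewrite setDE subsetIr.
have := card_coloredC Q gf; have := card_D; rewrite rQ mulnDl.
have := cardsID Q (stuck f); have := stuck_ge gf; have := s_gt0.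
set a := #|stuck f :\: Q|; move=> s0 ge ID cD cC le.
have: a * s <= 2 * s by lia.
rewrite leq_mul2r; move: le2 r_ge9 ID ge s0; rewrite rQ; clear; lia.
Qed.

(* The vertices of stuck classes that could enter the class [c] if [z] left it. *)
Definition solo f c z :=
  [set y in colored f (stuck f) | (c \in L y) && (nbr y :&: cls f c == [set z])].

Lemma soloP f c z y :
  reflect [/\ y \in colored f (stuck f), c \in L y & nbr y :&: cls f c = [set z]]
          (y \in solo f c z).
Proof. by rewrite inE; apply: (iffP and3P) => -[? ? /eqP]. Qed.

Lemma solo_adj f c z y : y \in solo f c z -> e y z /\ f z = Some c.
Proof.
case/soloP=> _ _ /setP/(_ z); rewrite !inE eqxx => /andP[eyz /eqP fz].
by [].
Qed.

Lemma solo_nbr f c z y u : y \in solo f c z -> e y u -> f u = Some c -> u = z.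
Proof.
by case/soloP=> _ _ /setP/(_ u); rewrite !inE => + eyu fu; rewrite eyu fu eqxx => /esym/eqP.
Qed.

(* [a] can give up [z] and receive a vertex without losing its access to a class
   with fewer than [s] vertices. *)
Definition exchangeable f a :=
  [/\ good f, reaches f a,
      forall c, reaches f c -> c != a -> #|cls f c| < s
    & #|cls f a| < s \/
      exists w c, [/\ f w = Some a, c != a, #|cls f c| < s & free f w c]].

Lemma solo_stuck f a z y : y \in solo f a z -> exists2 c, c \in stuck f & f y = Some c.
Proof. by case/soloP=> /coloredP. Qed.

Lemma solo_color f a z y : reaches f a -> y \in solo f a z -> f y <> Some a.
Proof.
by move=> ra /solo_stuck[c cs ->] [ca]; move: cs; rewrite stuckE ca ra.
Qed.

(* After [y1] has replaced [z], the vertex [y2] may enter the class [a], so that the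
   class of [y2] is no longer stuck. *)
Lemma improve f g a z y1 y2 :
    exchangeable f a -> (forall c, f z = Some a -> c != a -> #|cls f c| < s -> ~~ free f z c) ->
    good g -> y1 \in solo f a z -> y2 \in solo f a z -> y1 != y2 -> ~~ e y1 y2 ->
    cls g a = y1 |: (cls f a :\ z) ->
    (forall c, reaches f c -> c != a -> cls g c = cls f c) ->
  #|stuck g| < #|stuck f|.
Proof.
move=> [gf ra nonfull alt] imm gg sy1 sy2 y12 ney12 clsa clsc.
have [ey1z fz] := solo_adj sy1.
have card_a : #|cls g a| = #|cls f a|.
  rewrite clsa cardsU1 (cardsD1 z (cls f a)) !inE fz eqxx.
  by rewrite (introF eqP (solo_color ra sy1)) andbF.
have rg_nonfull c : reaches f c -> c != a -> reaches g c.
  by move=> rc ca; apply: reaches_nonfull; rewrite clsc //; apply: nonfull.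
have rga : reaches g a.
  case: alt => [lt|[w [c [fw ca lt fr]]]]; first by apply: reaches_nonfull; rewrite card_a.
  have rc := reaches_nonfull lt.
  apply: reaches_step (rg_nonfull c rc ca); rewrite /move eq_sym ca.
  apply/exists_inP; exists w; last by rewrite (free_eq_cls _ (clsc c rc ca)).
  (* The vertex [w] that links [a] to an open class is not [z], hence it is still in the class. *)
  rewrite clsa !inE fw eqxx andbT; apply/orP; right.
  apply: contraTneq fr => wz; rewrite wz; exact: imm.
have sub c : reaches f c -> reaches g c.
  by move=> rc; have [->|ca] := eqVneq c a; last exact: rg_nonfull.
have [c2 c2s fy2] := solo_stuck sy2.
(* [g] may have recoloured [y2], so the colour that ceases to be stuck is that of [y2] in [g]. *)
have [c gy2] := good_color gg (good_dom gf fy2).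
have fr2 : free g y2 a.
  case/soloP: (sy2) => _ aL _; rewrite /free aL -setI_eq0; apply/eqP/setP=> u.
  rewrite clsa !inE; apply/negP=> /andP[e2u].
  case/orP=> [/eqP u1|/andP[uz /eqP fu]].
    by move: ney12; rewrite e_sym -u1 e2u.
  by rewrite (solo_nbr sy2 e2u fu) eqxx in uz.
have ca : c != a.
  apply/eqP=> ca; have: y2 \in cls g a by rewrite in_cls gy2 ca.
  rewrite clsa !inE eq_sym (negPf y12) /= => /andP[_ /eqP].
  exact: solo_color sy2.
have rgc : reaches g c.
  apply: reaches_step rga; rewrite /move ca; apply/exists_inP; exists y2 => //.
  by rewrite in_cls gy2.
have cs : c \in stuck f.
  rewrite stuckE; apply/negP=> rc; have: y2 \in cls g c by rewrite in_cls gy2.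
  rewrite clsc // in_cls fy2 => /eqP[cc]; by move: c2s; rewrite stuckE cc rc.
apply/proper_card/properP; split; last by exists c; rewrite // stuckE rgc.
by apply/subsetP=> d; rewrite !stuckE; apply/contra/sub.
Qed.

Lemma cards_swap (A : {set V}) z y : z \in A -> y \notin A -> #|y |: (A :\ z)| = #|A|.
Proof. by move=> zA yA; rewrite cardsU1 !inE (negPf yA) andbF (cardsD1 z A) zA. Qed.

Lemma setU1_in (A : {set V}) z : z \in A -> z |: A = A.
Proof. by move=> zA; apply/setUidPr; rewrite sub1set. Qed.

(** * Exchanges in a colouring with fewest stuck colours *)

Definition minimal f := forall g, good g -> #|stuck f| <= #|stuck g|.

Lemma card_reachable f : good f -> #|colored f (~: stuck f)| < (r - #|stuck f|) * s.
Proof.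
move=> gf; have := card_coloredC (stuck f) gf; have := card_D; have := stuck_lt gf.
rewrite (@full_colored f (stuck f)); last by move=> c; apply: stuck_full.
by rewrite mulnBl; clear; lia.
Qed.

Lemma cls_colored f Q c : c \in Q -> cls f c \subset colored f Q.
Proof. by move=> cQ; apply: bigcup_sup. Qed.

Lemma free_solo f g a z y :
  y \in solo f a z -> cls g a \subset cls f a :\ z -> free g y a.
Proof.
move=> sy /subsetP sub; case/soloP: (sy) => _ aL _; rewrite /free aL -setI_eq0.
apply/eqP/setP=> u; rewrite in_set0; apply/negP; rewrite inE in_nbr => /andP[eyu /sub].
by rewrite !inE => /andP[uz /eqP fu]; rewrite (solo_nbr sy eyu fu) eqxx in uz.
Qed.

(** Otherwise [z] moves to [c], [y] takes its place, and the class of [y] gets a gap. If b = r - 1,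
    fewer than s vertices have reachable colours, so no reachable class fills up and b drops. If b =
    r - 2, the class [c] may fill up and close the access for others; then the edge bound is applied
    to the colours that are stuck both before and after. *)
Lemma immovable f a z y c :
    exchangeable f a -> minimal f -> y \in solo f a z -> reaches f c -> c != a ->
  ~~ free f z c.
Proof.
move=> [gf ra nonfull _] minf sy rc ca; apply/negP=> fr.
have [eyz fz] := solo_adj sy; have [c1 c1s fy] := solo_stuck sy.
have nr1 : ~~ reaches f c1 by rewrite -stuckE.
have c1a : c1 != a by apply: contraNneq nr1 => ->.
have c1c : c1 != c by apply: contraNneq nr1 => ->.
have yz : y != z by apply: contraTneq eyz => ->; rewrite e_irr.
have [Pf le df] := gf.
pose g := recolor (recolor f z (Some c)) y (Some a).
have clsa : cls g a = y |: (cls f a :\ z) by rewrite !cls_recolor eqxx eq_sym (negPf ca).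
have clsc : cls g c = z |: cls f c.
  rewrite !cls_recolor (negPf ca) eqxx; apply/setDidPl.
  by rewrite disjoint_sym disjoints1 !inE (negPf yz) fy (inj_eq Some_inj).
have clsD d : d != a -> d != c -> cls g d = cls f d :\ z :\ y.
  by move=> da dc; rewrite !cls_recolor (negPf da) (negPf dc).
have card_a : #|cls g a| = #|cls f a|.
  by rewrite clsa cards_swap // in_cls ?fz // fy (inj_eq Some_inj).
have card_c : #|cls g c| = (#|cls f c|).+1.
  by rewrite clsc cardsU1 in_cls fz (inj_eq Some_inj) eq_sym ca.
have gg : good g; first split.
- apply: lcoloring_recolor; first exact: lcoloring_recolor.
  by apply: free_solo sy _; rewrite cls_recolor eq_sym (negPf ca).
- move=> d; have [->|da] := eqVneq d a; first by rewrite card_a.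
  have [->|dc] := eqVneq d c; first by rewrite card_c nonfull.
  rewrite clsD //; apply: leq_trans (le d).
  by apply: subset_leq_card; rewrite !subDset !setUA subsetUr.
- have zD := good_dom gf fz; have yD := good_dom gf fy.
  by rewrite !dom_recolor df (setU1_in zD) (setU1_in yD).
have stuckS d : d \in stuck f -> cls g d = cls f d :\ y.
  move=> ds; have nr : ~~ reaches f d by rewrite -stuckE.
  have da : d != a by apply: contraNneq nr => ->.
  have dc : d != c by apply: contraNneq nr => ->.
  rewrite clsD //; congr (_ :\ _); apply/setDidPl.
  by rewrite disjoint_sym disjoints1 in_cls fz (inj_eq Some_inj) eq_sym.
have rg1 : reaches g c1.
  apply: reaches_nonfull; rewrite stuckS // -(stuck_full gf c1s).
  by rewrite (cardsD1 y (cls f c1)) in_cls fy eqxx.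
have [b1|b2] := leqP r (#|stuck f| + 1).
  have As : #|colored f (~: stuck f)| < s.
    have := card_reachable gf; have -> : r - #|stuck f| = 1 by move: b1 (stuck_lt gf); clear; lia.
    by rewrite mul1n.
  have: #|stuck g| < #|stuck f|.
    apply/proper_card/properP; split; last by exists c1; rewrite // stuckE rg1.
    apply/subsetP=> d; rewrite !stuckE; apply: contra => rd; apply: reaches_nonfull.
    have dA : cls f d \subset colored f (~: stuck f).
      by apply: cls_colored; rewrite inE stuckE rd.
    have [da|da] := eqVneq d a.
      by rewrite da card_a -da; apply: leq_ltn_trans As; apply: subset_leq_card.
    have [dc|dc] := eqVneq d c.
      apply: leq_ltn_trans As; apply: subset_leq_card; rewrite dc clsc -dc.
      by rewrite subUset dA andbT sub1set (colored_Some _ fz) inE stuckE ra.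
    apply: leq_ltn_trans As; apply: subset_leq_card; rewrite clsD //.
    by apply: subset_trans dA; rewrite !subDset !setUA subsetUr.
  by rewrite ltnNge minf.
have rQ : r = #|stuck f| + 2 by move: b2 (stuck_ge gf); clear; lia.
have colS : colored g (stuck f) = colored f (stuck f) :\ y.
  apply/setP=> v; rewrite in_setD1; apply/bigcupP/andP => [[d ds]|[vy /bigcupP[d ds vd]]].
    by rewrite stuckS // in_setD1 => /andP[-> vd]; split=> //; apply/bigcupP; exists d.
  by exists d; rewrite // stuckS // in_setD1 vy.
apply: (stuck_outside gg rQ).
  rewrite colS -(full_colored (f := f)); last by move=> d; apply: stuck_full.
  by rewrite (cardsD1 y) (colored_Some _ fy) c1s addnC.
set Q := stuck g :&: stuck f.
have Qf d : d \in Q -> d \in stuck f by rewrite inE => /andP[].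
have sub v d : d \in stuck f -> g v = Some d -> f v = Some d.
  move=> ds gv; have: v \in cls g d by rewrite in_cls gv.
  by rewrite stuckS // !inE => /andP[_ /eqP].
apply: (few_inner (X := set0) gg); rewrite ?set0I ?cards0 //.
- by move=> d; rewrite inE => /andP[dg _]; apply: stuck_full.
- have: #|Q| < #|stuck f|; last by move: rQ; clear; lia.
  apply/proper_card/properP; split; first exact: subsetIr.
  by exists c1; rewrite // inE stuckE rg1.
move=> v /coloredP[d dQ gv]; rewrite in_set0 -[nat_of_bool _](cards0 K).
apply: (out_nbrs (lab := f)) => d' d'L d'Q _.
(* Colours that have become reachable get their neighbour from [g], those reachable before from
   [f]. *)
have [u evu fu] : exists2 u, e v u & f u = Some d'.
  have [d's|d's] := boolP (d' \in stuck f).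
    have rd' : reaches g d' by move: d'Q; rewrite inE d's andbT stuckE negbK.
    have ds : d \in stuck g by move: dQ; rewrite inE => /andP[].
    by have [u evu /(sub _ _ d's) fu] := stuck_nbr gv ds d'L rd'; exists u.
  apply: (stuck_nbr (sub _ _ (Qf d dQ) gv) (Qf d dQ)) => //.
  by move: d's; rewrite stuckE negbK.
exists u; split=> //.
have [_ _ dg] := gg; rewrite coloredC dg inE (good_dom gf fu) andbT.
apply/coloredP=> -[d2 d2Q gu]; have := sub _ _ (Qf _ d2Q) gu.
by rewrite fu => -[dd]; rewrite dd d2Q in d'Q.
Qed.

Lemma stuck_neq f c d : c \in stuck f -> reaches f d -> c != d.
Proof. by rewrite stuckE => nr rd; apply: contraNneq nr => ->. Qed.

Lemma improve_adj f g a z y1 y2 :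
    exchangeable f a -> minimal f -> good g ->
    y1 \in solo f a z -> y2 \in solo f a z -> y1 != y2 ->
    cls g a = y1 |: (cls f a :\ z) ->
    (forall c, reaches f c -> c != a -> cls g c = cls f c) ->
  e y1 y2.
Proof.
move=> bf minf gg sy1 sy2 y12 clsa clsc; apply/negPn/negP=> ney.
have imm c : f z = Some a -> c != a -> #|cls f c| < s -> ~~ free f z c.
  move=> _ ca lt; apply: (immovable bf minf sy1) ca; exact: reaches_nonfull.
by have := improve bf imm gg sy1 sy2 y12 ney clsa clsc; rewrite ltnNge minf.
Qed.

(** Under these hypotheses [z] and [y1] can exchange their colours, so [improve_adj] applies. *)
Lemma only_nbr_adj f a z y1 y2 c :
    exchangeable f a -> minimal f -> y1 \in solo f a z -> y2 \in solo f a z -> y1 != y2 ->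
    f y1 = Some c -> c \in L z -> nbr z :&: cls f c = [set y1] ->
  e y1 y2.
Proof.
move=> bf minf sy1 sy2 y12 fy1 cL only.
have [gf ra _ _] := bf; have [Pf le df] := gf.
have [ey1z fz] := solo_adj sy1.
have cs : c \in stuck f by case/soloP: sy1; rewrite (colored_Some _ fy1).
have ca := stuck_neq cs ra.
have y1z : y1 != z by apply: contraTneq ey1z => ->; rewrite e_irr.
pose g := recolor (recolor (recolor f y1 None) z (Some c)) y1 (Some a).
have y1a : y1 \notin cls f a by rewrite in_cls fy1 (inj_eq Some_inj).
have zc : z \notin cls f c by rewrite in_cls fz (inj_eq Some_inj) eq_sym.
have clsa : cls g a = y1 |: (cls f a :\ z).
  rewrite !cls_recolor cls_erase eqxx eq_sym (negPf ca); congr (_ |: (_ :\ _)).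
  by apply/setDidPl; rewrite disjoint_sym disjoints1.
have clsc : cls g c = z |: (cls f c :\ y1).
  rewrite !cls_recolor cls_erase (negPf ca) eqxx; apply/setDidPl.
  by rewrite disjoint_sym disjoints1 !inE (negPf y1z) eqxx.
have clsD d : d != a -> d != c -> cls g d = cls f d.
  move=> da dc; rewrite !cls_recolor cls_erase (negPf da) (negPf dc).
  apply/setP=> u; rewrite !inE; have [->|_] := eqVneq u y1.
    by rewrite fy1 Some_eqF.
  by have [->|//] := eqVneq u z; rewrite fz Some_eqF.
have gg : good g; first split.
- apply: lcoloring_recolor; first apply: lcoloring_recolor.
  + exact: lcoloring_erase.
  + by rewrite /free cL -setI_eq0 cls_erase setIDA only setDv eqxx.
  + apply: free_solo sy1 _; rewrite cls_recolor eq_sym (negPf ca) cls_erase.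
    by apply: setSD; rewrite subD1set.
- move=> d; have [->|da] := eqVneq d a; first by rewrite clsa cards_swap // in_cls fz.
  have [->|dc] := eqVneq d c; first by rewrite clsc cards_swap // in_cls fy1.
  by rewrite clsD.
- have zD := good_dom gf fz; have yD := good_dom gf fy1.
  by rewrite !dom_recolor dom_erase df setUCA setD1K // (setU1_in zD).
apply: (improve_adj bf minf gg sy1 sy2 y12 clsa) => d rd da.
by rewrite clsD // eq_sym (stuck_neq cs rd).
Qed.

Definition dominating f c :=
  forall v, v \in colored f (stuck f :\ c) -> c \in L v -> exists2 u, e v u & f u = Some c.

(* If [z] has three free stuck colours and [y1] has replaced [z], then [z] can be
   shifted towards the gap left by [y1], unless no class but that of [y1] leads there. *)
Lemma dominating_color f a z y1 y2 c :
    exchangeable f a -> minimal f -> y1 \in solo f a z -> y2 \in solo f a z -> y1 != y2 ->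
    ~~ e y1 y2 -> f y1 = Some c -> 2 < #|[set d in stuck f | free f z d]| ->
  r = #|stuck f| + 1 /\ dominating f c.
Proof.
move=> bf minf sy1 sy2 y12 ney fy1 p3.
have [gf ra _ _] := bf; have [Pf le df] := gf.
have [ey1z fz] := solo_adj sy1.
have cs : c \in stuck f by case/soloP: sy1; rewrite (colored_Some _ fy1).
have y1z : y1 != z by apply: contraTneq ey1z => ->; rewrite e_irr.
have zD := good_dom gf fz; have yD := good_dom gf fy1.
have y1a : y1 \notin cls f a by rewrite in_cls fy1 (inj_eq Some_inj) (stuck_neq cs ra).
pose f1 := recolor (recolor f z None) y1 (Some a).
have cls1a : cls f1 a = y1 |: (cls f a :\ z) by rewrite cls_recolor eqxx cls_erase.
have cls1 d : d != a -> cls f1 d = cls f d :\ y1.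
  move=> da; rewrite cls_recolor (negPf da) cls_erase; congr (_ :\ _).
  by apply/setDidPl; rewrite disjoint_sym disjoints1 in_cls fz (inj_eq Some_inj) eq_sym.
have Pf1 : lcoloring f1.
  apply: lcoloring_recolor; first exact: lcoloring_erase.
  by apply: free_solo sy1 _; rewrite cls_erase.
have f1z : f1 z = None by rewrite !ffunE eq_sym (negPf y1z) eqxx.
have free1 v d : d != a -> free f v d -> free f1 v d.
  by move=> da; apply: freeS; rewrite cls1 // subD1set.
have f1c d v : d != a -> d != c -> f v = Some d -> f1 v = Some d.
  move=> da dc fv; have: v \in cls f1 d.
    rewrite cls1 // !inE fv eqxx andbT; apply: contraNneq dc => vy.
    by move: fv; rewrite vy fy1 => -[->].
  by rewrite in_cls => /eqP.
pose Q := [set d in stuck f | ~~ connect (move_in (stuck f) f1) d c].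
have Qs : Q \subset stuck f by apply/subsetP=> d; rewrite inE => /andP[].
have cQ : c \notin Q by rewrite inE connect0 andbF.
have Qlt : #|Q| < #|stuck f|.
  by apply/proper_card/properP; split=> //; exists c.
have Qmove v d d' : d \in Q -> f v = Some d -> d' \in stuck f -> d' \notin Q -> ~~ free f1 v d'.
  move=> dQ fv d's; rewrite inE d's negbK => d'c; apply/negP=> fr.
  have ds := subsetP Qs _ dQ.
  have dc : d != c by apply: contraNneq cQ => <-.
  move: dQ; rewrite inE ds /= => /negP; apply.
  have [->//|dd'] := eqVneq d d'.
  apply: connect_trans d'c; apply: connect1; rewrite /move_in ds d's /move dd'.
  apply/exists_inP; exists v => //; rewrite in_cls (f1c d v) //; exact: stuck_neq ra.
(* If [Q] is too large for the edge bound, then, as it misses [c], it has exactly r - 2 colours and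
   b = r - 1: every stuck colour except [c] is in [Q]. *)
have [Q3|Q3] := leqP (#|Q| + 3) r; last first.
  have lt := stuck_lt gf; have ge := stuck_ge gf.
  have b1 : r = #|stuck f| + 1 by move: lt Qlt Q3; clear; lia.
  split=> // v vb cL.
  have eQ : Q = stuck f :\ c.
    apply/eqP; rewrite eqEcard subsetD1 Qs cQ /=.
    by move: b1 Q3; rewrite (cardsD1 c (stuck f)) cs; clear; lia.
  rewrite -eQ in vb; have [d dQ fv] := coloredP _ _ _ vb.
  apply: not_free cL _; apply: contra (Qmove v d c dQ fv cs cQ).
  by apply: free1; apply: stuck_neq ra.
have Q2 : #|Q| <= 2.
  apply: (few_inner (X := set0) gf); rewrite ?set0I ?cards0 //.
    by move=> d /(subsetP Qs); apply: stuck_full.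
  move=> v /coloredP[d dQ fv]; rewrite in_set0 -[nat_of_bool _](cards0 K).
  apply: (out_nbrs (lab := f)) => d' d'L d'Q _.
  have [d's|d's] := boolP (d' \in stuck f).
    have [|u evu fu] := @not_free f v d' d'L.
      by apply: contra (Qmove v d d' dQ fv d's d'Q); apply: free1; apply: stuck_neq ra.
    by exists u; rewrite (colored_Some _ fu) inE.
  apply: (stuck_nbr_colored gf fv (subsetP Qs _ dQ) d'L _ d'Q).
  by move: d's; rewrite stuckE negbK.
(* Of the three free stuck colours of [z] at most two are in [Q]; another one leads to the gap. *)
have [d] : exists d, d \in [set d in stuck f | free f z d] :\: Q.
  apply/set0Pn; rewrite -card_gt0 cardsD subn_gt0.
  apply: leq_ltn_trans p3; apply: leq_trans Q2; exact/subset_leq_card/subsetIr.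
rewrite !inE => /andP[+ /andP[+ fr]]; rewrite -stuckE => + ds; rewrite ds negbK => dc.
have [g [Pg dg sg og]] := shift_connect Pf1 f1z (free1 _ _ (stuck_neq ds ra) fr) ds dc.
have clsa : cls g a = y1 |: (cls f a :\ z) by rewrite og // stuckE ra.
have clsc d' : reaches f d' -> d' != a -> cls g d' = cls f d'.
  move=> rd' d'a; rewrite og ?stuckE ?rd' // cls1 //; apply/setDidPl.
  rewrite disjoint_sym disjoints1 in_cls fy1 (inj_eq Some_inj).
  exact: stuck_neq cs rd'.
have gg : good g.
  split=> //.
    move=> d'; rewrite sg; have [->|d'a] := eqVneq d' a.
      rewrite (eq_sym a) (negPf (stuck_neq cs ra)) addn0 cls1a cards_swap //.
      by rewrite in_cls fz.
    rewrite cls1 //; have [->|_] := eqVneq d' c.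
      by apply: leq_trans (le c); rewrite (cardsD1 y1 (cls f c)) in_cls fy1 eqxx addnC.
    by rewrite addn0; apply: leq_trans (le d'); apply/subset_leq_card; rewrite subD1set.
  rewrite dg dom_recolor dom_erase df setUCA setD1K //.
  by rewrite (setU1_in yD).
by move: ney; rewrite (improve_adj bf minf gg sy1 sy2 y12 clsa clsc).
Qed.

(** With two dominating classes the other r - 3 stuck colours satisfy the hypotheses of [few_inner],
    although r - 3 exceeds two. *)
Lemma dominating_unique f c d :
  good f -> r = #|stuck f| + 1 -> c \in stuck f -> d \in stuck f ->
  dominating f c -> dominating f d -> c = d.
Proof.
move=> gf b1 cs ds domc domd; apply/eqP/negPn/negP=> cd.
pose Q := stuck f :\ c :\ d.
have cQ : #|Q| + 3 = r.
  rewrite /Q b1 (cardsD1 c (stuck f)) cs (cardsD1 d (stuck f :\ c)) !inE eq_sym cd.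
  by rewrite -stuckE ds; clear; lia.
have Qs e' : e' \in Q -> e' \in stuck f by rewrite !inE => /and3P[].
have: #|Q| <= 2.
  apply: (few_inner (X := set0) gf); rewrite ?set0I ?cards0 ?cQ //.
    by move=> e' /Qs; apply: stuck_full.
  move=> v vQ; have [e' eQ fv] := coloredP _ _ _ vQ.
  rewrite in_set0 -[nat_of_bool _](cards0 K).
  apply: (out_nbrs (lab := f)) => d' d'L d'Q _.
  have [rd'|nr] := boolP (reaches f d').
    exact: (stuck_nbr_colored gf fv (Qs _ eQ) d'L rd' d'Q).
  have [u evu fu] : exists2 u, e v u & f u = Some d'.
    have [d'c|d'c] := eqVneq d' c.
      rewrite d'c; apply: domc; last by rewrite -d'c.
      by move: vQ; apply/subsetP/coloredS; rewrite subD1set.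
    have [d'd|d'd] := eqVneq d' d; last by rewrite !inE d'd d'c nr in d'Q.
    rewrite d'd; apply: domd; last by rewrite -d'd.
    by move: vQ; apply/subsetP/coloredS; rewrite setSD // subD1set.
  by exists u; rewrite (colored_Some _ fu) inE.
by move: cQ r_ge9; clear; lia.
Qed.

(* Here [z] moves to [c], which is free once both [y1] and [y2] have entered the class
   [a]. The new colouring [g] of the proof has few stuck colours: a vertex of a class
   in [E] keeps its neighbours outside [E], except that [z] is counted twice for the
   members of [solo f a z]. *)
Lemma doubled_color f f' (E : {set K}) a z y1 y2 c :
    good f -> good f' -> r = #|E| + 2 -> E \subset stuck f -> reaches f a ->
    (forall v d, v \in colored f E -> d \in L v -> d \notin E ->
      exists2 u, e v u & f u = Some d) ->
    (forall d, d \in E -> cls f' d = cls f d) -> cls f' a \subset cls f a ->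
    z \in cls f' a -> #|cls f' a| < s ->
    y1 \in solo f a z -> y2 \in solo f a z -> y1 != y2 ->
    c \in E -> c \in L z -> nbr z :&: cls f c = [set y1; y2] ->
  ~ #|solo f a z| <= 7.
Proof.
move=> gf gf' rE /subsetP Es ra nbrE clsE clsa za lta sy1 sy2 y12 cE cL nz t7.
have [Pf' le df'] := gf'; have cs := Es c cE; have ca := stuck_neq cs ra.
have [ey1z fz] := solo_adj sy1; have [ey2z _] := solo_adj sy2.
have f'z : f' z = Some a by move: za; rewrite in_cls => /eqP.
have clsy y : (y \in [set y1; y2]) -> f y = Some c.
  by rewrite -nz inE in_cls => /andP[_ /eqP].
have fy1 : f y1 = Some c by rewrite clsy // !inE eqxx.
have fy2 : f y2 = Some c by rewrite clsy // !inE eqxx orbT.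
have f'y y : f y = Some c -> f' y = Some c.
  by move=> fy; apply/eqP; rewrite -in_cls clsE // in_cls fy.
have [f'y1 f'y2] := (f'y y1 fy1, f'y y2 fy2).
have ac : (Some a == Some c) = false by rewrite (inj_eq Some_inj) eq_sym (negPf ca).
have zy1 : z != y1 by apply: contraFneq ac => zy; rewrite -f'z zy f'y1.
have zy2 : z != y2 by apply: contraFneq ac => zy; rewrite -f'z zy f'y2.
have ya y : f' y = Some c -> y \notin cls f' a.
  by move=> fy; rewrite in_cls fy (inj_eq Some_inj).
pose g0 := recolor (recolor f' y1 None) y2 None.
pose g := recolor (recolor (recolor g0 z (Some c)) y1 (Some a)) y2 (Some a).
have cls0 d : cls g0 d = cls f' d :\ y1 :\ y2 by rewrite !cls_erase.
have cls0D d : d != c -> cls g0 d = cls f' d.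
  move=> dc; rewrite cls0; apply/setP=> u; rewrite !inE.
  have [->|_] := eqVneq u y2; first by rewrite f'y2 Some_eqF.
  by have [->|//] := eqVneq u y1; rewrite f'y1 Some_eqF.
have clsga : cls g a = y2 |: (y1 |: (cls f' a :\ z)).
  by rewrite !cls_recolor !eqxx eq_sym (negPf ca) cls0D // eq_sym.
have clsgc : cls g c = z |: (cls f c :\ y1 :\ y2).
  rewrite !cls_recolor (negPf ca) eqxx cls0 clsE //; apply/setP=> u; rewrite !inE.
  have [->|_] := eqVneq u z; rewrite ?zy1 ?zy2 //=.
  by case: (u == y1); case: (u == y2).
have clsgD d : d != a -> d != c -> cls g d = cls f' d.
  move=> da dc; rewrite !cls_recolor (negPf da) (negPf dc) cls0D //.
  apply/setP=> u; rewrite !inE.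
  have [->|_] := eqVneq u y2; first by rewrite f'y2 Some_eqF.
  have [->|_] := eqVneq u y1; first by rewrite f'y1 Some_eqF.
  by have [->|//] := eqVneq u z; rewrite f'z Some_eqF.
have cgc : (#|cls g c|).+1 = s.
  rewrite clsgc -(stuck_full gf cs) (cardsD1 y1 (cls f c)) (cardsD1 y2 (cls f c :\ y1)).
  rewrite cardsU1 !inE fz ac fy1 fy2 !andbF eq_sym y12 !eqxx /=.
  by rewrite !add1n.
have gg : good g; first split.
- apply: lcoloring_recolor; [apply: lcoloring_recolor; [apply: lcoloring_recolor|]|].
  + by do 2!apply: lcoloring_erase.
  + rewrite /free cL -setI_eq0 cls0 clsE // !setIDA nz.
    by apply/eqP/setP=> u; rewrite !inE; case: (u == y1); case: (u == y2).
  + apply: (free_solo sy1); rewrite cls_recolor eq_sym (negPf ca) cls0D 1?eq_sym //.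
    exact: setSD.
  + have sub : cls f' a :\ z \subset cls f a :\ z by apply: setSD.
    rewrite /free; case/soloP: (sy2) => _ -> _; rewrite -setI_eq0; apply/eqP/setP=> u.
    rewrite in_set0; apply/negP; rewrite inE in_nbr => /andP[e2u].
    rewrite !cls_recolor eqxx eq_sym (negPf ca) cls0D 1?eq_sym // in_setU1.
    case/orP=> [/eqP uy1|/(subsetP sub)].
      by case: (gf) => -[Pf _] _ _; apply: (Pf _ _ _ e2u fy2); rewrite uy1.
    by rewrite !inE => /andP[uz /eqP fu]; rewrite (solo_nbr sy2 e2u fu) eqxx in uz.
- move=> d; have [->|da] := eqVneq d a.
    rewrite clsga cardsU1 cardsU1 !inE (eq_sym y2) (negPf y12) f'y1 f'y2.
    rewrite (inj_eq Some_inj) (negPf ca) !andbF /=.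
    by move: lta; rewrite (cardsD1 z (cls f' a)) za.
  by have [->|dc] := eqVneq d c; [rewrite -cgc | rewrite clsgD].
- have zD := good_dom gf fz; have y1D := good_dom gf fy1; have y2D := good_dom gf fy2.
  rewrite !dom_recolor !dom_erase df'; apply/setP=> u; rewrite !inE.
  have [->|_] := eqVneq u y2; first by rewrite y2D.
  have [->|_] := eqVneq u y1; first by rewrite y1D.
  by have [->|//] := eqVneq u z; rewrite zD.
have cgE d : d \in E -> d != c -> cls g d = cls f d.
  by move=> dE dc; rewrite clsgD ?clsE //; apply: stuck_neq ra; apply: Es.
have rgc : reaches g c by apply: reaches_nonfull; rewrite -cgc.
pose Q := stuck g :&: E.
have QE d : d \in Q -> [/\ d \in E, d \in stuck g & d != c].
  by rewrite inE => /andP[dg dE]; split=> //; apply: stuck_neq dg rgc.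
have clsQ d : d \in Q -> cls g d = cls f d by case/QE=> dE _ dc; apply: cgE.
have colQ : colored g Q = colored f Q by apply: eq_colored clsQ.
(* The class [c] has lost two vertices and gained one: this is the defect 1 allowed there. *)
apply: (stuck_outside gg rE).
  rewrite card_colored (bigD1 c) //= -addnAC addn1 cgc (cardsD1 c) cE mulSn leq_add2l.
  rewrite -sum_nat_const [leqLHS](eq_bigl (fun d => (d \in E) && (d != c))); last first.
    by move=> d; rewrite !inE andbC.
  apply: leq_sum => d /andP[dE dc]; rewrite cgE // (stuck_full gf) //; exact: Es.
apply: (few_inner (X := solo f a z) gg).
- by move=> d /QE[_ dg _]; apply: stuck_full.
- rewrite rE -[3]/(1 + 2) addnA leq_add2r addn1.
  apply/proper_card/properP; split; first exact: subsetIr.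
  by exists c; rewrite // inE stuckE rgc.
(* [y1] and [y2] have no colour of [Q], so seven members of [solo f a z] leave at most five
   exceptions. *)
- have: solo f a z :&: colored g Q \subset solo f a z :\ y1 :\ y2.
    rewrite colQ; apply/subsetP=> u; rewrite !in_setD1 inE => /andP[-> uQ]; rewrite andbT.
    have fuc : f u != Some c.
      case/coloredP: uQ => d dQ ->; rewrite (inj_eq Some_inj).
      by case/QE: dQ.
    by apply/andP; split; apply: contraNneq fuc => ->; rewrite ?fy1 ?fy2.
  move/subset_leq_card/leq_trans; apply; move: t7.
  by rewrite (cardsD1 y1) sy1 (cardsD1 y2 (_ :\ _)) in_setD1 sy2 eq_sym y12.
move=> v; rewrite colQ => vQ; have [d dQ fv] := coloredP _ _ _ vQ.
have [dE ds dc] := QE d dQ.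
have gv : g v = Some d by apply/eqP; rewrite -in_cls clsQ // in_cls fv.
have vE : v \in colored f E by rewrite (colored_Some _ fv).
have wit u d' : f u = Some d' -> d' \notin Q -> u \in colored g (~: Q).
  move=> fu d'Q; case: (gg) => _ _ dg; rewrite coloredC dg inE (good_dom gf fu) andbT.
  by rewrite colQ (colored_Some _ fu).
have fnbr d' : d' \in L v -> d' \notin Q -> d' != c -> exists2 u, e v u & f u = Some d'.
  move=> d'L d'Q d'c; have [d'E|d'E] := boolP (d' \in E); last exact: nbrE.
  have rd' : reaches g d' by move: d'Q; rewrite inE d'E andbT stuckE negbK.
  have [u evu gu] := stuck_nbr gv ds d'L rd'; exists u => //.
  by apply/eqP; rewrite -in_cls -cgE // in_cls gu.
have cnbr : c \in L v -> exists2 u, e v u & u = z \/ f u = Some c.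
  move=> cLv; have [u evu gu] := stuck_nbr gv ds cLv rgc; exists u => //.
  have: u \in cls g c by rewrite in_cls gu.
  by rewrite clsgc !inE => /orP[/eqP|/and3P[_ _ /eqP]]; [left|right].
have [vS|vS] := boolP (v \in solo f a z).
  rewrite -[nat_of_bool _](cards1 c); apply: (out_nbrs (lab := f)) => d' d'L d'Q.
  rewrite inE => d'c.
  by have [u evu fu] := fnbr d' d'L d'Q d'c; exists u; split=> //; apply: wit d'Q.
rewrite -[nat_of_bool _](cards0 K).
(* [z] has colour [c] in [g] and is made to represent [c]. The colour [a] then needs a second
   neighbour in its class under [f], which exists as [v] is not in [solo f a z]. *)
pose lab u := if e v z && (u == z) then Some c else f u.
apply: (out_nbrs (lab := lab)) => d' d'L d'Q _.
have zC : z \in colored g (~: Q).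
  by apply: wit fz _; apply/negP=> /QE[aE _ _]; have := Es _ aE; rewrite stuckE ra.
have [d'c|d'c] := eqVneq d' c.
  have [|u evu uz] := cnbr; first by rewrite -d'c.
  have [evz|nevz] := boolP (e v z).
    by exists z; rewrite /lab evz eqxx d'c.
  case: uz => [uz|fu]; first by rewrite -uz evu in nevz.
  exists u; rewrite /lab (negPf nevz) d'c; split=> //; apply: wit fu _.
  by rewrite -d'c.
have [u evu fu] := fnbr d' d'L d'Q d'c.
have [uz|uz] := eqVneq u z; last first.
  by exists u; rewrite /lab (negPf uz) andbF; split=> //; apply: wit d'Q.
have d'a : d' = a by move: fu; rewrite uz fz => -[].
have: [exists w in nbr v :&: cls f a, w != z].
  apply: contraR vS; rewrite negb_exists_in => /forall_inP all_z.
  rewrite inE (subsetP (coloredS f (_ : E \subset _))) //; last exact/subsetP.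
  rewrite -d'a d'L d'a; apply/eqP/setP=> w; apply/idP/set1P => [wn|->].
    by apply/eqP; move: (all_z w wn); rewrite negbK.
  by rewrite inE in_nbr -uz evu in_cls uz fz eqxx.
case/exists_inP=> w; rewrite !inE => /andP[evw /eqP fw] wz.
by exists w; rewrite /lab (negPf wz) andbF d'a; split=> //; apply: wit fw _; rewrite -d'a.
Qed.

(** * Counting around a vertex for whose place many others wait *)

(** All of [S] except [y1] and [y2] is joined to the three vertices [z], [y1], [y2], and the edge
    bound excludes K_{3,3}. *)
Lemma no_K3_join (S : {set V}) z y1 y2 :
    (forall y, y \in S -> e z y) -> y1 \in S -> y2 \in S -> y1 != y2 ->
    (forall w, w \in S -> w != y1 -> e y1 w) -> (forall w, w \in S -> w != y2 -> e y2 w) ->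
  #|S| <= 4.
Proof.
move=> ez y1S y2S y12 e1 e2; rewrite leqNgt; apply/negP=> S5.
pose U := [set z; y1; y2]; pose W := S :\ y1 :\ y2.
have zS : z \notin S by apply/negP=> /ez; rewrite e_irr.
have cW : #|S| = #|W| + 2.
  by rewrite (cardsD1 y1 S) y1S (cardsD1 y2 (S :\ y1)) in_setD1 y2S eq_sym y12 addnA addnC.
have cU : #|U| = 3.
  have [zy1 zy2] : z != y1 /\ z != y2 by split; apply: contraNneq zS => ->.
  by rewrite /U setUC cardsU1 cards2 !inE negb_or !(eq_sym y2) zy2 y12 zy1.
have disUW : [disjoint U & W].
  rewrite -setI_eq0; apply/eqP/setP=> u; rewrite !inE.
  have [->|_] := eqVneq u y2; first by rewrite andbF.
  have [->|_] := eqVneq u y1; first by rewrite andbF.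
  by have [->|//] := eqVneq u z; rewrite (negPf zS).
have all u : u \in U -> #|nbr u :&: W| = #|W|.
  move=> uU; congr #|pred_of_set _|; apply/setIidPr/subsetP=> w.
  rewrite !inE => /and3P[w2 w1 wS].
  by move: uU; rewrite !inE -orbA => /or3P[] /eqP ->; [apply: ez|apply: e1|apply: e2].
have := sparse disUW; rewrite cU (eq_bigr _ all) sum_nat_const cU.
move: S5; rewrite cW; clear; lia.
Qed.

Lemma card_sub (T : finType) (A : {set T}) (P : pred T) :
  #|[set t in A | P t]| = \sum_(t in A) P t.
Proof.
rewrite -sum1_card big_mkcond [RHS]big_mkcond /=; apply: eq_bigr => t _.
by rewrite inE; case: (t \in A); case: (P t).
Qed.

Lemma card_inter_colored f (N : {set V}) Q :
  #|N :&: colored f Q| = \sum_(c in Q) #|N :&: cls f c|.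
Proof.
have cardE (A : {set V}) : #|N :&: A| = \sum_(v in A) (v \in N).
  by rewrite setIC -card_sub; apply: eq_card => v; rewrite !inE.
by rewrite cardE sum_colored; apply: eq_bigr => c _; rewrite cardE.
Qed.

(** Meant for [N] the neighbours of [z] in stuck classes, [Q] the stuck colours of its list, and [S]
    the vertices waiting for [z]. Let n count the elements of [N] of one colour. The excesses n - 1
    of the colours present, plus the elements coloured outside [Q], sum to at most 1 + 2 = 3. Apart
    from one colour with n = 1, a colour gives [S] at most twice its excess, so |S| <= 1 + 6. If no
    colour has just two elements, both in [S], the worst ratio is 3 elements for excess 2, and 1 +
    9/2 rounds down to 5. *)
Lemma few_repeats f (N S : {set V}) (Q : {set K}) :
    S \subset N -> #|N| <= #|Q| + 1 -> #|[set c in Q | N :&: cls f c == set0]| <= 2 ->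
    #|[set c in Q | [exists y in S, N :&: cls f c == [set y]]]| <= 1 ->
  #|S| <= 7 /\
  ((forall c y1 y2, c \in Q -> y1 \in S -> y2 \in S -> y1 != y2 ->
      N :&: cls f c <> [set y1; y2]) -> #|S| <= 5).
Proof.
move=> sub cN p2 u1.
pose n c := #|N :&: cls f c|; pose m c := #|S :&: cls f c|.
pose u c := [exists y in S, N :&: cls f c == [set y]].
have mn c : m c <= n c by apply/subset_leq_card/setSI.
have sumN : #|N| = #|N :\: colored f Q| + \sum_(c in Q) n c.
  by rewrite addnC -card_inter_colored cardsID.
have sumS : #|S| <= #|N :\: colored f Q| + \sum_(c in Q) m c.
  rewrite addnC -card_inter_colored -(cardsID (colored f Q) S) leq_add2l.
  exact/subset_leq_card/setSD.
have sumn : \sum_(c in Q) n c + #|[set c in Q | N :&: cls f c == set0]|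
    = \sum_(c in Q) (n c).-1 + #|Q|.
  rewrite card_sub -sum1_card -!big_split /=; apply: eq_bigr => c _.
  by rewrite -cards_eq0 -/(n c); case: (n c) => //= k; rewrite addn0 addn1.
have sumu : \sum_(c in Q) u c <= 1 by rewrite -card_sub.
have u_or c : n c = 1 -> m c <= u c.
  move/eqP/cards1P=> [y Ny]; rewrite /m /u Ny.
  have [yS|yS] := boolP (y \in S).
    rewrite (_ : [exists _ in _, _] = true); last by apply/exists_inP; exists y.
    by rewrite -[X in _ <= X](cards1 y) -Ny; apply/subset_leq_card/setSI.
  suff -> : S :&: cls f c = set0 by rewrite cards0.
  apply/setP=> w; rewrite in_set0; apply/negP=> wS.
  have: w \in N :&: cls f c by apply: subsetP wS; apply: setSI.
  by rewrite Ny => /set1P wy; move: wS; rewrite wy inE (negPf yS).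
have m1 c : m c <= u c + 2 * (n c).-1.
  have := u_or c; have := mn c; case: (n c) => [|[|k]] /=; first by clear; lia.
    by move=> _ /(_ erefl); clear; lia.
  by clear; lia.
split.
  have : \sum_(c in Q) m c <= \sum_(c in Q) u c + 2 * \sum_(c in Q) (n c).-1.
    by rewrite big_distrr -big_split; apply: leq_sum.
  by move: sumN sumS sumn sumu cN p2; clear; lia.
move=> nodbl.
have m2 c : c \in Q -> 2 * m c <= 2 * u c + 3 * (n c).-1.
  move=> cQ; have := u_or c; have := mn c; have := nodbl c.
  move=> nodb mn_c u_c; have [n2|n2] := eqVneq (n c) 2; last first.
    by case: (n c) n2 mn_c u_c => [|[|[|k]]] //= _; [| |]; clear; lia.
  rewrite n2; have [m2|] := eqVneq (m c) 2; last by move: mn_c; rewrite n2; clear; lia.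
  have mN : S :&: cls f c = N :&: cls f c.
    by apply/eqP; rewrite eqEcard setSI //= -/(n c) -/(m c) n2 m2.
  have [y1 [y2 [y12 Ny]]] : exists y1 y2, y1 != y2 /\ N :&: cls f c = [set y1; y2].
    by move/eqP/cards2P: n2 => [y1 [y2 [y12 Ny]]]; exists y1, y2.
  case: (nodb y1 y2 cQ) => //.
    have: y1 \in N :&: cls f c by rewrite Ny !inE eqxx.
    by rewrite -mN inE => /andP[].
  have: y2 \in N :&: cls f c by rewrite Ny !inE eqxx orbT.
  by rewrite -mN inE => /andP[].
have : 2 * \sum_(c in Q) m c <= 2 * \sum_(c in Q) u c + 3 * \sum_(c in Q) (n c).-1.
  by rewrite !big_distrr -big_split; apply: leq_sum.
by move: sumN sumS sumn sumu cN p2; clear; lia.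
Qed.

(** * Double counting between stuck and reachable classes *)

Lemma double_count (A B : {set V}) (P : V -> V -> bool) :
  \sum_(v in A) #|[set u in B | P v u]| = \sum_(u in B) #|[set v in A | P v u]|.
Proof.
under eq_bigr do rewrite card_sub; rewrite exchange_big /=.
by under [RHS]eq_bigr do rewrite card_sub.
Qed.

Lemma sum_nbr (A B : {set V}) : \sum_(v in A) #|nbr v :&: B| = \sum_(u in B) #|nbr u :&: A|.
Proof.
have E (C : {set V}) v : #|nbr v :&: C| = #|[set u in C | e v u]|.
  by apply: eq_card => u; rewrite !inE andbC.
under eq_bigr do rewrite E; under [RHS]eq_bigr do rewrite E.
rewrite double_count; apply: eq_bigr => u _.
by apply: eq_card => v; rewrite !inE e_sym.
Qed.

Lemma solo_pair f y c :
    good f -> y \in colored f (stuck f) -> c \in L y -> reaches f c ->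
  2 <= #|nbr y :&: cls f c| + #|[set z in cls f c | y \in solo f c z]|.
Proof.
move=> gf yB cL rc; have [d ds fy] := coloredP _ _ _ yB.
have [u eyu fu] := stuck_nbr fy ds cL rc.
have : 0 < #|nbr y :&: cls f c| by apply/card_gt0P; exists u; rewrite inE in_nbr eyu in_cls fu eqxx.
case E : #|_ :&: _| => [|[|k]] // _; move/eqP/cards1P: E => [z Ez].
rewrite addSn ltnS add0n; apply/card_gt0P; exists z; rewrite inE.
have : z \in nbr y :&: cls f c by rewrite Ez set11.
by rewrite inE => /andP[_ ->]; rewrite inE yB cL Ez eqxx.
Qed.

(** The list of a vertex of [Y] has at least k reachable colours. Each contributes two: two
    neighbours, or a single one that is counted again in the second sum. *)
Lemma solo_sum f k (Y : {set V}) :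
    good f -> r = #|stuck f| + k -> Y \subset colored f (stuck f) ->
  2 * k * #|Y| <= \sum_(z in colored f (~: stuck f)) #|nbr z :&: Y| +
    \sum_(c in ~: stuck f) \sum_(z in cls f c) #|[set y in Y | y \in solo f c z]|.
Proof.
move=> gf rk /subsetP YB; rewrite sum_nbr.
under [X in _ <= _ + X]eq_bigr do rewrite double_count.
rewrite exchange_big -big_split mulnC -sum_nat_const; apply: leq_sum => y yY /=.
rewrite card_inter_colored -big_split /=.
apply: (@leq_trans (\sum_(c in L y :\: stuck f) 2)).
  rewrite sum_nat_const mulnC leq_mul2r /=.
  have := cardsID (stuck f) (L y); have := subset_leq_card (subsetIr (L y) (stuck f)).
  by rewrite card_L; move: rk; clear; lia.
rewrite [leqLHS]big_mkcond [leqRHS]big_mkcond /=; apply: leq_sum => c _.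
rewrite !inE negbK; case: (reaches f c) (@solo_pair f y c gf (YB y yY)) => //=.
by case: (c \in L y) => // ->.
Qed.

(** By [immovable], [z] has a neighbour in each reachable class of its list except its own, and its
    degree is at most r = |L z|. *)
Lemma nbr_stuck_le f a z y :
    exchangeable f a -> minimal f -> y \in solo f a z ->
  #|nbr z :&: colored f (stuck f)| <= #|L z :&: stuck f| + 1.
Proof.
move=> bf minf sy; have [gf ra _ _] := bf.
have out : #|L z :\: stuck f :\ a| <= #|nbr z :&: colored f (~: stuck f)|.
  apply: (card_labels (lab := f)) => c; rewrite !inE negbK => /and3P[ca rc cL].
  have [u ezu fu] := not_free cL (immovable bf minf sy rc ca).
  by exists u; rewrite // inE in_nbr ezu (colored_Some _ fu) inE stuckE rc.
have disj : #|nbr z :&: colored f (stuck f)| + #|nbr z :&: colored f (~: stuck f)| <= r.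
  apply: leq_trans (deg_le z); rewrite -(cardsID (colored f (stuck f)) (nbr z)) leq_add2l.
  by apply/subset_leq_card/subsetP=> u; rewrite coloredC !inE => /and3P[-> ->].
have := cardsID (stuck f) (L z); have := cardsD1 a (L z :\: stuck f).
rewrite card_L; move: out disj; case: (a \in _); clear; lia.
Qed.

Lemma solo_adj_z f a z y : y \in solo f a z -> e z y.
Proof. by case/solo_adj; rewrite e_sym. Qed.

Lemma nonadj_solos f a z (Y : {set V}) :
  Y \subset solo f a z -> 4 < #|Y| ->
  exists y1 y2, [/\ y1 \in Y, y2 \in Y, y1 != y2 & ~~ e y1 y2].
Proof.
move=> /subsetP YS Y5.
have [/exists_inP[y1 y1Y /exists_inP[y2 y2Y /andP[y12 ne]]]|no] :=
  boolP [exists y1 in Y, [exists y2 in Y, (y1 != y2) && ~~ e y1 y2]].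
  by exists y1, y2.
have adj y1 y2 : y1 \in Y -> y2 \in Y -> y2 != y1 -> e y1 y2.
  move=> y1Y y2Y y12; apply: contraR no => ne; apply/exists_inP; exists y1 => //.
  by apply/exists_inP; exists y2; rewrite // eq_sym y12.
have /card_gt1P[y1 [y2 [y1Y y2Y y12]]] : 1 < #|Y| by apply: leq_trans Y5.
have := no_K3_join (fun y yY => solo_adj_z (YS y yY)) y1Y y2Y y12 (adj y1 ^~ y1Y) (adj y2 ^~ y2Y).
by rewrite leqNgt Y5.
Qed.

(** [few_repeats] around [z]: six waiting vertices do not fit unless some colour occurs exactly
    twice, at two of them. *)
Lemma doubled_exists f a z :
    exchangeable f a -> minimal f -> 5 < #|solo f a z| ->
    #|[set c in stuck f | free f z c]| <= 2 ->
  #|solo f a z| <= 7 /\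
  exists c y1 y2, [/\ c \in stuck f, c \in L z, nbr z :&: cls f c = [set y1; y2], y1 != y2
    & y1 \in solo f a z /\ y2 \in solo f a z].
Proof.
move=> bf minf t6 p2; have [gf ra _ _] := bf.
have /card_gt0P[y0 sy0] : 0 < #|solo f a z| by apply: leq_trans t6.
pose N := nbr z :&: colored f (stuck f); pose Q := L z :&: stuck f.
have Ncls c : c \in Q -> N :&: cls f c = nbr z :&: cls f c.
  rewrite inE => /andP[_ cs]; rewrite /N -setIA; congr (_ :&: _).
  by apply/setIidPr/cls_colored.
have SN : solo f a z \subset N.
  apply/subsetP=> y sy; rewrite inE in_nbr (solo_adj_z sy).
  by case/soloP: sy.
have [||t7 dbl] := few_repeats (f := f) (Q := Q) SN (nbr_stuck_le bf minf sy0).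
- apply: leq_trans p2; apply/subset_leq_card/subsetP=> c /setIdP[cQ].
  rewrite Ncls // => N0; case/setIP: cQ => cL cs; apply/setIdP; split=> //.
  by rewrite /free cL -setI_eq0.
(* Two colours that occur only at waiting vertices [y1] and [y2] would, by [only_nbr_adj], join both
   to all other waiting vertices, against [no_K3_join]. *)
- rewrite leqNgt; apply/negP=> /card_gt1P[c [d []]].
  move=> /setIdP[cQ /exists_inP[y1 sy1 /eqP]] + /setIdP[dQ /exists_inP[y2 sy2 /eqP]].
  rewrite !Ncls // => n1 n2 cd.
  have fy1 : f y1 = Some c.
    have /setIP[_] : y1 \in nbr z :&: cls f c by rewrite n1 set11.
    by rewrite in_cls => /eqP.
  have fy2 : f y2 = Some d.
    have /setIP[_] : y2 \in nbr z :&: cls f d by rewrite n2 set11.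
    by rewrite in_cls => /eqP.
  have y12 : y1 != y2 by apply: contraNneq cd => y12; move: fy1; rewrite y12 fy2 => -[->].
  have [/setIP[cL _] /setIP[dL _]] := (cQ, dQ).
  have a1 w : w \in solo f a z -> w != y1 -> e y1 w.
    by move=> sw w1; apply: (only_nbr_adj bf minf sy1 sw _ fy1 cL n1); rewrite eq_sym.
  have a2 w : w \in solo f a z -> w != y2 -> e y2 w.
    by move=> sw w2; apply: (only_nbr_adj bf minf sy2 sw _ fy2 dL n2); rewrite eq_sym.
  have := no_K3_join (@solo_adj_z f a z) sy1 sy2 y12 a1 a2.
  by move: t6; clear; lia.
split=> //.
have [/exists_inP[c cQ /exists_inP[y1 sy1 /exists_inP[y2 sy2 /andP[y12 /eqP n]]]]|no] :=
  boolP [exists c in Q, [exists y1 in solo f a z, [exists y2 in solo f a z,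
          (y1 != y2) && (N :&: cls f c == [set y1; y2])]]].
  exists c, y1, y2; rewrite -Ncls //; case/setIP: cQ => cL cs.
  by split.
have: #|solo f a z| <= 5.
  apply: dbl => c y1 y2 cQ sy1 sy2 y12 n; move/negP: no; apply.
  apply/exists_inP; exists c => //; apply/exists_inP; exists y1 => //.
  by apply/exists_inP; exists y2; rewrite // y12 n eqxx.
by rewrite leqNgt t6.
Qed.

Lemma few_free f a z (Y : {set V}) :
    exchangeable f a -> minimal f -> Y \subset solo f a z -> 4 < #|Y| ->
    (forall y c, y \in Y -> f y = Some c -> ~ (r = #|stuck f| + 1 /\ dominating f c)) ->
  #|[set c in stuck f | free f z c]| <= 2.
Proof.
move=> bf minf YS Y5 no; rewrite leqNgt; apply/negP=> p3.
have [y1 [y2 [y1Y y2Y y12 ne]]] := nonadj_solos YS Y5.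
have [sy1 sy2] := (subsetP YS _ y1Y, subsetP YS _ y2Y).
have [c _ fy1] := solo_stuck sy1.
exact: (no y1 c y1Y fy1 (dominating_color bf minf sy1 sy2 y12 ne fy1 p3)).
Qed.

(** For b = r - 2 the colouring is minimal by [stuck_ge], and [dominating_color] cannot apply since
    it forces b = r - 1; so some colour is doubled. If the class [a] is full, [w] first leaves it to
    make room for both [y1] and [y2]. *)
Lemma not_two_short_many f a z :
  exchangeable f a -> r = #|stuck f| + 2 -> ~ 5 < #|solo f a z|.
Proof.
move=> bf b2 t6; have [gf ra nonfull alt] := bf.
have minf : minimal f by move=> g /stuck_ge; rewrite b2 leq_add2r.
have p2 : #|[set c in stuck f | free f z c]| <= 2.
  apply: (few_free bf minf (subxx _) (ltnW t6)) => y c _ _ [b1 _].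
  by move: b1 b2; clear; lia.
have [t7 [c [y1 [y2 [cs cL n y12 [sy1 sy2]]]]]] := doubled_exists bf minf t6 p2.
have nbrs v d : v \in colored f (stuck f) -> d \in L v -> d \notin stuck f ->
    exists2 u, e v u & f u = Some d.
  move=> /coloredP[d' d's fv] dL; rewrite stuckE negbK; exact: stuck_nbr fv d's dL.
have [_ fz] := solo_adj sy1.
case: alt => [lt|[w [d [fw da lt fr]]]].
  by apply: (doubled_color gf gf b2 _ ra nbrs _ _ _ lt sy1 sy2 y12 cs cL n t7) => //;
     rewrite in_cls fz.
have rd := reaches_nonfull lt.
have wz : w != z.
  by apply: contraTneq fr => ->; apply: immovable bf minf sy1 rd da.
have [Pf le df] := gf.
pose f' := recolor f w (Some d).
have clsa : cls f' a = cls f a :\ w by rewrite cls_recolor eq_sym (negPf da).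
have clsD d' : d' != a -> d' != d -> cls f' d' = cls f d'.
  move=> d'a d'd; rewrite cls_recolor (negPf d'd); apply/setDidPl.
  by rewrite disjoint_sym disjoints1 in_cls fw (inj_eq Some_inj) eq_sym.
have lta : #|cls f' a| < s.
  by rewrite clsa; apply: leq_trans (le a); rewrite (cardsD1 w (cls f a)) in_cls fw eqxx.
have gf' : good f'.
  split; first exact: lcoloring_recolor.
    move=> d'; have [->|d'd] := eqVneq d' d.
      rewrite cls_recolor eqxx; apply: leq_trans lt.
      by rewrite cardsU1; case: (w \notin _); rewrite ?ltnS.
    have [->|d'a] := eqVneq d' a; first exact: ltnW.
    by rewrite clsD.
  by rewrite dom_recolor df; apply: setU1_in; apply: good_dom gf fw.
apply: (doubled_color gf gf' b2 _ ra nbrs _ _ _ lta sy1 sy2 y12 cs cL n t7) => //.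
- by move=> d' d's; rewrite clsD //; [apply: stuck_neq ra | apply: stuck_neq rd].
- by rewrite clsa subD1set.
by rewrite clsa !inE eq_sym wz fz eqxx.
Qed.

(** * Averaging, and the cases b = r - 2 and b = r - 1 *)

Lemma many_solos f k t (Y : {set V}) :
    good f -> r = #|stuck f| + k -> Y \subset colored f (stuck f) ->
    \sum_(z in colored f (~: stuck f)) #|nbr z :&: Y| + t * #|colored f (~: stuck f)|
      < 2 * k * #|Y| ->
  exists a z, [/\ reaches f a, f z = Some a & t < #|[set y in Y | y \in solo f a z]|].
Proof.
move=> gf rk YB lt.
have [/existsP[a /existsP[z /and3P[ra /eqP fz tz]]]|no] :=
  boolP [exists a, [exists z, [&& reaches f a, f z == Some a &
           t < #|[set y in Y | y \in solo f a z]|]]]; first by exists a, z.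
suff: 2 * k * #|Y| <= \sum_(z in colored f (~: stuck f)) #|nbr z :&: Y|
    + t * #|colored f (~: stuck f)| by rewrite leqNgt lt.
apply: leq_trans (solo_sum gf rk YB) _; rewrite leq_add2l card_colored big_distrr /=.
apply: leq_sum => a; rewrite inE stuckE negbK => ra; rewrite mulnC -sum_nat_const.
apply: leq_sum => z; rewrite in_cls => fz; rewrite leqNgt.
apply: contra no => tz; apply/existsP; exists a; apply/existsP; exists z.
by rewrite ra fz.
Qed.

Lemma sum_nbr_le (A B : {set V}) : \sum_(z in A) #|nbr z :&: B| <= r * #|A|.
Proof.
rewrite mulnC -sum_nat_const; apply: leq_sum => z _.
by apply: leq_trans (deg_le z); apply/subset_leq_card/subsetIl.
Qed.

Lemma card_two_classes f a c :
  reaches f a -> reaches f c -> c != a ->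
  #|cls f a| + #|cls f c| + #|colored f (~: stuck f :\ a :\ c)| = #|colored f (~: stuck f)|.
Proof.
move=> ra rc ca; rewrite !card_colored [in RHS](big_setD1 a) ?inE ?stuckE ?negbK //=.
by rewrite [in RHS](big_setD1 c) ?inE ?negbK ?ca //= addnA.
Qed.

(** Fewer than 2 s vertices have reachable colours, so at most one reachable class is full. If [a]
    is, one of its vertices moves to some [c]. Either the number of full classes drops, which is the
    induction, or [a] and [c] hold all these vertices and the averaging is done over the class [a]
    alone. *)
Lemma not_two_short f : good f -> r <> #|stuck f| + 2.
Proof.
have [n] := ubnP #|[set c | #|cls f c| == s]|.
elim: n f => // n IH f; rewrite ltnS => full_n gf b2.
have Alt : #|colored f (~: stuck f)| < 2 * s.
  by have := card_reachable gf; rewrite {1}b2 addKn.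
have B : #|colored f (stuck f)| = (r - 2) * s.
  by rewrite full_colored ?b2 ?addnK // => c; apply: stuck_full.
have [/exists_inP[a]|no] := boolP [exists a in ~: stuck f, s <= #|cls f a|]; last first.
  have nonfull c : reaches f c -> #|cls f c| < s.
    move=> rc; rewrite ltnNge; apply: contra no => le; apply/exists_inP; exists c => //.
    by rewrite inE stuckE rc.
  have [|a [z [ra fz t6]]] := @many_solos f 2 5 _ gf b2 (subxx _).
    (* Since A < 2 s, (r + 5) A stays below 4 (r - 2) s as soon as r >= 9. *)
    apply: leq_ltn_trans (leq_add (sum_nbr_le _ _) (leqnn _)) _.
    rewrite B; move: Alt r_ge9; set A := #|_|; clear; nia.
  apply: (@not_two_short_many f a z) b2 _; last first.
    by apply: leq_trans t6 _; apply/subset_leq_card/subsetP=> y /setIdP[].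
  by split=> //; [move=> c rc _; apply: nonfull | left; apply: nonfull].
rewrite inE stuckE negbK => ra fulla.
have [Pf le df] := gf.
have nonfull c : reaches f c -> c != a -> #|cls f c| < s.
  move=> rc ca; rewrite ltnNge; apply/negP=> fullc.
  have := card_two_classes ra rc ca; move: Alt fulla fullc; clear; lia.
have [c [w [ca rc fw fr]]] : exists c w, [/\ c != a, reaches f c, f w = Some a & free f w c].
  have /existsP[d /andP[ltd /connectP[[|c p] /= pth ed]]] := ra.
    by move: ltd; rewrite ed ltnNge fulla.
  case/andP: pth => /andP[ac /exists_inP[w]]; rewrite in_cls => /eqP fw fr pth.
  exists c, w; split=> //; first by rewrite eq_sym.
  by apply/existsP; exists d; rewrite ltd; apply/connectP; exists p.
have ltc := nonfull c rc ca.
have bf : exchangeable f a by split=> //; right; exists w, c.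
have [ltc'|gec] := ltnP (#|cls f c|.+1) s.
  pose g := recolor f w (Some c).
  have clsa : cls g a = cls f a :\ w by rewrite cls_recolor eq_sym (negPf ca).
  have clsc : cls g c = w |: cls f c by rewrite cls_recolor eqxx.
  have wc : w \notin cls f c by rewrite in_cls fw (inj_eq Some_inj) eq_sym.
  have clsD d : d != a -> d != c -> cls g d = cls f d.
    move=> da dc; rewrite cls_recolor (negPf dc); apply/setDidPl.
    by rewrite disjoint_sym disjoints1 in_cls fw (inj_eq Some_inj) eq_sym.
  have cga : #|cls g a| < s.
    by rewrite clsa; apply: leq_trans (le a); rewrite (cardsD1 w (cls f a)) in_cls fw eqxx.
  have cgc : #|cls g c| < s by rewrite clsc cardsU1 wc.
  have gg : good g.
    split; first exact: lcoloring_recolor.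
      move=> d; have [->|dc] := eqVneq d c; first exact: ltnW.
      by have [->|da] := eqVneq d a; [apply: ltnW | rewrite clsD].
    by rewrite dom_recolor df; apply: setU1_in; apply: good_dom gf fw.
  have sub : stuck g \subset stuck f.
    apply/subsetP=> d; rewrite !stuckE; apply: contra => rd; apply: reaches_nonfull.
    have [->//|da] := eqVneq d a; have [->//|dc] := eqVneq d c.
    by rewrite clsD // nonfull.
  apply: (IH g) => //; last first.
    by have := stuck_ge gg; have := subset_leq_card sub; rewrite [in X in _ -> X]b2; clear; lia.
  apply: leq_trans full_n; apply/proper_card/properP; split.
    apply/subsetP=> d; rewrite !inE; have [->|da] := eqVneq d a.
      by move/eqP=> ea; rewrite ea ltnn in cga.
    have [->|dc] := eqVneq d c; first by move/eqP=> ec; rewrite ec ltnn in cgc.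
    by rewrite clsD.
  by exists a; rewrite inE; [rewrite eqn_leq le | apply/eqP=> ea; rewrite ea ltnn in cga].
have rest0 d : reaches f d -> d != a -> d != c -> cls f d = set0.
  move=> rd da dc; apply/eqP; rewrite -cards_eq0 -leqn0.
  have: #|colored f (~: stuck f :\ a :\ c)| = 0.
    by have := card_two_classes ra rc ca; move: Alt fulla gec; clear; lia.
  move=> <-; apply/subset_leq_card/cls_colored; rewrite !in_setD1 dc da.
  by rewrite inE stuckE rd.
(* A stuck vertex has a neighbour in each reachable class of its list. Only [a] and [c] are
   non-empty, and at least two colours of the list are reachable. *)
have aL y : y \in colored f (stuck f) -> a \in L y.
  move=> yB; have [d ds fy] := coloredP _ _ _ yB; apply/negPn/negP=> naL.
  have : #|L y :\: stuck f| <= 1.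
    rewrite -(cards1 c); apply/subset_leq_card/subsetP=> d'.
    rewrite !inE negbK => /andP[rd' d'L]; apply/negPn/negP=> d'c.
    have d'a : d' != a by apply: contraNneq naL => <-.
    have [u _ fu] := stuck_nbr fy ds d'L rd'.
    have: u \in cls f d' by rewrite in_cls fu.
    by rewrite rest0 // inE.
  have := cardsID (stuck f) (L y); have := subset_leq_card (subsetIr (L y) (stuck f)).
  by rewrite card_L b2; clear; lia.
have [/exists_inP[z zA t6]|few] := boolP [exists z in cls f a, 5 < #|solo f a z|].
  exact: not_two_short_many bf b2 t6.
have lower : 2 * #|colored f (stuck f)| <=
    \sum_(z in cls f a) (#|nbr z :&: colored f (stuck f)| + #|solo f a z|).
  have soloE z : #|solo f a z| = #|[set y in colored f (stuck f) | y \in solo f a z]|.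
    apply: eq_card => y; apply/idP/setIdP => [sy|[]//]; split=> //.
    by case/soloP: sy.
  under eq_bigr do rewrite soloE.
  rewrite big_split /= sum_nbr double_count -big_split mulnC -sum_nat_const.
  by apply: leq_sum => y yB; apply: solo_pair => //; apply: aL.
(* A [z] for which nobody waits has at most r neighbours; any other has at most (r - 2) + 1 in stuck
   classes and 5 waiting vertices. But 2 (r - 2) <= r + 4 fails for r >= 9. *)
have upper : \sum_(z in cls f a) (#|nbr z :&: colored f (stuck f)| + #|solo f a z|)
    <= s * (r + 4).
  apply: (@leq_trans (#|cls f a| * (r + 4))); last by rewrite leq_mul2r le orbT.
  rewrite -sum_nat_const; apply: leq_sum => z zA.
  have t5 : #|solo f a z| <= 5.
    by rewrite leqNgt; apply: contra few => t6; apply/exists_inP; exists z.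
  have [/eqP t0|] := posnP #|solo f a z|.
    rewrite (eqP t0) addn0; apply: leq_trans (leq_addr _ _); apply: leq_trans (deg_le z).
    exact/subset_leq_card/subsetIl.
  case/card_gt0P=> y sy; have minf : minimal f by move=> g /stuck_ge; rewrite b2 leq_add2r.
  have := nbr_stuck_le bf minf sy; have := subset_leq_card (subsetIr (L z) (stuck f)).
  by move: t5; rewrite [in X in _ -> _ -> _ -> X]b2; clear; lia.
have := leq_trans lower upper; rewrite B.
by move: s_gt0 r_ge9; clear; nia.
Qed.

(** The first averaging gives eight waiting vertices, one more than [doubled_exists] permits; so
    there is a dominating colour [d]. The second one omits the class [d] and still gives seven. By
    [dominating_unique] their classes are not dominating, so a colour in [E] is doubled. *)
Lemma not_one_short f : good f -> r <> #|stuck f| + 1.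
Proof.
move=> gf b1.
have minf : minimal f.
  move=> g gg; have := stuck_ge gg; rewrite leq_eqVlt => /predU1P[e2|].
    by case: (not_two_short gg e2).
  by rewrite [in X in X -> _]b1; clear; lia.
have Alt : #|colored f (~: stuck f)| < s.
  by have := card_reachable gf; rewrite {1}b1 addKn mul1n.
have nonfull c : reaches f c -> #|cls f c| < s.
  move=> rc; apply: leq_ltn_trans Alt; apply/subset_leq_card/cls_colored.
  by rewrite inE stuckE rc.
have bf a : reaches f a -> exchangeable f a.
  by move=> ra; split=> //; [move=> c rc _; apply: nonfull | left; apply: nonfull].
have B : #|colored f (stuck f)| = (r - 1) * s.
  by rewrite full_colored ?b1 ?addnK // => c; apply: stuck_full.
have [|a [z [ra fz t8]]] := @many_solos f 1 7 _ gf b1 (subxx _).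
  (* Since A < s, (r + 7) A stays below 2 (r - 1) s as soon as r >= 9. *)
  apply: leq_ltn_trans (leq_add (sum_nbr_le _ _) (leqnn _)) _.
  rewrite B; move: Alt r_ge9; set A := #|_|; clear; nia.
have {}t8 : 7 < #|solo f a z|.
  by apply: leq_trans t8 _; apply/subset_leq_card/subsetP=> y /setIdP[].
have [d ds domd] : exists2 d, d \in stuck f & dominating f d.
  have p3 : 2 < #|[set c in stuck f | free f z c]|.
    rewrite ltnNge; apply/negP=> p2.
    have t6 : 5 < #|solo f a z| by apply: leq_trans t8.
    by have [] := doubled_exists (bf a ra) minf t6 p2; rewrite leqNgt t8.
  have t5 : 4 < #|solo f a z| by apply: leq_trans t8.
  have [y1 [y2 [sy1 sy2 y12 ne]]] := nonadj_solos (subxx _) t5.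
  have [d ds fy1] := solo_stuck sy1; exists d => //.
  by have [] := dominating_color (bf a ra) minf sy1 sy2 y12 ne fy1 p3.
pose E := stuck f :\ d; pose Y := colored f E.
have rE : r = #|E| + 2 by rewrite b1 (cardsD1 d) ds -/E; clear; lia.
have ES : E \subset stuck f by rewrite subD1set.
have cY : #|Y| = (r - 2) * s.
  rewrite full_colored ?rE ?addnK // => c /(subsetP ES); exact: stuck_full.
have YB : Y \subset colored f (stuck f) by apply: coloredS.
have disY : [disjoint Y & cls f d].
  rewrite -setI_eq0; apply/eqP/setP=> u; rewrite !inE; apply/negP=> /andP[uY /eqP fu].
  by move: uY; rewrite (colored_Some _ fu) !inE eqxx.
(* Each of the s vertices of the class [d] has a neighbour of reachable colour. These s edges do not
   go to [Y], which makes up for part of the loss. *)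
have sumY : \sum_(z in colored f (~: stuck f)) #|nbr z :&: Y| + s
    <= r * #|colored f (~: stuck f)|.
  apply: (leq_trans _ (sum_nbr_le _ (Y :|: cls f d))).
  have split_nbr z' : #|nbr z' :&: (Y :|: cls f d)| = #|nbr z' :&: Y| + #|nbr z' :&: cls f d|.
    rewrite setIUr cardsU (_ : _ :&: (_ :&: _) = set0) ?cards0 ?subn0 //.
    by rewrite setIACA (disjoint_setI0 disY) setI0.
  under [leqRHS]eq_bigr do rewrite split_nbr.
  rewrite big_split leq_add2l sum_nbr -{1}(stuck_full gf ds) -sum1_card.
  apply: leq_sum => y; rewrite in_cls => /eqP fy; apply/card_gt0P.
  have [c] : exists c, c \in L y :\: stuck f.
    apply/card_gt0P; have := cardsID (stuck f) (L y).
    have := subset_leq_card (subsetIr (L y) (stuck f)).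
    by rewrite card_L b1; clear; lia.
  rewrite !inE negbK => /andP[rc cL]; have [u eyu fu] := stuck_nbr fy ds cL rc.
  by exists u; rewrite inE in_nbr eyu (colored_Some _ fu) inE stuckE rc.
have [|a' [z' [ra' fz' t7]]] := @many_solos f 1 6 _ gf b1 YB.
  by rewrite cY; move: sumY Alt r_ge9; set A := #|_|; set S := \sum_(_ in _) _; clear; nia.
set T := [set y in Y | _] in t7.
have TS : T \subset solo f a' z' by apply/subsetP=> y /setIdP[].
have p2 : #|[set c in stuck f | free f z' c]| <= 2.
  apply: (few_free (bf a' ra') minf TS); first by apply: leq_trans t7.
  move=> y c /setIdP[yY _] fy [_ domc].
  have cE : c \in E by move: yY; rewrite (colored_Some _ fy).
  have cd := dominating_unique gf b1 (subsetP ES _ cE) ds domc domd.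
  by move: cE; rewrite cd !inE eqxx.
have t6 : 5 < #|solo f a' z'|.
  by apply: leq_trans (subset_leq_card TS); apply: leq_trans t7.
have [s7 [c [y1 [y2 [cs cL n y12 [sy1 sy2]]]]]] := doubled_exists (bf a' ra') minf t6 p2.
(* At most seven vertices wait in all and seven of them are in [Y]; so none has colour [d]. *)
have eT : T = solo f a' z' by apply/eqP; rewrite eqEcard TS (leq_trans s7).
have cE : c \in E.
  have: y1 \in nbr z' :&: cls f c by rewrite n !inE eqxx.
  case/setIP=> _; rewrite in_cls => /eqP fy1.
  by move: sy1; rewrite -eT => /setIdP[+ _]; rewrite (colored_Some _ fy1).
apply: (doubled_color gf gf rE ES ra' _ _ _ _ (nonfull a' ra') sy1 sy2 y12 cE cL n s7) => //.
  move=> v c' vE c'L c'E; have [rc'|] := boolP (reaches f c').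
    by have [c2 c2E fv] := coloredP _ _ _ vE; apply: stuck_nbr fv (subsetP ES _ c2E) c'L rc'.
  rewrite -stuckE => c's; have c'd : c' = d.
    by apply/eqP; move: c'E; rewrite in_setD1 c's andbT negbK.
  by rewrite c'd; apply: domd; [exact: vE | rewrite -c'd].
by rewrite in_cls fz'.
Qed.

Lemma no_good f : ~ good f.
Proof.
move=> gf; have := stuck_ge gf; have := stuck_lt gf.
have := not_one_short gf; have := not_two_short gf; clear; lia.
Qed.

End PartialColorings.

(** * Colouring a sparse graph vertex by vertex *)

Section SparseGraphs.
Variables (V K : finType) (e : rel V) (L : V -> {set K}) (r s : nat).
Hypotheses (e_sym : symmetric e) (e_irr : irreflexive e).
Hypotheses (r_ge9 : 9 <= r) (card_L : forall v, #|L v| = r).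
Hypothesis deg_le : forall v, #|nbr e v| <= r.
Hypothesis sparse : forall U W : {set V}, [disjoint U & W] -> 3 <= #|U| + #|W| ->
  \sum_(u in U) #|nbr e u :&: W| + 4 <= 2 * (#|U| + #|W|).
Hypothesis degenerate : forall X : {set V}, X != set0 ->
  exists2 v, v \in X & #|nbr e v :&: X| <= 6.
Hypothesis card_V : #|V| <= r * s.

(** If [D] had no such colouring, the one of [D :\ x] would contradict [no_good]. *)
Lemma partial_equitable (D : {set V}) :
  exists f, [/\ lcoloring e L f, forall c, #|cls f c| <= s & dom f = D].
Proof.
have [n] := ubnP #|D|; elim: n D => // n IH D; rewrite ltnS => Dn.
have [->|D0] := eqVneq D set0.
  exists [ffun _ => None]; split.
  - by split=> [u v c _|v c]; rewrite !ffunE.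
  - move=> c; rewrite (_ : cls _ c = set0) ?cards0 //.
    by apply/setP=> v; rewrite !inE ffunE.
  - by apply/setP=> v; rewrite !inE ffunE.
have [x xD dx] := degenerate D0.
have cD : #|D :\ x| < #|D| by rewrite (cardsD1 x D) xD.
have [f gf] := IH _ (leq_trans cD Dn).
apply: contrapT => none.
have xD' : x \notin D :\ x by rewrite !inE eqxx.
have cD' : #|D :\ x| < r * s by apply: leq_trans card_V; apply: leq_trans cD (max_card _).
have dx' : #|nbr e x :&: (D :\ x)| <= 6.
  by apply: leq_trans dx; apply/subset_leq_card/setIS; rewrite subD1set.
apply: (no_good e_sym e_irr r_ge9 card_L deg_le sparse xD' cD' dx' _ gf).
by move=> g Pg sg dg; apply: none; exists g; rewrite dg setD1K.
Qed.

Lemma sparse_equitable : exists f : V -> K,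
  [/\ forall u v, e u v -> f u != f v, forall v, f v \in L v
    & forall c, #|[set v | f v == c]| <= s].
Proof.
have [f [[Pf Lf] sf df]] := partial_equitable [set: V].
have col v : exists c, f v == Some c.
  have : v \in dom f by rewrite df inE.
  by rewrite in_dom; case: (f v) => // c _; exists c.
have fE v : f v = Some (xchoose (col v)) by apply/eqP; exact: (xchooseP (col v)).
exists (fun v => xchoose (col v)); split.
- by move=> u v euv; apply/eqP=> uv; apply: (Pf u v _ euv (fE u)); rewrite uv.
- by move=> v; apply: Lf.
- move=> c; apply: leq_trans (sf c); apply/subset_leq_card/subsetP=> v.
  by rewrite !inE => /eqP vc; rewrite [X in X == _]fE vc.
Qed.

End SparseGraphs.

(** * The number of faces of a plane graph *)

Lemma card_fibers (T S : finType) (f : T -> S) (g : nat) :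
  (forall t, g <= #|[set t' | f t' == f t]|) -> g * #|[set f t | t in T]| <= #|T|.
Proof.
move=> fib; rewrite -[in leqRHS]sum1_card (partition_big_imset f) /=.
rewrite mulnC -sum_nat_const; apply: leq_sum => c /imsetP[t _ ->].
apply: leq_trans (fib t) _; rewrite sum1dep_card; apply: subset_leq_card.
by apply/subsetP=> t'; rewrite !inE => /eqP ->.
Qed.

Lemma F2_add (a : 'F_2) : (a + a = 0)%R.
Proof. by rewrite -mulr2n -mulr_natr pchar_Zp // mulr0. Qed.

Lemma F2_eq (a b : 'F_2) : (a + b = 0)%R -> a = b.
Proof. by move=> ab; rewrite -[a]addr0 -(F2_add b) addrA ab add0r. Qed.

(** * A rank bound for the number of distinct columns *)

Section RankBound.
Local Open Scope ring_scope.
Variables (F : finFieldType) (m n k : nat).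
Variables (M : 'M[F]_(m, n)) (P : 'M[F]_(m, k)) (J : 'M[F]_(k, m)).
Hypotheses (n_gt0 : (0 < n)%N) (k_gt0 : (0 < k)%N).
Hypothesis M1 : M *m const_mx 1 = 0 :> 'cV_m.
Hypothesis J1 : (const_mx 1 : 'rV_k) *m J = 0.
Hypothesis PJ : forall x : 'rV_m, x *m M = 0 -> x *m P *m J = x.

(** By [M1] the kernel of [M] has dimension at least m - n + 1, and by [PJ] the map [P] is injective
    on it. The constant row is not in the image: [J] maps it to 0, so it would come from 0. This
    makes rank m - n + 2, and a matrix has at least as many distinct columns as its rank. *)
Lemma rank_columns : (m + 2 <= n + #|[set col d (kermx M *m P) | d in 'I_k]|)%N.
Proof.
set Z := kermx M; set Q := Z *m P; set C := [set _ | _ in _].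
have rM : (\rank M + 1 <= n)%N.
  apply: leq_trans (mulmx0_rank_max M1); rewrite leq_add2l lt0n mxrank_eq0.
  apply/eqP=> /matrixP/(_ (Ordinal n_gt0) 0); rewrite !mxE => /eqP.
  by rewrite oner_eq0.
have ZPJ : Q *m J = Z.
  apply/row_matrixP=> i; rewrite (row_mul i Q) (row_mul i Z); apply: PJ.
  by rewrite -(row_mul i Z) mulmx_ker row0.
have rQ : (\rank Z <= \rank Q)%N by rewrite -{1}ZPJ; apply: mxrankM_maxl.
have not1 : ~~ ((const_mx 1 : 'rV_k) <= Q)%MS.
  apply/negP=> /submxP[D eD].
  have D0 : D *m Z = 0 by rewrite -ZPJ mulmxA -eD.
  have: const_mx 1 = 0 :> 'rV[F]_k by rewrite eD mulmxA D0 mul0mx.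
  by move=> /matrixP/(_ 0 (Ordinal k_gt0)); rewrite !mxE => /eqP; rewrite oner_eq0.
pose A := col_mx Q (const_mx 1 : 'rV_k).
have rA : (\rank Q < \rank A)%N.
  have eA : (A :=: Q + (const_mx 1 : 'rV_k))%MS by apply: eqmx_sym; apply: addsmxE.
  apply: rank_ltmx; rewrite /ltmx !eA addsmxSl.
  by apply: contra not1; apply: submx_trans; apply: addsmxSr.
have AC : (\rank A <= #|C|)%N.
  pose A' : 'M[F]_(m + 1, #|C|) := \matrix_(i, c)
     col_mx (enum_val c) (const_mx 1 : 'rV_1) i 0.
  pose O : 'M[F]_(#|C|, k) := \matrix_(c, d) (enum_val c == col d Q)%:R.
  suff -> : A = A' *m O by apply: leq_trans (mxrankM_maxl _ _) (rank_leq_col _).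
  apply/matrixP=> i d; rewrite [RHS]mxE.
  have dC : col d Q \in C by apply: imset_f.
  rewrite (bigD1 (enum_rank_in dC (col d Q))) //= big1 => [|c ne].
    rewrite !mxE enum_rankK_in // eqxx mulr1 addr0.
    by case: (split i) => j; rewrite !mxE.
  rewrite !mxE (_ : _ == _ = false) ?mulr0 //; apply/negP=> /eqP ec.
  by case/eqP: ne; apply: enum_val_inj; rewrite ec enum_rankK_in.
have := mxrank_ker M; have := rank_leq_row M; rewrite -/Z.
have := leq_trans (leq_ltn_trans rQ rA) AC.
by move: rM; lia.
Qed.
End RankBound.

(** * Darts and the cycle space *)

Section DartCount.
Local Open Scope ring_scope.
Variables (V : finType) (e : rel V).
Hypotheses (e_sym : symmetric e) (e_irr : irreflexive e).

Definition darts := [set d : V * V | e d.1 d.2].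
(** Each edge once, oriented by the enumeration of the vertices. A dart stands for one side of its
    edge; in drawings it is the left one. *)
Definition edges := [set d : V * V | e d.1 d.2 && (enum_rank d.1 < enum_rank d.2)%N].
Definition flip (d : V * V) := (d.2, d.1).

Lemma flipK : involutive flip.
Proof. by case. Qed.

Lemma dart_orient d : d \in darts -> (d \in edges) (+) (flip d \in edges).
Proof.
rewrite !inE /= [in e d.2 _]e_sym => ed; rewrite ed /=.
case: ltngtP => // /val_inj/enum_rank_inj eq12.
by rewrite eq12 e_irr in ed.
Qed.

Lemma edges_darts d : d \in edges -> d \in darts.
Proof. by rewrite !inE => /andP[]. Qed.

Lemma flip_darts d : (flip d \in darts) = (d \in darts).
Proof. by rewrite !inE e_sym. Qed.

Lemma card_darts : #|darts| = (2 * #|edges|)%N.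
Proof.
rewrite mul2n -addnn -{2}(card_imset (mem edges) (inv_inj flipK)).
rewrite -cardsUI (_ : _ :&: _ = set0) ?cards0 ?addn0; last first.
  apply/setP=> d; rewrite !inE; apply/negP=> /andP[dE /imsetP[p pE dp]].
  by have := dart_orient (edges_darts pE); rewrite -dp pE; move: dE; rewrite inE => ->.
apply: eq_card => d; rewrite in_setU; apply/idP/orP => [dD|[dE|/imsetP[p pE ->]]].
- have := dart_orient dD; have [|_ fE] := boolP (d \in edges); first by left.
  by right; apply/imsetP; exists (flip d); rewrite ?flipK.
- exact: edges_darts.
by rewrite flip_darts edges_darts.
Qed.

Implicit Types (x : V * V -> 'F_2) (P : V * V -> V * V -> 'F_2).

(* A set of edges is given by its indicator function with values in F_2. *)
Definition even_edges x :=
  forall u, \sum_(p in edges) x p * ((p.1 == u)%:R + (p.2 == u)%:R) = 0.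
Definition total P x d := \sum_(p in edges) x p * P p d.

Variables (P : V * V -> V * V -> 'F_2) (g : nat).
(** Crossing an edge changes the parity exactly if the edge is selected. *)
Hypothesis flipP : forall x p, even_edges x -> p \in edges ->
  total P x p + total P x (flip p) = x p.
(** Every face has at least [g] sides. *)
Hypothesis classP : forall d, d \in darts -> exists2 C : {set V * V},
  d \in C /\ (g <= #|C|)%N &
  C \subset darts /\
  forall x d', even_edges x -> d' \in C -> total P x d' = total P x d.

(** [M] is the incidence matrix, its kernel the cycle space, [Pm] gives the parities at the sides,
    and [J] adds those at the two sides of an edge. Sides of one face have equal columns, so there
    are at most |darts| / g distinct ones. *)
Lemma euler_count : (0 < #|darts|)%N -> (g * (#|edges| + 2) <= g * #|V| + #|darts|)%N.
Proof.
move=> D0.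
pose m := #|edges|; pose k := #|darts|; pose n := #|V|.
have n0 : (0 < n)%N.
  by move: D0 => /card_gt0P[[u v] _]; apply/card_gt0P; exists u.
pose M : 'M['F_2]_(m, n) := \matrix_(i, j)
  (((enum_val i).1 == enum_val j)%:R + ((enum_val i).2 == enum_val j)%:R).
pose Pm : 'M['F_2]_(m, k) := \matrix_(i, d) P (enum_val i) (enum_val d).
pose J : 'M['F_2]_(k, m) := \matrix_(d, i)
  ((enum_val d == enum_val i)%:R + (enum_val d == flip (enum_val i))%:R).
pose fn (x : 'rV['F_2]_m) p := \sum_(i < m) (enum_val i == p)%:R * x 0 i.
have fn_val (y : 'rV['F_2]_m) i : fn y (enum_val i) = y 0 i.
  rewrite /fn (bigD1 i) //= eqxx mul1r big1 ?addr0 // => j ji.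
  by rewrite (inj_eq enum_val_inj) (negPf ji) mul0r.
have sum_fn (y : 'rV['F_2]_m) (F : V * V -> 'F_2) :
    \sum_(p in edges) fn y p * F p = \sum_(i < m) y 0 i * F (enum_val i).
  by rewrite big_enum_val; apply: eq_bigr => i _; rewrite fn_val.
have even_fn (y : 'rV['F_2]_m) : y *m M = 0 -> even_edges (fn y).
  move=> /matrixP yM u; rewrite sum_fn.
  have := yM 0 (enum_rank u); rewrite !mxE => yMu.
  by rewrite -[RHS]yMu; apply: eq_bigr => i _; rewrite mxE enum_rankK.
have total_fn (y : 'rV['F_2]_m) d : (y *m Pm) 0 d = total P (fn y) (enum_val d).
  by rewrite /total sum_fn mxE; apply: eq_bigr => i _; rewrite mxE.
have sumJ (F : V * V -> 'F_2) i : \sum_(d < k) F (enum_val d) * J d i =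
    F (enum_val i) + F (flip (enum_val i)).
  have pE := enum_valP i; move: pE; set p := enum_val i => pE.
  have pD : p \in darts by apply: edges_darts.
  have fD : flip p \in darts by rewrite flip_darts.
  have pf : p != flip p.
    by have := dart_orient pD; rewrite pE; apply: contraTneq => {1}<-; rewrite pE.
  have delta q : q \in darts -> \sum_(d in darts) F d * (d == q)%:R = F q.
    move=> qD; rewrite (bigD1 q) //= eqxx mulr1 big1 ?addr0 // => d /andP[_ /negPf ->].
    by rewrite mulr0.
  rewrite -(delta p pD) -(delta _ fD) -big_split /= [RHS]big_enum_val /=.
  by apply: eq_bigr => d _; rewrite mxE mulrDr.
have M1 : M *m const_mx 1 = 0 :> 'cV_m.
  apply/matrixP=> i j; rewrite !mxE.
  transitivity (\sum_(u : V) (((enum_val i).1 == u)%:R + ((enum_val i).2 == u)%:R : 'F_2)).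
    by rewrite [RHS]big_enum_val /=; apply: eq_bigr => u _; rewrite !mxE mulr1.
  have one w : \sum_(u : V) (w == u)%:R = 1 :> 'F_2.
    by rewrite (bigD1 w) //= eqxx big1 ?addr0 // => u; rewrite eq_sym => /negPf ->.
  by rewrite big_split /= !one F2_add.
have J1 : (const_mx 1 : 'rV_k) *m J = 0.
  apply/matrixP=> j i; rewrite !mxE -[RHS](F2_add 1) -(sumJ (fun=> 1) i).
  by apply: eq_bigr => d _; rewrite mxE.
have PJ (y : 'rV['F_2]_m) : y *m M = 0 -> y *m Pm *m J = y.
  move=> yM; apply/rowP=> i; rewrite mxE -fn_val -(flipP (even_fn y yM) (enum_valP i)).
  by rewrite -sumJ; apply: eq_bigr => d _; rewrite total_fn.
have := rank_columns n0 D0 M1 J1 PJ; set C := [set _ | _ in _] => le_mn.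
have: (g * #|C| <= k)%N.
  rewrite -[k]card_ord; apply: card_fibers => d.
  have [Cd [dC gC] [CD eqC]] := classP (enum_valP d).
  apply: leq_trans gC _.
  rewrite -(card_imset _ (@enum_val_inj _ darts)).
  apply/subset_leq_card/subsetP=> d' d'C.
  have d'D := subsetP CD _ d'C.
  apply/imsetP; exists (enum_rank_in d'D d'); last by rewrite enum_rankK_in.
  rewrite inE; apply/eqP/colP=> i; rewrite !mxE.
  have ev : row i (kermx M) *m M = 0 by rewrite -row_mul mulmx_ker row0.
  have := eqC _ _ (even_fn _ ev) d'C.
  rewrite -{1}(enum_rankK_in d'D d'D) -!total_fn !mxE.
  by under eq_bigr do rewrite mxE; under [X in _ = X -> _]eq_bigr do rewrite mxE.
move=> gC; apply: leq_trans (leq_mul (leqnn g) le_mn) _.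
by rewrite (mulnDr g n) leq_add2l.
Qed.

End DartCount.

(** * Segments and vertical rays *)

Section Segments.
Local Open Scope ring_scope.
Variables (R : realType) (t : R).
Implicit Types (a b p q : 'rV[R]_2) (s u v : 'rV[R]_2 * 'rV[R]_2) (x y : R).

(* The shear by [t] is chosen later so that no segment of the drawing is vertical. *)
Definition Xc p : R := p 0 ord0 + t * p 0 ord_max.
Definition Yc p : R := p 0 ord_max.
Definition slope s : R := (Yc s.2 - Yc s.1) / (Xc s.2 - Xc s.1).
Definition height s x : R := Yc s.1 + slope s * (x - Xc s.1).
Definition rightward s := Xc s.1 < Xc s.2.
Definition overlap s u := Num.max (Xc s.1) (Xc u.1) < Num.min (Xc s.2) (Xc u.2).
Definition middle s u := (Num.max (Xc s.1) (Xc u.1) + Num.min (Xc s.2) (Xc u.2)) / 2.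
(** Non-crossing segments keep their order on the whole common range ([above_ge]), so one test
    abscissa suffices. *)
Definition above s u := overlap s u && (height u (middle s u) < height s (middle s u)).
Definition endpoint s p := (p == s.1) || (p == s.2).

Lemma coord_inj p q : Xc p = Xc q -> Yc p = Yc q -> p = q.
Proof.
rewrite /Xc /Yc => + eY; rewrite eY => /addIr eX; apply/rowP=> j.
have [->|->] // : j = ord0 \/ j = ord_max.
by case: j => [[|[|//]]] lt; [left|right]; apply: val_inj.
Qed.

Lemma coord_surj x y : exists2 p, Xc p = x & Yc p = y.
Proof.
exists (\row_j if j == ord0 then x - t * y else y); last by rewrite /Yc mxE.
by rewrite /Xc !mxE /= subrK.
Qed.

Lemma Xc_lin a b l : Xc ((1 - l) *: a + l *: b) = (1 - l) * Xc a + l * Xc b.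
Proof. rewrite /Xc !mxE; ring. Qed.

Lemma Yc_lin a b l : Yc ((1 - l) *: a + l *: b) = (1 - l) * Yc a + l * Yc b.
Proof. by rewrite /Yc !mxE. Qed.

Lemma height_on s x p : rightward s -> Xc s.1 <= x <= Xc s.2 ->
  Xc p = x -> Yc p = height s x -> on_segment s.1 s.2 p.
Proof.
move=> rs /andP[x1 x2] eX eY.
have d0 : 0 < Xc s.2 - Xc s.1 by rewrite subr_gt0.
have d0' := lt0r_neq0 d0.
exists ((x - Xc s.1) / (Xc s.2 - Xc s.1)).
  by rewrite divr_ge0 ?subr_ge0 ?(ltW rs) //= ler_pdivrMr // mul1r lerD2r.
apply: coord_inj; rewrite ?Xc_lin ?Yc_lin ?eX ?eY /height /slope; field; exact: d0'.
Qed.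

Lemma height1 s : height s (Xc s.1) = Yc s.1.
Proof. by rewrite /height subrr mulr0 addr0. Qed.

Lemma height2 s : rightward s -> height s (Xc s.2) = Yc s.2.
Proof.
move=> rs; have d0 : Xc s.2 - Xc s.1 != 0 by rewrite lt0r_neq0 // subr_gt0.
by rewrite /height /slope; field.
Qed.

Lemma heightE2 s x : rightward s -> height s x = Yc s.2 + slope s * (x - Xc s.2).
Proof.
by move=> rs; rewrite -(height2 rs) /height; ring.
Qed.

(** * Segments that meet only in common ends *)

Definition apart s u := forall p,
  on_segment s.1 s.2 p -> on_segment u.1 u.2 p -> endpoint s p && endpoint u p.

Lemma apart_neq s u x : rightward s -> rightward u -> apart s u ->
  Xc s.1 <= x <= Xc s.2 -> Xc u.1 <= x <= Xc u.2 -> height s x = height u x ->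
  exists p, [/\ Xc p = x, Yc p = height s x, endpoint s p & endpoint u p].
Proof.
move=> rs ru ap xs xu eh; have [p eX eY] := coord_surj x (height s x).
have sp : on_segment s.1 s.2 p by apply: height_on eX eY.
have up : on_segment u.1 u.2 p by apply: height_on eX _; rewrite ?eY.
by exists p; case/andP: (ap p sp up).
Qed.

Lemma endpoint_X s p : endpoint s p -> Xc p = Xc s.1 \/ Xc p = Xc s.2.
Proof. by case/orP=> /eqP ->; [left|right]. Qed.

Lemma apart_open s u x : rightward s -> rightward u -> apart s u ->
  Num.max (Xc s.1) (Xc u.1) < x < Num.min (Xc s.2) (Xc u.2) -> height s x != height u x.
Proof.
move=> rs ru ap; rewrite gt_max lt_min => /andP[/andP[s1 u1] /andP[s2 u2]].
apply/eqP=> eh; have [||p [eX _ /endpoint_X es _]] := apart_neq rs ru ap _ _ eh.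
- by rewrite !ltW.
- by rewrite !ltW.
by move: s1 s2; rewrite -eX; case: es => ->; rewrite ltxx.
Qed.

Lemma above_ge s u x : rightward s -> rightward u -> apart s u -> above s u ->
  Num.max (Xc s.1) (Xc u.1) <= x <= Num.min (Xc s.2) (Xc u.2) -> height u x <= height s x.
Proof.
move=> rs ru ap /andP[ov]; set m := middle s u; set l := Num.max _ _; set r := Num.min _ _.
have lr : l < r := ov.
have lm : l < m by rewrite /m /middle -/l -/r ltr_pdivlMr //; lra.
have mr : m < r by rewrite /m /middle -/l -/r ltr_pdivrMr //; lra.
move=> hm /andP[lx xr]; rewrite leNgt; apply/negP=> hx.
pose Dm := height s m - height u m; pose Dx := height u x - height s x.
have Dm0 : 0 < Dm by rewrite subr_gt0.
have Dx0 : 0 < Dx by rewrite subr_gt0.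
have S0 : 0 < Dm + Dx by rewrite addr_gt0.
(* The abscissa where the two affine functions agree, a weighted mean of [m] and [x]. *)
pose w := (Dx * m + Dm * x) / (Dm + Dx).
have eqw : height s w = height u w.
  rewrite /w /Dx /Dm /height in S0 *; have S0' := lt0r_neq0 S0; field.
  by apply: contraNneq S0' => <-; apply/eqP; ring.
have := apart_open rs ru ap (x := w); rewrite eqw eqxx => /(_ _)/negP; apply=> //.
rewrite -/l -/r /w ltr_pdivlMr // ltr_pdivrMr //; apply/andP; split; nra.
Qed.

Lemma middle_in s u : overlap s u ->
  Num.max (Xc s.1) (Xc u.1) < middle s u < Num.min (Xc s.2) (Xc u.2).
Proof.
rewrite /overlap /middle; set l := Num.max _ _; set r := Num.min _ _ => lr.
by rewrite ltr_pdivlMr // ltr_pdivrMr //; apply/andP; split; lra.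
Qed.

Lemma apart_sym s u : apart s u -> apart u s.
Proof. by move=> ap p pu ps; rewrite andbC; apply: ap. Qed.

Lemma overlap_sym s u : overlap s u = overlap u s.
Proof. by rewrite /overlap maxC minC. Qed.

Lemma middle_sym s u : middle s u = middle u s.
Proof. by rewrite /middle maxC minC. Qed.

Lemma above_total s u : rightward s -> rightward u -> apart s u -> overlap s u ->
  above u s = ~~ above s u.
Proof.
move=> rs ru ap ov; rewrite /above (overlap_sym u) ov /= (middle_sym u) -leNgt lt_neqAle.
by rewrite (apart_open rs ru ap (middle_in ov)).
Qed.

Lemma overlap_at s u x : rightward s -> rightward u ->
  (Xc s.1 <= x < Xc s.2) && (Xc u.1 <= x < Xc u.2) ||
  (Xc s.1 < x <= Xc s.2) && (Xc u.1 < x <= Xc u.2) -> overlap s u.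
Proof.
rewrite /rightward /overlap gt_max !lt_min => rs ru.
by case/orP=> /andP[/andP[a b] /andP[c d]]; lra.
Qed.

Lemma above_at s u x : rightward s -> rightward u -> apart s u -> above s u ->
  Xc s.1 <= x <= Xc s.2 -> Xc u.1 <= x <= Xc u.2 -> height u x <= height s x.
Proof.
move=> rs ru ap ab /andP[s1 s2] /andP[u1 u2]; apply: above_ge ab _ => //.
by rewrite ge_max le_min s1 s2 u1 u2.
Qed.

(** * Vertical rays near a segment *)

Definition over u p := (Xc u.1 < Xc p < Xc u.2) && (height u (Xc p) < Yc p).

Lemma over_endpoint s u p : rightward s -> rightward u -> apart s u ->
  endpoint s p -> over u p = above s u && (Xc u.1 < Xc p < Xc u.2).
Proof.
move=> rs ru ap ep; rewrite /over andbC; have [inu|] := boolP (_ < _ < _); last by rewrite !andbF.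
rewrite !andbT; have /andP[u1 u2] := inu.
have eh : height s (Xc p) = Yc p.
  by case/orP: ep => /eqP ->; rewrite ?height1 ?height2.
have ps : Xc s.1 <= Xc p <= Xc s.2.
  by move: rs; rewrite /rightward; case/orP: ep => /eqP -> lt; rewrite lexx ltW.
have pu : Xc u.1 <= Xc p <= Xc u.2 by rewrite !ltW.
have ov : overlap s u.
  apply: (overlap_at (x := Xc p)) => //; apply/orP.
  move: rs; rewrite /rightward; case/orP: ep => /eqP <- lt; [left|right].
    by rewrite lexx lt u2 ltW.
  by rewrite lexx lt u1 ltW.
have ne : height u (Xc p) != height s (Xc p).
  apply/eqP=> eu; have [q [eX _ _ /endpoint_X]] := apart_neq rs ru ap ps pu (esym eu).
  by rewrite eX => -[eq|eq]; move: u1 u2; rewrite eq ltxx.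
rewrite -eh lt_neqAle ne /=.
have [ab|nab] := boolP (above s u); first by rewrite (above_at rs ru ap ab).
apply/negP=> le; move/eqP: ne; apply; apply/eqP; rewrite eq_le le.
have ab : above u s by rewrite (above_total rs ru ap ov).
by rewrite (above_at ru rs (apart_sym ap) ab).
Qed.

(* [up u true s] tells whether [s] is met by the vertical ray issued upwards from a
   point just to the right of the left end of [u]; [up u false s] is about the right end. *)
Definition up u (right : bool) s :=
  above s u && (if right then Xc s.1 <= Xc u.1 else Xc u.2 <= Xc s.2).

(** While a point slides along [u], its ray gains or loses [s] only when an end of [s] passes
    overhead. *)
Lemma up_transport s u : rightward s -> rightward u -> s = u \/ apart s u ->
  up u true s (+) up u false s = over u s.1 (+) over u s.2.
Proof.
move=> rs ru [->|ap].
  by rewrite /up /above ltxx !andbF /over !ltxx !andbF.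
have e1 : endpoint s s.1 by rewrite /endpoint eqxx.
have e2 : endpoint s s.2 by rewrite /endpoint eqxx orbT.
rewrite !(over_endpoint rs ru ap) // /up.
have [ab|] := boolP (above s u) => //=; have /andP[] := ab.
rewrite /overlap gt_max !lt_min => /andP[/andP[_ a] /andP[b _]] _.
by rewrite a b andbT /= leNgt [Xc u.2 <= _]leNgt; do 2!case: (_ < _).
Qed.

Definition over_right p s := (Xc s.1 <= Xc p < Xc s.2) && (Yc p < height s (Xc p)).
Definition over_left p s := (Xc s.1 < Xc p <= Xc s.2) && (Yc p < height s (Xc p)).
Definition vertically_over p q := (Xc q == Xc p) && (Yc p < Yc q).

Lemma over_sides p s : rightward s ->
  over_right p s (+) over_left p s = vertically_over p s.1 (+) vertically_over p s.2.
Proof.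
rewrite /over_right /over_left /vertically_over /rightward => rs.
have [e1|n1] := eqVneq (Xc s.1) (Xc p).
  rewrite -e1 height1 lexx rs ltxx /= addbF.
  by rewrite (gt_eqF rs) addbF.
have [e2|n2] := eqVneq (Xc s.2) (Xc p).
  by rewrite -e2 height2 // ltxx lexx !andbF rs.
by rewrite !le_eqVlt (negPf n1) (eq_sym (Xc p)) (negPf n2) addbb.
Qed.

Lemma height_slope1 s u x : s.1 = u.1 ->
  height s x - height u x = (slope s - slope u) * (x - Xc s.1).
Proof. by move=> e1; rewrite /height e1; ring. Qed.

Lemma height_slope2 s u x : rightward s -> rightward u -> s.2 = u.2 ->
  height s x - height u x = (slope s - slope u) * (x - Xc s.2).
Proof. by move=> rs ru e2; rewrite !heightE2 // e2; ring. Qed.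

Lemma above_slope1 s u : rightward s -> rightward u -> s.1 = u.1 ->
  above s u = (slope u < slope s).
Proof.
move=> rs ru e1.
have ov : overlap s u.
  apply: (overlap_at (x := Xc s.1)) => //.
  by move: rs ru; rewrite /rightward e1 => -> ->; rewrite lexx.
rewrite /above ov -subr_gt0 (height_slope1 _ e1) pmulr_lgt0 ?subr_gt0 //.
by have /andP[] := middle_in ov; rewrite gt_max => /andP[].
Qed.

Lemma above_slope2 s u : rightward s -> rightward u -> s.2 = u.2 ->
  above s u = (slope s < slope u).
Proof.
move=> rs ru e2.
have ov : overlap s u.
  apply: (overlap_at (x := Xc s.2)) => //; apply/orP; right.
  by move: rs ru; rewrite /rightward e2 => -> ->; rewrite lexx.
rewrite /above ov -subr_gt0 (height_slope2 _ rs ru e2) -[_ < slope u]subr_gt0 -mulrNN.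
rewrite opprB pmulr_lgt0 // oppr_gt0 subr_lt0.
by have /andP[_] := middle_in ov; rewrite lt_min => /andP[].
Qed.

Lemma slope_neq1 s u : rightward s -> rightward u -> apart s u -> s.1 = u.1 ->
  slope s != slope u.
Proof.
move=> rs ru ap e1; apply/eqP=> es.
have ov : overlap s u.
  apply: (overlap_at (x := Xc s.1)) => //.
  by move: rs ru; rewrite /rightward e1 => -> ->; rewrite lexx.
have := above_total rs ru ap ov.
by rewrite !above_slope1 // es ltxx.
Qed.

Lemma slope_neq2 s u : rightward s -> rightward u -> apart s u -> s.2 = u.2 ->
  slope s != slope u.
Proof.
move=> rs ru ap e2; apply/eqP=> es.
have ov : overlap s u.
  apply: (overlap_at (x := Xc s.2)) => //; apply/orP; right.
  by move: rs ru; rewrite /rightward e2 => -> ->; rewrite lexx.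
have := above_total rs ru ap ov.
by rewrite !above_slope2 // es ltxx.
Qed.

(** Close to [u.1], a ray from [u] meets what passes over [u.1] towards the right and, in addition,
    the segments that leave [u.1] more steeply than [u]. At right ends the order of slopes is
    reversed. *)
Lemma up_right s u : rightward s -> rightward u -> s = u \/ apart s u ->
  up u true s = over_right u.1 s (+) ((s.1 == u.1) && (slope u < slope s)).
Proof.
move=> rs ru [->|ap].
  by rewrite /up /above /over_right height1 !ltxx !andbF.
have [e1|n1] := eqVneq s.1 u.1.
  rewrite /over_right -e1 height1 ltxx andbF /up e1 lexx andbT.
  by rewrite above_slope1.
rewrite addbF /up /over_right.
have [/andP[s1 s2]|out] := boolP (Xc s.1 <= Xc u.1 < Xc s.2); last first.
  apply/negP=> /andP[/andP[ov _] s1]; case/negP: out; rewrite s1 /=.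
  by move: ov; rewrite /overlap gt_max !lt_min => /andP[_ /andP[]].
have u12 : Xc u.1 <= Xc u.1 <= Xc u.2 by rewrite lexx ltW.
have s12 : Xc s.1 <= Xc u.1 <= Xc s.2 by rewrite s1 ltW.
have ov : overlap s u.
  by apply: (overlap_at (x := Xc u.1)) => //; move: ru; rewrite /rightward s1 s2 lexx => ->.
rewrite s1 andbT -height1 lt_neqAle.
have ne : height s (Xc u.1) != height u (Xc u.1).
  apply/eqP=> eh; have [p [eX eY es _]] := apart_neq rs ru ap s12 u12 eh.
  have pu : p = u.1 by apply: coord_inj; rewrite // eY eh height1.
  case/orP: es; first by rewrite pu eq_sym (negPf n1).
  by rewrite pu => /eqP eu; move: s2; rewrite eu ltxx.
rewrite eq_sym ne /=; have [ab|nab] := boolP (above s u).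
  by rewrite (above_at rs ru ap ab).
apply/esym/negP=> le; move/eqP: ne; apply; apply/eqP; rewrite eq_le le andbT.
have ab : above u s by rewrite (above_total rs ru ap ov).
by rewrite (above_at ru rs (apart_sym ap) ab).
Qed.

Lemma up_left s u : rightward s -> rightward u -> s = u \/ apart s u ->
  up u false s = over_left u.2 s (+) ((s.2 == u.2) && (slope s < slope u)).
Proof.
move=> rs ru [->|ap].
  by rewrite /up /above /over_left height2 // !ltxx !andbF.
have [e2|n2] := eqVneq s.2 u.2.
  rewrite /over_left -e2 height2 // ltxx andbF /up e2 lexx andbT.
  by rewrite above_slope2.
rewrite addbF /up /over_left.
have [/andP[s1 s2]|out] := boolP (Xc s.1 < Xc u.2 <= Xc s.2); last first.
  apply/negP=> /andP[/andP[ov _] s2]; case/negP: out; rewrite s2 andbT.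
  by move: ov; rewrite /overlap gt_max !lt_min => /andP[/andP[_ ->]].
have u12 : Xc u.1 <= Xc u.2 <= Xc u.2 by rewrite lexx ltW.
have s12 : Xc s.1 <= Xc u.2 <= Xc s.2 by rewrite s2 ltW.
have ov : overlap s u.
  apply: (overlap_at (x := Xc u.2)) => //; apply/orP; right.
  by move: ru; rewrite /rightward s1 s2 lexx => ->.
rewrite s2 andbT -(height2 ru) lt_neqAle.
have ne : height s (Xc u.2) != height u (Xc u.2).
  apply/eqP=> eh; have [p [eX eY es _]] := apart_neq rs ru ap s12 u12 eh.
  have pu : p = u.2 by apply: coord_inj; rewrite // eY eh height2.
  case/orP: es; last by rewrite pu eq_sym (negPf n2).
  by rewrite pu => /eqP eu; move: s1; rewrite eu ltxx.
rewrite eq_sym ne /=; have [ab|nab] := boolP (above s u).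
  by rewrite (above_at rs ru ap ab).
apply/esym/negP=> le; move/eqP: ne; apply; apply/eqP; rewrite eq_le le andbT.
have ab : above u s by rewrite (above_total rs ru ap ov).
by rewrite (above_at ru rs (apart_sym ap) ab).
Qed.

End Segments.

(** * Parities along the faces of a drawing *)

Section PlaneDrawing.
Local Open Scope ring_scope.
Variables (R : realType) (G : sgraph).
Variables (pt : G -> 'rV[R]_2) (bends : G -> G -> seq 'rV[R]_2).
Hypothesis plane : plane_drawing pt bends.
Implicit Types (d p : G * G) (i j n : nat) (q : 'rV[R]_2).

Let E := edges (@adj G).
Let A := darts (@adj G).

(** * Corners and segments of a drawing *)

Definition len d := (size (bends d.1 d.2)).+1.
Definition corner d i : 'rV[R]_2 := (route pt bends d.1 d.2)`_i.

Lemma size_route d : size (route pt bends d.1 d.2) = (len d).+1.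
Proof. by rewrite /= size_rcons. Qed.

Lemma corner0 d : corner d 0 = pt d.1.
Proof. by []. Qed.

Lemma corner_len d : corner d (len d) = pt d.2.
Proof. by rewrite /corner /= nth_rcons ltnn eqxx. Qed.

Lemma route_flip d : d \in A -> route pt bends d.2 d.1 = rev (route pt bends d.1 d.2).
Proof.
rewrite inE => ad; case: plane => _ rv _ _ _.
by rewrite /route rv // rev_cons rev_rcons.
Qed.

Lemma len_flip d : d \in A -> len (flip d) = len d.
Proof.
move=> dA; apply: succn_inj; rewrite -!size_route /= -[LHS]/(size (route pt bends d.2 d.1)).
by rewrite route_flip // size_rev.
Qed.

Lemma corner_flip d i : d \in A -> (i <= len d)%N -> corner (flip d) i = corner d (len d - i).
Proof.
move=> dA le; by rewrite /corner /= route_flip // nth_rev ?size_route ?ltnS //.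
Qed.

Lemma corner_inj d i j : d \in A -> (i <= len d)%N -> (j <= len d)%N ->
  corner d i = corner d j -> i = j.
Proof.
rewrite inE => ad li lj; case: plane => _ _ sim _ _; have [un _] := sim _ _ ad.
by move/eqP; rewrite /corner (nth_uniq 0) ?size_route ?ltnS // => /eqP.
Qed.

Lemma on_route d i q : (i < len d)%N -> on_segment (corner d i) (corner d i.+1) q ->
  on_polyline (route pt bends d.1 d.2) q.
Proof. by move=> li on; exists i; rewrite ?size_route. Qed.

Lemma on_start (a b : 'rV[R]_2) : on_segment a b a.
Proof. by exists 0; rewrite ?lexx ?ler01 // subr0 scale1r scale0r addr0. Qed.

Lemma on_end (a b : 'rV[R]_2) : on_segment a b b.
Proof. by exists 1; rewrite ?lexx ?ler01 // subrr scale1r scale0r add0r. Qed.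

Lemma on_sym (a b : 'rV[R]_2) q : on_segment a b q -> on_segment b a q.
Proof.
case=> l /andP[l0 l1] ->; exists (1 - l); last by rewrite subKr addrC.
by rewrite subr_ge0 l1 gerBl l0.
Qed.

Lemma route_end d i q : d \in A -> (i < len d)%N ->
  on_segment (corner d i) (corner d i.+1) q -> (q == pt d.1) || (q == pt d.2) ->
  (q == corner d i) || (q == corner d i.+1).
Proof.
rewrite inE => ad li on; case: plane => _ _ sim _ _; have [_ cross] := sim _ _ ad.
case/orP=> /eqP eq.
  have [->|i0] := posnP i; first by rewrite corner0 eq eqxx.
  have on0 : on_segment (corner d 0) (corner d 1) q by rewrite eq; apply: on_start.
  have [|-> ->] := cross 0%N i q i0 _ on0 on; first by rewrite size_route.
  by rewrite eqxx.
have [/eqP il|il] := eqVneq i.+1 (len d).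
  by rewrite (eqP il) corner_len eq eqxx orbT.
have {}il : (i < (len d).-1)%N by rewrite /= ltn_neqAle -ltnS li andbT -eqSS.
have onl : on_segment (corner d (len d).-1) (corner d (len d).-1.+1) q.
  by rewrite eq -corner_len; apply: on_end.
have [|e1 ->] := cross i (len d).-1 q il _ on onl; first by rewrite size_route.
by rewrite e1 eqxx orbT.
Qed.

(** [E] has only one orientation of each edge, so distinct members have distinct sets of ends, as
    the drawing condition requires. *)
Lemma cross_edges p p' q : p \in E -> p' \in E -> p != p' ->
  on_polyline (route pt bends p.1 p.2) q -> on_polyline (route pt bends p'.1 p'.2) q ->
  exists2 w, (w == p.1) || (w == p.2) & q = pt w.
Proof.
move=> pE pE' pp on on'; have [pA pA'] := (edges_darts pE, edges_darts pE').
have nset : [set p.1; p.2] != [set p'.1; p'.2].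
  apply: contraNneq pp => es.
  have /set2P[e1|e1] : p.1 \in [set p'.1; p'.2] by rewrite -es !inE eqxx.
    have /set2P[e2|e2] : p.2 \in [set p'.1; p'.2] by rewrite -es !inE eqxx orbT.
      by move: pA; rewrite inE e1 e2 adj_irr.
    by rewrite [p]surjective_pairing e1 e2 -surjective_pairing.
  have /set2P[e2|e2] : p.2 \in [set p'.1; p'.2] by rewrite -es !inE eqxx orbT.
    have fp : p = flip p' by rewrite [p]surjective_pairing e1 e2.
    have := dart_orient (@adj_sym G) (@adj_irr G) pA'.
    by rewrite -fp -/E pE pE'.
  by move: pA; rewrite inE e1 e2 adj_irr.
case: plane => _ _ _ _ /(_ p.1 p.2 p'.1 p'.2 q).
rewrite !inE in pA pA'; case/(_ pA pA' nset on on') => w.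
by rewrite !inE => /andP[ww _] qw; exists w.
Qed.

Lemma routes_apart p p' i j q : p \in E -> p' \in E -> (i < len p)%N -> (j < len p')%N ->
  (p, i) != (p', j) ->
  on_segment (corner p i) (corner p i.+1) q -> on_segment (corner p' j) (corner p' j.+1) q ->
  (q == corner p i) || (q == corner p i.+1).
Proof.
move=> pE pE' li lj ne on on'; have pA := edges_darts pE.
have [pp|pp] := eqVneq p p'.
  rewrite -pp in pE' lj ne on' *; case: plane => _ _ sim _ _.
  have ad : adj p.1 p.2 by move: pA; rewrite inE.
  have [_ cross] := sim _ _ ad.
  have : i != j by move: ne; rewrite xpair_eqE eqxx.
  rewrite neq_ltn => /orP[ij|ji].
    by have [|-> ->] := cross i j q ij _ on on'; rewrite ?size_route ?eqxx ?orbT.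
  by have [|_ ->] := cross j i q ji _ on' on; rewrite ?size_route ?eqxx.
have [w ww qw] := cross_edges pE pE' pp (on_route li on) (on_route lj on').
apply: route_end on _ => //.
by case/orP: ww => /eqP <-; rewrite qw eqxx ?orbT.
Qed.

Variable t : R.
Hypothesis generic : forall d i, d \in A -> (i < len d)%N ->
  Xc t (corner d i) != Xc t (corner d i.+1).

Local Notation X := (Xc t).

Definition lseg (a b : 'rV[R]_2) := if X a < X b then (a, b) else (b, a).
Definition sg d i := lseg (corner d i) (corner d i.+1).
Definition goes_right d i := X (corner d i) < X (corner d i.+1).

Lemma sgE d i : sg d i = if goes_right d i then (corner d i, corner d i.+1)
                         else (corner d i.+1, corner d i).
Proof. by []. Qed.

Lemma sg_right d i : d \in A -> (i < len d)%N -> rightward t (sg d i).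
Proof.
move=> dA li; rewrite sgE /goes_right /rightward; case: ifP => //= lt.
by rewrite lt_neqAle eq_sym generic // leNgt lt.
Qed.

Lemma endpoint_sg d i q : endpoint (sg d i) q = (q == corner d i) || (q == corner d i.+1).
Proof. by rewrite sgE /endpoint; case: ifP => _ //=; rewrite orbC. Qed.

Lemma on_sg d i q : on_segment (sg d i).1 (sg d i).2 q ->
  on_segment (corner d i) (corner d i.+1) q.
Proof. by rewrite sgE; case: ifP => _ //=; apply: on_sym. Qed.

Lemma sg_apart p p' i j : p \in E -> p' \in E -> (i < len p)%N -> (j < len p')%N ->
  (p, i) != (p', j) -> apart (sg p i) (sg p' j).
Proof.
move=> pE pE' li lj ne q /on_sg on /on_sg on'; rewrite !endpoint_sg.
by rewrite (routes_apart pE pE' li lj ne on on') (routes_apart pE' pE lj li _ on' on) // eq_sym.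
Qed.

Lemma sg_inj p p' i j : p \in E -> p' \in E -> (i < len p)%N -> (j < len p')%N ->
  sg p i = sg p' j -> (p, i) = (p', j).
Proof.
move=> pE pE' li lj es; apply/eqP/negPn/negP=> ne.
have ap := sg_apart pE pE' li lj ne; have rp := sg_right (edges_darts pE) li.
rewrite -es in ap.
by have := slope_neq1 rp rp ap erefl; rewrite eqxx.
Qed.

Definition drawn (s : 'rV[R]_2 * 'rV[R]_2) := exists p i, [/\ p \in E, (i < len p)%N & s = sg p i].

Lemma drawn_right s : drawn s -> rightward t s.
Proof. by case=> p [i [pE li ->]]; apply: sg_right => //; apply: edges_darts. Qed.

Lemma drawn_apart s u : drawn s -> drawn u -> s = u \/ apart s u.
Proof.
case=> p [i [pE li ->]] [p' [j [pE' lj ->]]].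
by have [[-> ->]|ne] := eqVneq (p, i) (p', j); [left | right; apply: sg_apart].
Qed.

Lemma sg_flip d i : d \in A -> (i < len d)%N -> sg (flip d) i = sg d (len d - i.+1).
Proof.
move=> dA li; rewrite /sg !corner_flip // ?(ltnW li) //.
have -> : (len d - i = (len d - i.+1).+1)%N by rewrite subnSK.
rewrite /lseg; case: ltgtP => // e.
have li' : (len d - i.+1 < len d)%N by rewrite ltn_subrL (leq_ltn_trans _ li).
by have := generic dA li'; rewrite e eqxx.
Qed.

Lemma drawn_sg d i : d \in A -> (i < len d)%N -> drawn (sg d i).
Proof.
move=> dA li; have [dE|dE] := boolP (d \in E); first by exists d, i.
have fE : flip d \in E.
  by have := dart_orient (@adj_sym G) (@adj_irr G) dA; rewrite -/E (negPf dE).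
have fA := edges_darts fE.
exists (flip d), (len d - i.+1)%N; split=> //.
  by rewrite len_flip // ltn_subrL (leq_ltn_trans _ li).
rewrite sg_flip // ?ltn_subrL ?(leq_ltn_trans _ li) //.
by rewrite subnSK // subKn // ltnW.
Qed.

(** * Weights modulo 2 of the selected segments *)

Implicit Types (x : G * G -> 'F_2) (s u : 'rV[R]_2 * 'rV[R]_2).
Implicit Types (F : 'rV[R]_2 * 'rV[R]_2 -> bool).

Definition weight x F : 'F_2 := \sum_(p in E) x p * \sum_(i < len p) (F (sg p i))%:R.

Lemma F2_addb (b c : bool) : (b (+) c)%:R = b%:R + c%:R :> 'F_2.
Proof. by case: b; case: c; apply: val_inj. Qed.

Lemma weight_addb x F F' :
  weight x (fun s => F s (+) F' s) = weight x F + weight x F'.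
Proof.
rewrite /weight -big_split; apply: eq_bigr => p _ /=; rewrite -mulrDr -big_split.
by congr (_ * _); apply: eq_bigr => i _; rewrite F2_addb.
Qed.

Lemma eq_weight x F F' : (forall s, drawn s -> F s = F' s) -> weight x F = weight x F'.
Proof.
move=> eF; apply: eq_bigr => p pE; congr (_ * _); apply: eq_bigr => i _.
by rewrite eF //; apply: drawn_sg (edges_darts pE) (ltn_ord i).
Qed.

Lemma weight_sum x F F' F'' : (forall s, drawn s -> F s = F' s (+) F'' s) ->
  weight x F = weight x F' + weight x F''.
Proof. by move=> eF; rewrite -weight_addb; apply: eq_weight. Qed.

Lemma weight0 x F : (forall s, drawn s -> F s = false) -> weight x F = 0.
Proof.
move=> F0; apply: big1 => p pE; rewrite big1 ?mulr0 // => i _.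
by rewrite F0 //; apply: drawn_sg (edges_darts pE) (ltn_ord i).
Qed.

Lemma telescope2 (f : nat -> 'F_2) n : \sum_(i < n) (f i + f i.+1) = f 0%N + f n.
Proof.
elim: n => [|n IH]; first by rewrite big_ord0 F2_add.
by rewrite big_ord_recr /= IH addrA -[_ + f n + f n]addrA F2_add addr0.
Qed.

(** Inner corners of an edge cancel in pairs, and each vertex is an end of an even number of
    selected edges. *)
Lemma weight_ends x (Q : 'rV[R]_2 -> bool) : even_edges (@adj G) x ->
  weight x (fun s => Q s.1 (+) Q s.2) = 0.
Proof.
move=> ev; transitivity (\sum_(p in E) x p * ((Q (pt p.1))%:R + (Q (pt p.2))%:R)).
  apply: eq_bigr => p _; congr (_ * _); rewrite -corner0 -corner_len.
  rewrite -(telescope2 (fun i => (Q (corner p i))%:R)); apply: eq_bigr => i _.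
  by rewrite sgE F2_addb; case: ifP => _ //=; rewrite addrC.
transitivity (\sum_(w : G) (Q (pt w))%:R *
    \sum_(p in E) x p * ((p.1 == w)%:R + (p.2 == w)%:R)); last first.
  by apply: big1 => w _; rewrite ev mulr0.
under [RHS]eq_bigr do rewrite big_distrr /=.
rewrite exchange_big /=; apply: eq_bigr => p _.
under eq_bigr do rewrite mulrCA mulrDr.
rewrite -big_distrr big_split /=.
have one v : \sum_(w : G) (Q (pt w))%:R * (v == w)%:R = (Q (pt v))%:R :> 'F_2.
  rewrite (bigD1 v) //= eqxx mulr1 big1 ?addr0 // => w; rewrite eq_sym => /negPf ->.
  by rewrite mulr0.
by rewrite !one.
Qed.

Lemma weight_single x p i : p \in E -> (i < len p)%N -> weight x (fun s => s == sg p i) = x p.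
Proof.
move=> pE li; rewrite /weight (bigD1 p) //= [X in _ + X]big1 ?addr0 => [|p' /andP[pE' np]].
  rewrite (bigD1 (Ordinal li)) //= eqxx big1 ?addr0 ?mulr1 // => j nj.
  case: eqP => // /(sg_inj pE pE (ltn_ord j) li)[ej].
  by case/eqP: nj; apply: val_inj.
rewrite big1 ?mulr0 // => j _; case: eqP => // /(sg_inj pE' pE (ltn_ord j) li)[ep].
by rewrite ep eqxx in np.
Qed.

(** * Parity along a segment and around a corner *)

Lemma up_weight x u : even_edges (@adj G) x -> drawn u ->
  weight x (up t u true) = weight x (up t u false).
Proof.
move=> ev du; apply: F2_eq; rewrite -weight_addb -(weight_ends (over t u) ev).
apply: eq_weight => s ds.
by apply: up_transport (drawn_apart ds du); apply: drawn_right.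
Qed.

Lemma over_weight x q : even_edges (@adj G) x ->
  weight x (over_left t q) = weight x (over_right t q).
Proof.
move=> ev; apply: F2_eq; rewrite -weight_addb -(weight_ends (vertically_over t q) ev).
by apply: eq_weight => s ds; rewrite addbC over_sides //; apply: drawn_right.
Qed.

(* A segment leaving [q] is given by a normalised segment [u] and the end at which
   it is attached. The directions are sorted counterclockwise from the downward
   vertical one. *)
Definition start u (right : bool) := if right then u.1 else u.2.
Definition dir u (right : bool) : bool *l R := (~~ right, slope t u).
Arguments dir : simpl never.

Definition dirs_below (q : 'rV[R]_2) (k : bool *l R) s :=
  ((s.1 == q) && (dir s true < k)%O) (+) ((s.2 == q) && (dir s false < k)%O).
Definition dirs_upto (q : 'rV[R]_2) (k : bool *l R) s :=
  ((s.1 == q) && (dir s true <= k)%O) (+) ((s.2 == q) && (dir s false <= k)%O).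
Definition base_weight x q := weight x (over_right t q) + weight x (fun s => s.1 == q).

Lemma dir_lt s u b c :
  (dir s b < dir u c)%O = (b && ~~ c) || ((b == c) && (slope t s < slope t u)).
Proof. by rewrite ltEprodlexi /=; case: b; case: c. Qed.

Lemma dir_le s u b c :
  (dir s b <= dir u c)%O = (b && ~~ c) || ((b == c) && (slope t s <= slope t u)).
Proof. by rewrite leEprodlexi /=; case: b; case: c. Qed.

(** [up] never counts [u] itself, so it describes a point just above [u]. Seen from [start u r] this
    is the left side if the segment goes right, and the right side if it goes left. The point just
    below also sees [u]. *)
Definition left_side u r s := up t u r s (+) (~~ r && (s == u)).
Definition right_side u r s := up t u r s (+) (r && (s == u)).

Lemma weight_left x u r :
  weight x (left_side u r) = weight x (up t u r) + weight x (fun s => ~~ r && (s == u)).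
Proof. exact: weight_addb. Qed.

Lemma weight_right x u r :
  weight x (right_side u r) = weight x (up t u r) + weight x (fun s => r && (s == u)).
Proof. exact: weight_addb. Qed.

(* Up to a term depending on [q] only, the parity on the left of a segment leaving [q]
   is the number of selected directions up to its own; hence it agrees with the
   parity on the right of the next segment. *)
Lemma left_dirs x u r : even_edges (@adj G) x -> drawn u ->
  weight x (left_side u r) =
    base_weight x (start u r) + weight x (dirs_upto (start u r) (dir u r)).
Proof.
move=> ev du; have ru := drawn_right du; rewrite weight_left /base_weight -addrA.
case: r => /=.
  rewrite (@weight0 x (fun s => false)) // addr0.
  rewrite (@weight_sum x _ (over_right t u.1)
      (fun s => (s.1 == u.1) && (slope t u < slope t s))); last first.
    by move=> s ds; apply: up_right (drawn_right ds) ru (drawn_apart ds du).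
  congr (_ + _); apply: weight_sum => s ds.
  rewrite /dirs_upto !dir_le /= andbF addbF ltNge.
  by case: (s.1 == u.1) => //=; rewrite addTb.
rewrite (@weight_sum x _ (over_left t u.2)
      (fun s => (s.2 == u.2) && (slope t s < slope t u))); last first.
  by move=> s ds; apply: up_left (drawn_right ds) ru (drawn_apart ds du).
rewrite over_weight // -addrA; congr (_ + _).
rewrite (@weight_sum x (dirs_upto u.2 (dir u false)) (fun s => s.1 == u.2)
      (fun s => (s.2 == u.2) && (slope t s <= slope t u))); last first.
  by move=> s ds; rewrite /dirs_upto !dir_le /= andbT.
rewrite addrA F2_add add0r; apply/esym/weight_sum => s ds.
have [->|ne] := eqVneq s u; first by rewrite eqxx lexx ltxx.
rewrite addbF; have [e2|//] := eqVneq s.2 u.2; rewrite /= le_eqVlt.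
case: (drawn_apart ds du) => [es|ap]; first by rewrite es eqxx in ne.
by rewrite (negPf (slope_neq2 (drawn_right ds) ru ap e2)).
Qed.

Lemma right_dirs x u r : even_edges (@adj G) x -> drawn u ->
  weight x (right_side u r) =
    base_weight x (start u r) + weight x (dirs_below (start u r) (dir u r)).
Proof.
move=> ev du; have ru := drawn_right du; rewrite weight_right /base_weight -addrA.
case: r => /=.
  rewrite (@weight_sum x _ (over_right t u.1)
      (fun s => (s.1 == u.1) && (slope t u < slope t s))); last first.
    by move=> s ds; apply: up_right (drawn_right ds) ru (drawn_apart ds du).
  rewrite -addrA; congr (_ + _); rewrite -!weight_addb; apply: eq_weight => s ds.
  rewrite /dirs_below !dir_lt /= andbF addbF.
  have [->|ne] := eqVneq s u; first by rewrite eqxx ltxx.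
  rewrite addbF; have [e1|//] := eqVneq s.1 u.1; rewrite /= -leNgt le_eqVlt.
  case: (drawn_apart ds du) => [es|ap]; first by rewrite es eqxx in ne.
  by rewrite eq_sym (negPf (slope_neq1 (drawn_right ds) ru ap e1)).
rewrite (@weight0 x (fun s => false)) // addr0.
rewrite (@weight_sum x _ (over_left t u.2)
      (fun s => (s.2 == u.2) && (slope t s < slope t u))); last first.
  by move=> s ds; apply: up_left (drawn_right ds) ru (drawn_apart ds du).
rewrite over_weight //; congr (_ + _).
rewrite (@weight_sum x (dirs_below u.2 (dir u false)) (fun s => s.1 == u.2)
      (fun s => (s.2 == u.2) && (slope t s < slope t u))); last first.
  by move=> s ds; rewrite /dirs_below !dir_lt /= andbT.
by rewrite addrA F2_add add0r.
Qed.

(** [v] follows [u] clockwise around [q]. In the first case no direction lies between them, so those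
    below [u] are those up to [v]. In the second case [u] is lowest and [v] highest: one side counts
    nothing, the other all selected ends at [q], an even number. *)
Lemma turn x u r v r' : even_edges (@adj G) x -> drawn u -> drawn v ->
    start u r = start v r' ->
    ((dir v r' < dir u r)%O /\ forall s b, drawn s -> start s b = start v r' ->
       (dir s b < dir u r)%O -> (dir s b <= dir v r')%O) \/
    (forall s b, drawn s -> start s b = start v r' ->
       (dir u r <= dir s b)%O /\ (dir s b <= dir v r')%O) ->
  weight x (right_side u r) = weight x (left_side v r').
Proof.
move=> ev du dv es cond; rewrite right_dirs // left_dirs // es; congr (_ + _).
set q := start v r' in cond *.
case: cond => [[lt between]|all].
  apply: eq_weight => s ds; rewrite /dirs_below /dirs_upto.
  have same b : start s b = q -> (dir s b < dir u r)%O = (dir s b <= dir v r')%O.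
    move=> sq; apply/idP/idP => [|le]; first exact: between.
    exact: le_lt_trans le lt.
  congr (_ (+) _); case: eqP => //= sq; first exact: (same true).
  exact: (same false).
rewrite weight0; last first.
  move=> s ds; rewrite /dirs_below.
  have [e1|_] := eqVneq s.1 q; have [e2|_] := eqVneq s.2 q; rewrite /= ?addbF ?addFb.
  - by rewrite !ltNge (all s true ds e1).1 (all s false ds e2).1.
  - by rewrite ltNge (all s true ds e1).1.
  - by rewrite ltNge (all s false ds e2).1.
  - by [].
rewrite -(weight_ends (fun a => a == q) ev); apply: eq_weight => s ds.
rewrite /dirs_upto; congr (_ (+) _); case: eqP => //= sq.
  by rewrite (all s true ds sq).2.
by rewrite (all s false ds sq).2.
Qed.

Lemma start_sg d i b :
  start (sg d i) b = if b == goes_right d i then corner d i else corner d i.+1.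
Proof. by rewrite sgE /start; case: b; case: (goes_right d i). Qed.

Lemma start_inj s b c : rightward t s -> start s b = start s c -> b = c.
Proof.
rewrite /rightward /start => rs; case: b; case: c => // es; move: rs.
  by rewrite es ltxx.
by rewrite es ltxx.
Qed.

Lemma dir_inj s u b c : drawn s -> drawn u -> start s b = start u c -> dir s b = dir u c -> s = u.
Proof.
move=> ds du es [bc sl]; case: (drawn_apart ds du) => // ap.
have {}bc : b = c by case: b c bc {es} => [] [].
move: es; rewrite bc /start; case: (c) => es.
  by have := slope_neq1 (drawn_right ds) (drawn_right du) ap es; rewrite sl eqxx.
by have := slope_neq2 (drawn_right ds) (drawn_right du) ap es; rewrite sl eqxx.
Qed.

(** * Walking along faces *)

Lemma drawn_bend p i s b : p \in E -> (i.+1 < len p)%N -> drawn s -> start s b = corner p i.+1 ->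
  s = sg p i /\ b = ~~ goes_right p i \/ s = sg p i.+1 /\ b = goes_right p i.+1.
Proof.
move=> pE li [p' [j [pE' lj ->]]]; have pA := edges_darts pE.
have [pp|pp] := eqVneq p p'; last first.
  rewrite start_sg => e.
  have on : on_polyline (route pt bends p.1 p.2) (corner p i.+1).
    by apply: (on_route li); apply: on_start.
  have on' : on_polyline (route pt bends p'.1 p'.2) (corner p i.+1).
    by apply: (on_route lj); rewrite -e; case: ifP => _; [apply: on_start|apply: on_end].
  have [w /orP[] /eqP -> e'] := cross_edges pE pE' pp on on'.
    by move/(corner_inj pA (ltnW li) (leq0n _)): e'.
  move: e'; rewrite -corner_len => /(corner_inj pA (ltnW li) (leqnn _)) e'.
  by rewrite e' ltnn in li.
rewrite -pp in lj *; rewrite start_sg; case: ifP => [/eqP -> e|/negbT nb e].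
  by right; rewrite (corner_inj pA (ltnW lj) (ltnW li) e).
left; have [->] := corner_inj pA lj (ltnW li) e; split=> //.
by have [<-] := corner_inj pA lj (ltnW li) e; case: b nb {e}; case: (goes_right p j).
Qed.

Lemma polyline_vertex d v : d \in A -> on_polyline (route pt bends d.1 d.2) (pt v) ->
  v = d.1 \/ v = d.2.
Proof.
rewrite inE => ad on; case: plane => _ _ _ avoid _.
by have /set2P := avoid _ _ _ ad on.
Qed.

Lemma start_first d : start (sg d 0) (goes_right d 0) = pt d.1.
Proof. by rewrite start_sg eqxx. Qed.

Lemma drawn_vertex v s b : drawn s -> start s b = pt v ->
  exists w, [/\ (v, w) \in A, s = sg (v, w) 0 & b = goes_right (v, w) 0].
Proof.
move=> ds es; have rs := drawn_right ds.
suff [w [vw esg]] : exists w, (v, w) \in A /\ s = sg (v, w) 0.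
  exists w; split=> //; apply: (start_inj rs).
  by rewrite es esg start_first.
case: ds es => p [j [pE lj es]]; have pA := edges_darts pE; rewrite es start_sg => e.
have on : on_polyline (route pt bends p.1 p.2) (pt v).
  by apply: (on_route lj); rewrite -e; case: ifP => _; [apply: on_start|apply: on_end].
case: (polyline_vertex pA on) => vp.
  exists p.2; rewrite {1}vp -surjective_pairing; split=> //.
  move: e; rewrite vp -corner0; case: ifP => _ e.
    by rewrite (corner_inj pA (ltnW lj) (leq0n _) e) -surjective_pairing.
  by have := corner_inj pA lj (leq0n _) e.
exists p.1; rewrite vp -/(flip p) flip_darts; last exact: adj_sym.
split=> //; rewrite sg_flip //.
move: e; rewrite vp -corner_len; case: ifP => _ e.
  by have := corner_inj pA (ltnW lj) (leqnn _) e => ej; rewrite ej ltnn in lj.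
by rewrite -(corner_inj pA lj (leqnn _) e) subSS subn0.
Qed.

Definition left_weight x d := weight x (left_side (sg d 0) (goes_right d 0)).
Definition right_weight x d := weight x (right_side (sg d 0) (goes_right d 0)).

Lemma left_right_edge x p i b : p \in E -> (i < len p)%N ->
  weight x (left_side (sg p i) b) + weight x (right_side (sg p i) b) = x p.
Proof.
move=> pE li; rewrite -(weight_single x pE li) -weight_addb; apply: eq_weight => s _.
rewrite /left_side /right_side addbACA addbb addFb.
by case: b; case: (s == _).
Qed.

(** The left side seen from one end of a segment is the right side seen from the other. *)
Lemma across x u b : even_edges (@adj G) x -> drawn u ->
  weight x (left_side u b) = weight x (right_side u (~~ b)).
Proof.
move=> ev du; rewrite weight_left weight_right; congr (_ + _).
by case: b; rewrite /= up_weight.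
Qed.

Lemma bend_turn x p i : even_edges (@adj G) x -> p \in E -> (i.+1 < len p)%N ->
  weight x (right_side (sg p i) (~~ goes_right p i)) =
  weight x (left_side (sg p i.+1) (goes_right p i.+1)).
Proof.
move=> ev pE li; have pA := edges_darts pE.
have du : drawn (sg p i) by apply: drawn_sg => //; apply: ltnW.
have dv : drawn (sg p i.+1) by apply: drawn_sg.
have eu : start (sg p i) (~~ goes_right p i) = corner p i.+1.
  by rewrite start_sg; case: (goes_right p i).
have ew : start (sg p i.+1) (goes_right p i.+1) = corner p i.+1 by rewrite start_sg eqxx.
have only s b : drawn s -> start s b = start (sg p i.+1) (goes_right p i.+1) -> _ :=
  fun ds es => drawn_bend pE li ds (etrans es ew).
apply: turn => //; first by rewrite eu ew.
have [lt|le] := ltP (dir (sg p i.+1) (goes_right p i.+1)) (dir (sg p i) (~~ goes_right p i)).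
  left; split=> // s b ds es; case: (only s b ds es) => [[-> ->]|[-> ->]] //.
  by rewrite ltxx.
by right=> s b ds es; case: (only s b ds es) => [[-> ->]|[-> ->]].
Qed.

(** The parity is carried over each segment by [across] and over each bend by [bend_turn]. *)
Lemma along_edge x p : even_edges (@adj G) x -> p \in E ->
  left_weight x p = right_weight x (flip p).
Proof.
move=> ev pE; have pA := edges_darts pE.
have step i : (i < len p)%N ->
    left_weight x p = weight x (left_side (sg p i) (goes_right p i)).
  elim: i => // i IH li; rewrite IH ?(ltnW li) // across //; first exact: bend_turn.
  by apply: drawn_sg => //; apply: ltnW.
have ll : ((len p).-1 < len p)%N by [].
have dl := drawn_sg pA ll.
rewrite (step _ ll) across // /right_weight.
have -> : sg p (len p).-1 = sg (flip p) 0 by rewrite sg_flip // subn1.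
suff -> : ~~ goes_right p (len p).-1 = goes_right (flip p) 0 by [].
have fA : flip p \in A by rewrite flip_darts //; apply: adj_sym.
apply: (@start_inj (sg (flip p) 0)); first exact: sg_right.
rewrite start_first sg_flip // subn1 start_sg -corner_len.
by case: (goes_right p _).
Qed.

Lemma left_right_flip x p : p \in E -> left_weight x (flip p) + right_weight x (flip p) = x p.
Proof.
move=> pE; have pA := edges_darts pE.
rewrite /left_weight /right_weight sg_flip // subn1; exact: left_right_edge.
Qed.

(** For the other orientation: the left and right parities have the same sum at both ends of an
    edge, so the equation for [flip d] yields that for [d]. *)
Lemma along_dart x d : even_edges (@adj G) x -> d \in A ->
  left_weight x d = right_weight x (flip d).
Proof.
move=> ev dA; have [dE|dE] := boolP (d \in E); first exact: along_edge.
have fE : flip d \in E.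
  by have := dart_orient (@adj_sym G) (@adj_irr G) dA; rewrite -/E (negPf dE).
have e1 := left_right_flip x fE; rewrite flipK in e1.
have e2 : left_weight x (flip d) + right_weight x (flip d) = x (flip d).
  exact: left_right_edge.
have e3 := along_edge ev fE; rewrite flipK in e3.
have : left_weight x d + right_weight x d = left_weight x (flip d) + right_weight x (flip d).
  by rewrite e1 e2.
by rewrite e3 addrC => /addrI.
Qed.

Lemma sg_dart d d' i j : d \in A -> d' \in A -> (i < len d)%N -> (j < len d')%N ->
  sg d i = sg d' j -> d' = d \/ d' = flip d.
Proof.
have norm d0 k : d0 \in A -> (k < len d0)%N -> exists p k',
    [/\ p \in E, (k' < len p)%N, sg d0 k = sg p k' & d0 = p \/ d0 = flip p].
  move=> dA lk; have [dE|dE] := boolP (d0 \in E); first by exists d0, k; split=> //; left.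
  have fE : flip d0 \in E.
    by have := dart_orient (@adj_sym G) (@adj_irr G) dA; rewrite -/E (negPf dE).
  have fA := edges_darts fE.
  have lf : (len d0 - k.+1 < len d0)%N by rewrite ltn_subrL (leq_ltn_trans _ lk).
  exists (flip d0), (len d0 - k.+1)%N; split=> //; first by rewrite len_flip.
    by rewrite sg_flip // subnSK // subKn // ltnW.
  by right; rewrite flipK.
move=> dA dA' li lj; have [p [k [pE lk -> dp]]] := norm d i dA li.
have [p' [k' [pE' lk' -> dp']]] := norm d' j dA' lj.
move=> /(sg_inj pE pE' lk lk')[pp _]; rewrite -{}pp in dp'.
by case: dp dp' => [->|->] [->|->]; rewrite ?flipK; auto.
Qed.

(** The face to the left of [d] continues with the dart that follows [flip d] clockwise: the highest
    direction below that of [flip d] or, if there is none, the highest of all. *)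
Lemma next_dart d : d \in A -> (exists2 w, adj d.2 w & w != d.1) ->
  exists w, [/\ (d.2, w) \in A, w != d.1 &
    forall x, even_edges (@adj G) x -> left_weight x (d.2, w) = left_weight x d].
Proof.
move=> dA [w1 aw1 w1d]; set v := d.2; have fA : flip d \in A.
  by rewrite flip_darts //; apply: adj_sym.
pose k w := dir (sg (v, w) 0) (goes_right (v, w) 0).
have dr w : (v, w) \in A -> drawn (sg (v, w) 0) by move=> wA; apply: drawn_sg.
have turnv w : (v, w) \in A -> w != d.1 ->
    ((k w < k d.1)%O /\ forall w', (v, w') \in A -> (k w' < k d.1)%O -> (k w' <= k w)%O) \/
    (forall w', (v, w') \in A -> (k d.1 <= k w')%O /\ (k w' <= k w)%O) ->
  exists w, [/\ (v, w) \in A, w != d.1 &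
    forall x, even_edges (@adj G) x -> left_weight x (v, w) = left_weight x d].
  move=> wA wd cond; exists w; split=> // x ev; rewrite (along_dart ev dA).
  apply/esym; apply: turn => //; [exact: (dr d.1) | exact: dr | by rewrite !start_first | ].
  case: cond => [[lt between]|all]; [left; split=> // s b ds | right=> s b ds];
    rewrite start_first => /(drawn_vertex ds)[w' [wA' -> ->]].
    exact: between.
  exact: all.
have [w0 /andP[w0A lt0]|none] := pickP [pred w | ((v, w) \in A) && (k w < k d.1)%O].
  have P0 : ((v, w0) \in A) && (k w0 < k d.1)%O by rewrite w0A.
  case: (@arg_maxP _ _ _ w0 (fun w => ((v, w) \in A) && (k w < k d.1)%O) k P0).
  move=> w /andP[wA lt] max; apply: (turnv w wA).
    by apply: contraTneq lt => ->; rewrite ltxx.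
  by left; split=> // w' wA' lt'; apply: max; rewrite wA'.
have w1A : (v, w1) \in A by rewrite inE.
have ge w : (v, w) \in A -> (k d.1 <= k w)%O.
  by move=> wA; have := none w; rewrite /= wA /= leNgt => ->.
case: (@arg_maxP _ _ _ w1 (fun w => (v, w) \in A) k w1A) => w wA max.
apply: (turnv w wA); last by right=> w' wA'; split; [apply: ge | apply: max].
(* If [w] were [d.1], its direction would be both lowest and highest, and [w1] would share it. *)
apply: contraNneq w1d => wd; apply/eqP.
have kk : k w1 = k d.1 by apply/eqP; rewrite eq_le ge // -wd andbT; apply: max.
have es : sg (v, w1) 0 = sg (v, d.1) 0.
  by apply: dir_inj kk; rewrite ?start_first //; apply: dr.
case: (sg_dart w1A (fA : (v, d.1) \in A) (ltn0Sn _) (ltn0Sn _) es) => [[->]//|[vw _]].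
by move: aw1; rewrite -/v vw adj_irr.
Qed.

(** * Face lengths and edge bounds *)

Definition dart_form (p d : G * G) : 'F_2 :=
  \sum_(i < len p) (left_side (sg d 0) (goes_right d 0) (sg p i))%:R.

Lemma total_dart x d : total (@adj G) dart_form x d = left_weight x d.
Proof. by []. Qed.

Lemma plane_euler (g : nat) :
    (0 < #|A|)%N ->
    (forall d, d \in A -> exists2 C : {set G * G}, d \in C /\ (g <= #|C|)%N & C \subset A /\
      forall x d', even_edges (@adj G) x -> d' \in C -> left_weight x d' = left_weight x d) ->
  (g * (#|E| + 2) <= g * #|G| + #|A|)%N.
Proof.
move=> A0 cls; apply: (euler_count (@adj_sym G) (@adj_irr G) (P := dart_form)) => //.
move=> x p ev pE; rewrite !total_dart (along_edge ev pE) addrC; exact: left_right_flip.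
Qed.

(** This keeps face walks from turning back. *)
Hypothesis deg2 : forall u v : G, adj u v -> exists2 w, adj v w & w != u.

Lemma face_walk d : d \in A -> exists d', [/\ d' \in A, d'.1 = d.2, d'.2 != d.1 &
  forall x, even_edges (@adj G) x -> left_weight x d' = left_weight x d].
Proof.
move=> dA; have [|w [wA wd eqw]] := next_dart dA; first by apply: deg2; move: dA; rewrite inE.
by exists (d.2, w).
Qed.

Lemma dart_neq d : d \in A -> d.1 != d.2.
Proof. by rewrite inE; apply: contraTneq => ->; rewrite adj_irr. Qed.

(** Three successive darts of a walk that does not turn back are distinct, so g = 3. *)
Lemma plane_edges : (0 < #|A|)%N -> (#|E| + 6 <= 3 * #|G|)%N.
Proof.
move=> A0; have := card_darts (@adj_sym G) (@adj_irr G); rewrite -/A -/E => cA.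
have: (3 * (#|E| + 2) <= 3 * #|G| + #|A|)%N.
  apply: plane_euler => // d dA.
  have [d1 [d1A e1 n1 w1]] := face_walk dA; have [d2 [d2A e2 n2 w2]] := face_walk d1A.
  have n01 : d != d1.
    by apply: contraNneq (dart_neq dA) => dd; rewrite -e1 -dd.
  have n12 : d1 != d2.
    by apply: contraNneq (dart_neq d1A) => dd; rewrite -e2 -dd.
  have n02 : d != d2 by apply: contraNneq n1 => ->; rewrite e2.
  exists [set d; d1; d2]; split.
  - by rewrite !inE eqxx.
  - by rewrite setUC cardsU1 cards2 !inE negb_or n01 !(eq_sym d2) n02 n12.
  - by apply/subsetP=> d'; rewrite !inE -orbA => /or3P[] /eqP ->; move: dA d1A d2A; rewrite !inE.
  move=> x d' ev; rewrite !inE -orbA => /or3P[] /eqP -> //; first exact: w1.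
  by rewrite w2 ?w1.
by rewrite cA; clear; lia.
Qed.

(** Here g = 4: after three steps the walk starts from the other side of the bipartition, so the
    fourth dart is not the first. *)
Lemma plane_bipartite_edges (side : pred G) : (forall u v : G, adj u v -> side u != side v) ->
  (0 < #|A|)%N -> (#|E| + 4 <= 2 * #|G|)%N.
Proof.
move=> bip A0; have := card_darts (@adj_sym G) (@adj_irr G); rewrite -/A -/E => cA.
have sideA d : d \in A -> side d.2 = ~~ side d.1.
  by rewrite inE => /bip; case: (side _); case: (side _).
have: (4 * (#|E| + 2) <= 4 * #|G| + #|A|)%N.
  apply: plane_euler => // d dA.
  have [d1 [d1A e1 n1 w1]] := face_walk dA; have [d2 [d2A e2 n2 w2]] := face_walk d1A.
  have [d3 [d3A e3 n3 w3]] := face_walk d2A.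
  have n01 : d != d1.
    by apply: contraNneq (dart_neq dA) => dd; rewrite -e1 -dd.
  have n12 : d1 != d2.
    by apply: contraNneq (dart_neq d1A) => dd; rewrite -e2 -dd.
  have n23 : d2 != d3.
    by apply: contraNneq (dart_neq d2A) => dd; rewrite -e3 -dd.
  have n02 : d != d2 by apply: contraNneq n1 => ->; rewrite e2.
  have n13 : d1 != d3 by apply: contraNneq n2 => ->; rewrite e3.
  have n03 : d != d3.
    have: side d3.1 != side d.1.
      by rewrite e3 (sideA d2) // e2 (sideA d1) // e1 (sideA d) //; case: (side _).
    by apply: contraNneq => ->.
  exists [set d; d1; d2; d3]; split.
  - by rewrite !inE eqxx.
  - rewrite setUC cardsU1 setUC cardsU1 cards2 !inE !negb_or !(eq_sym d3) n03 n13 n23.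
    by rewrite !(eq_sym d2) n02 n12 n01.
  - apply/subsetP=> d'; rewrite !inE -!orbA => /or4P[] /eqP ->;
      by move: dA d1A d2A d3A; rewrite !inE.
  move=> x d' ev; rewrite !inE -!orbA => /or4P[] /eqP -> //; first exact: w1.
    by rewrite w2 ?w1.
  by rewrite w3 ?w2 ?w1.
by rewrite cA; clear; lia.
Qed.

End PlaneDrawing.

(** * Generic shears and drawings of subgraphs *)

Section Planar.
Local Open Scope ring_scope.
Variables (R : realType) (G : sgraph).
Variables (pt : G -> 'rV[R]_2) (bends : G -> G -> seq 'rV[R]_2).
Hypothesis plane : plane_drawing pt bends.

Lemma generic_shear : exists t : R, forall d i, d \in darts (@adj G) -> (i < len bends d)%N ->
  Xc t (corner pt bends d i) != Xc t (corner pt bends d i.+1).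
Proof.
(* The only shear that makes the segment vertical. For horizontal segments the division by 0 gives
   0, a harmless value, as no shear makes them vertical. *)
pose bad (a b : 'rV[R]_2) : R := (b 0 ord0 - a 0 ord0) / (a 0 ord_max - b 0 ord_max).
pose B d (i : nat) := bad (corner pt bends d i) (corner pt bends d i.+1).
exists (1 + \sum_(d : G * G) \sum_(i < len bends d) `|B d i|) => d i dA li.
set t := _ + _; have Bt : B d i < t.
  apply: le_lt_trans (ler_norm _) _; rewrite /t (bigD1 d) //= (bigD1 (Ordinal li)) //=.
  set S := \sum_(_ < _ | _) _; set S' := \sum_(_ | _) _.
  have S0 : 0 <= S by apply: sumr_ge0.
  have S0' : 0 <= S' by apply: sumr_ge0 => *; apply: sumr_ge0.
  by move: S0 S0'; rewrite -/S; clear; lra.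
clearbody t; apply/eqP=> eX; have ne : corner pt bends d i != corner pt bends d i.+1.
  by apply/eqP=> /(corner_inj plane dA (ltnW li) li)/eqP; rewrite eqn_leq ltnn andbF.
move: eX Bt ne; rewrite /B /bad /Xc; set a := corner _ _ d i; set b := corner _ _ d i.+1.
move=> eX Bt /eqP; apply.
have [e1|n1] := eqVneq (a 0 ord_max) (b 0 ord_max).
  move: eX; rewrite e1 => /addIr e0; apply/rowP=> j.
  have [->|->] // : j = ord0 \/ j = ord_max.
  by case: j => [[|[|//]]] lt; [left|right]; apply: val_inj.
have d0 : a 0 ord_max - b 0 ord_max != 0 by rewrite subr_eq0.
have et : t = (b 0 ord0 - a 0 ord0) / (a 0 ord_max - b 0 ord_max).
  by apply: (mulIf d0); rewrite divfK // mulrBr; move: eX; clear; lra.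
by rewrite -et ltxx in Bt.
Qed.

Lemma sub_drawing (H : sgraph) (f : H -> G) : injective f ->
  (forall u v, adj u v -> adj (f u) (f v)) ->
  plane_drawing (fun u => pt (f u)) (fun u v => bends (f u) (f v)).
Proof.
move=> fI fe; case: plane => ptI rv sim avoid cross; split.
- by move=> u v /ptI/fI.
- by move=> u v /fe; apply: rv.
- by move=> u v /fe; apply: sim.
- by move=> u v w /fe auv on; have := avoid _ _ _ auv on; rewrite !inE !(inj_eq fI).
move=> u v u' v' x /fe auv /fe auv' ne on on'.
have [|w] := cross _ _ _ _ x auv auv' _ on on'.
  apply: contraNneq ne => es; apply/eqP/setP=> w; have /setP/(_ (f w)) := es.
  by rewrite !inE !(inj_eq fI).
rewrite !inE => /andP[w1 w2] ->; case/orP: w1 w2 => /eqP ->.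
  by rewrite !(inj_eq fI) => w2; exists u; rewrite // !inE eqxx.
by rewrite !(inj_eq fI) => w2; exists v; rewrite // !inE eqxx orbT.
Qed.

End Planar.

Section SubDrawing.
Local Open Scope ring_scope.
Variables (R : realType) (G : sgraph).
Variables (pt : G -> 'rV[R]_2) (bends : G -> G -> seq 'rV[R]_2).
Hypothesis plane : plane_drawing pt bends.
Variables (Z : {set G}) (a : rel G).
Hypotheses (a_sym : symmetric a) (a_adj : subrel a (@adj G)).
Hypothesis a_in : forall u v, a u v -> u \in Z.
Hypothesis a_deg2 : forall u v, a u v -> exists2 w, a v w & w != u.

Let vtx := {u : G | u \in Z}.

Fact sub_sym : symmetric (fun u v : vtx => a (val u) (val v)).
Proof. by move=> u v; apply: a_sym. Qed.

Fact sub_irr : irreflexive (fun u v : vtx => a (val u) (val v)).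
Proof. by move=> u; apply/negP=> /a_adj; rewrite adj_irr. Qed.

Let sub := SGraph sub_sym sub_irr.

Lemma sub_deg2 (u v : sub) : adj u v -> exists2 w : sub, adj v w & w != u.
Proof.
move=> auv; have [w avw wu] := a_deg2 auv.
by exists (Sub w (a_in (etrans (a_sym _ _) avw))).
Qed.

Lemma card_sub_darts : #|darts (@adj sub)| = (\sum_(u in Z) #|[set v | a u v]|)%N.
Proof.
have -> : (\sum_(u in Z) #|[set v | a u v]|)%N = #|[set d : G * G | a d.1 d.2]|.
  rewrite -sum1_card; under eq_bigr do rewrite -sum1_card.
  rewrite pair_big_dep /=; apply: eq_bigl => d; rewrite !inE andbC.
  by case ad: (a _ _) => //=; apply: a_in ad.
pose vv (d : sub * sub) : G * G := (val d.1, val d.2).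
have vvI : injective vv by move=> [u v] [u' v'] [/val_inj -> /val_inj ->].
rewrite -(card_imset _ vvI); apply: eq_card => d; rewrite [in RHS]inE.
apply/imsetP/idP => [[[u v]]|ad]; first by rewrite inE => auv ->.
have da : a d.2 d.1 by rewrite a_sym.
exists (Sub d.1 (a_in ad), Sub d.2 (a_in da)); first by rewrite inE.
by rewrite /vv /=; case: (d).
Qed.

Lemma card_sub_vertices : #|sub| = #|Z|.
Proof. by rewrite card_sig. Qed.

Lemma sub_drawn : exists t : R, plane_drawing (fun u : sub => pt (val u))
    (fun u v : sub => bends (val u) (val v)) /\
  forall d i, d \in darts (@adj sub) -> (i < len (fun u v : sub => bends (val u) (val v)) d)%N ->
    Xc t (corner (fun u : sub => pt (val u)) (fun u v : sub => bends (val u) (val v)) d i) !=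
    Xc t (corner (fun u : sub => pt (val u)) (fun u v : sub => bends (val u) (val v)) d i.+1).
Proof.
have pl := @sub_drawing _ _ _ _ plane sub val val_inj (fun u v auv => a_adj auv).
by have [t gen] := generic_shear pl; exists t.
Qed.

Lemma sub_darts_gt0 u v : a u v -> (0 < #|darts (@adj sub)|)%N.
Proof.
move=> auv; rewrite card_sub_darts (bigD1 u) ?(a_in auv) //=; apply: ltn_addr.
by apply/card_gt0P; exists v; rewrite inE.
Qed.

Lemma sub_edges u v : a u v ->
  (\sum_(u in Z) #|[set v | a u v]| + 12 <= 6 * #|Z|)%N.
Proof.
move=> auv; have [t [pl gen]] := sub_drawn.
have := plane_edges pl gen sub_deg2 (sub_darts_gt0 auv).
rewrite card_sub_vertices -card_sub_darts.
by rewrite (card_darts (@adj_sym sub) (@adj_irr sub)); clear; lia.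
Qed.

Lemma sub_bipartite_edges (side : pred G) u v : a u v ->
    (forall u v, a u v -> side u != side v) ->
  (\sum_(u in Z) #|[set v | a u v]| + 8 <= 4 * #|Z|)%N.
Proof.
move=> auv bip; have [t [pl gen]] := sub_drawn.
have := plane_bipartite_edges pl gen sub_deg2 (side := fun u => side (val u))
  (fun u v auv => bip _ _ auv) (sub_darts_gt0 auv).
rewrite card_sub_vertices -card_sub_darts.
by rewrite (card_darts (@adj_sym sub) (@adj_irr sub)); clear; lia.
Qed.
End SubDrawing.

(** * Planar graphs *)

Lemma other_elem (T : finType) (A : {set T}) x : 1 < #|A| -> exists2 y, y \in A & y != x.
Proof.
move=> A1; have /card_gt0P[y] : 0 < #|A :\ x|.
  by move: A1; rewrite (cardsD1 x A); case: (x \in A) => //=; apply: ltnW.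
by rewrite !inE => /andP[yx yA]; exists y.
Qed.

Section PlanarSparse.
Variables (R : realType) (G : sgraph).
Hypothesis planarG : planar R G.

(** A vertex with at most two neighbours on the other side can be removed, since the right-hand side
    drops by two. Once there is none, face walks need not turn back and [sub_bipartite_edges]
    applies. *)
Lemma planar_bipartite (U W : {set G}) : [disjoint U & W] -> 3 <= #|U| + #|W| ->
  \sum_(u in U) #|nbr (@adj G) u :&: W| + 4 <= 2 * (#|U| + #|W|).
Proof.
have [pt [bends plane]] := planarG.
have [n] := ubnP (#|U| + #|W|); elim: n U W => // n IH U W; rewrite ltnS => le_n dis ge3.
have remove (U' W' : {set G}) v :
    #|U'| + #|W'| = #|U| + #|W| -> [disjoint U' & W'] -> 4 <= #|U| + #|W| ->
    v \in U' -> #|nbr (@adj G) v :&: W'| <= 2 ->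
    \sum_(u in U') #|nbr (@adj G) u :&: W'| + 4 <= 2 * (#|U| + #|W|).
  move=> eq dis' ge4 vU le2; have cU := cardsD1 v U'; rewrite vU in cU.
  have lt_n : #|U' :\ v| + #|W'| < n by move: le_n; rewrite -eq cU; clear; lia.
  have ge3' : 3 <= #|U' :\ v| + #|W'| by move: ge4; rewrite -eq cU; clear; lia.
  have le_sum := IH _ _ lt_n (disjointWl (subD1set _ _) dis') ge3'.
  by rewrite (big_setD1 v) //=; move: le2 le_sum cU eq; clear; lia.
(* Removal would leave fewer than three vertices; but three vertices span at most two edges, which
   is the bound. *)
have [le3|ge4] := leqP (#|U| + #|W|) 3.
  apply: (@leq_trans (#|U| * #|W| + 4)).
    rewrite leq_add2r -sum_nat_const; apply: leq_sum => u _.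
    exact/subset_leq_card/subsetIr.
  by move: ge3 le3; clear; nia.
have [u /andP[uU le2]|hiU] := pickP [pred u in U | #|nbr (@adj G) u :&: W| <= 2].
  exact: remove uU le2.
have [w /andP[wW le2]|hiW] := pickP [pred w in W | #|nbr (@adj G) w :&: U| <= 2].
  rewrite (sum_nbr (@adj_sym G)); apply: remove wW le2 => //; first by rewrite addnC.
  by rewrite disjoint_sym.
have {}hiU u : u \in U -> 2 < #|nbr (@adj G) u :&: W|.
  by move=> uU; rewrite ltnNge; move: (hiU u); rewrite /= uU /= => ->.
have {}hiW w : w \in W -> 2 < #|nbr (@adj G) w :&: U|.
  by move=> wW; rewrite ltnNge; move: (hiW w); rewrite /= wW /= => ->.
have notW u : u \in U -> u \in W = false by move=> uU; rewrite (disjointFr dis).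
pose a u v := adj u v && ((u \in U) && (v \in W) || (u \in W) && (v \in U)).
have a_sym : symmetric a.
  by move=> u v; rewrite /a adj_sym [X in _ = _ && X]orbC; congr (_ && (_ || _)); rewrite andbC.
have a_adj : subrel a (@adj G) by move=> u v /andP[].
have a_in u v : a u v -> u \in U :|: W.
  by rewrite inE => /andP[_ /orP[]/andP[-> _]]; rewrite ?orbT.
have nbrU u : u \in U -> [set v | a u v] = nbr (@adj G) u :&: W.
  by move=> uU; apply/setP=> v; rewrite !inE /a uU (notW u uU) /= ?orbF.
have nbrW w : w \in W -> [set v | a w v] = nbr (@adj G) w :&: U.
  by move=> wW; apply/setP=> v; rewrite !inE /a wW (disjointFl dis wW) /=.
have a_deg2 u v : a u v -> exists2 w, a v w & w != u.
  move=> auv; have : 2 < #|[set w | a v w]|.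
    have: v \in U :|: W by apply: (a_in v u); rewrite a_sym.
    by case/setUP=> vUW; [rewrite nbrU // hiU | rewrite nbrW // hiW].
  by move/ltnW/(other_elem u) => [w]; rewrite inE => avw wu; exists w.
have [u [v auv]] : exists u v, a u v.
  have /card_gt0P[v vUW] : 0 < #|U :|: W|.
    by rewrite cardsU (disjoint_setI0 dis) cards0 subn0; apply: leq_trans ge3.
  exists v; case/setUP: vUW => v_in.
    have /card_gt0P[u] : 0 < #|nbr (@adj G) v :&: W| by apply: ltn_trans (hiU v v_in).
    by rewrite -nbrU // inE; exists u.
  have /card_gt0P[u] : 0 < #|nbr (@adj G) v :&: U| by apply: ltn_trans (hiW v v_in).
  by rewrite -nbrW // inE; exists u.
have bip x y : a x y -> (x \in U) != (y \in U).
  case/andP=> _ /orP[]/andP[]; first by move=> -> yW; rewrite (disjointFl dis yW).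
  by move=> xW ->; rewrite (disjointFl dis xW).
have := sub_bipartite_edges plane a_sym a_adj a_in a_deg2 auv bip.
have -> : #|U :|: W| = #|U| + #|W| by rewrite cardsU (disjoint_setI0 dis) cards0 subn0.
rewrite (big_setID U) /= setUK setDUl setDv set0U.
have /setDidPl -> : [disjoint W & U] by rewrite disjoint_sym.
rewrite (eq_bigr _ (fun u uU => congr1 (fun A : {set G} => #|A|) (nbrU u uU))).
rewrite (eq_bigr _ (fun u uW => congr1 (fun A : {set G} => #|A|) (nbrW u uW))).
by rewrite -(sum_nbr (@adj_sym G) U W); clear; lia.
Qed.

(** Seven neighbours everywhere would give 7 |Z| + 12 <= 6 |Z|. Six is what [stuck_ge] can afford,
    having r - 2 >= 7 reachable colours. *)
Lemma planar_degenerate (Z : {set G}) : Z != set0 ->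
  exists2 v, v \in Z & #|nbr (@adj G) v :&: Z| <= 6.
Proof.
have [pt [bends plane]] := planarG.
case/set0Pn=> z zZ.
have [v /andP[vZ le]|hi] := pickP [pred v in Z | #|nbr (@adj G) v :&: Z| <= 6]; first by exists v.
have {}hi v : v \in Z -> 6 < #|nbr (@adj G) v :&: Z|.
  by move=> vZ; rewrite ltnNge; move: (hi v); rewrite /= vZ /= => ->.
pose a u v := [&& adj u v, u \in Z & v \in Z].
have a_sym : symmetric a by move=> u v; rewrite /a adj_sym; congr (_ && _); rewrite andbC.
have a_adj : subrel a (@adj G) by move=> u v /andP[].
have a_in u v : a u v -> u \in Z by case/and3P.
have nbrZ v : v \in Z -> [set u | a v u] = nbr (@adj G) v :&: Z.
  by move=> vZ; apply/setP=> u; rewrite !inE /a vZ.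
have a_deg2 u v : a u v -> exists2 w, a v w & w != u.
  rewrite a_sym => /a_in vZ.
  have /(other_elem u)[w] : 1 < #|[set u | a v u]|.
    by rewrite nbrZ //; apply: ltn_trans (hi v vZ).
  by rewrite inE; exists w.
have [v azv] : exists v, a z v.
  have /card_gt0P[v] : 0 < #|[set u | a z u]|.
    by rewrite nbrZ //; apply: ltn_trans (hi z zZ).
  by rewrite inE; exists v.
have := sub_edges plane a_sym a_adj a_in a_deg2 azv.
have: \sum_(u in Z) 7 <= \sum_(u in Z) #|[set v | a u v]|.
  by apply: leq_sum => u uZ; rewrite nbrZ // hi.
by rewrite sum_nat_const; clear; lia.
Qed.

End PlanarSparse.

Lemma leq_ceil_div n r : 0 < r -> n <= r * ceil_div n r.
Proof.
move=> r0; rewrite /ceil_div; have := ltn_ceil (n + r.-1) r0.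
by rewrite mulSn mulnC; move: r0; clear; lia.
Qed.

Theorem theorem4 (R : realType) (G : sgraph) (r : nat) :
  planar R G -> maxn 9 (max_degree G) <= r -> equitably_choosable G r.
Proof.
move=> planarG; rewrite geq_max => /andP[r9 deg] C L card_L.
(* Only finitely many colours occur in the lists; they form the finite colour type of the first
   part. *)
pose X := (\bigcup_(v <- enum G) L v)%fset.
pose L' (v : G) : {set X} := [set c | val c \in L v].
have LX v c : c \in L v -> c \in X.
  by move=> cL; apply/bigfcupP; exists v; rewrite ?mem_enum.
have card_L' v : #|L' v| = r.
  rewrite -(card_L v) cardE -(size_map val); apply/perm_size/uniq_perm => [||c].
  - by rewrite (map_inj_uniq val_inj) enum_uniq.
  - exact: fset_uniq.
  apply/mapP/idP => [[k]|cL]; first by rewrite mem_enum inE => kL ->.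
  by exists (FSetSub (LX v c cL)); rewrite ?mem_enum ?inE.
have deg_le v : #|nbr (@adj G) v| <= r.
  by apply: leq_trans deg; apply: (leq_bigmax v).
have r0 : 0 < r by apply: leq_trans r9.
have [f [prop_f list_f eq_f]] := sparse_equitable (@adj_sym G) (@adj_irr G) r9 card_L' deg_le
  (planar_bipartite planarG) (planar_degenerate planarG) (leq_ceil_div #|G| r0).
exists (fun v => val (f v)); split; first split.
- by move=> u v /prop_f; rewrite (inj_eq val_inj).
- by move=> v; have := list_f v; rewrite inE.
move=> c; have [cX|cX] := boolP (c \in X).
  apply: leq_trans (eq_f (FSetSub cX)); apply/subset_leq_card/subsetP=> v.
  by rewrite !inE.
rewrite (_ : [set v | _] = set0) ?cards0 //; apply/setP=> v; rewrite !inE.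
by apply: contraNF cX => /eqP <-; apply: valP.
Qed.
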